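(* Let $\mathbb{K}$ be a field of characteristic zero, let $n,k\ge 2$ be integers, let $m=(n-1)k+1$, and suppose $N\ge m$. Then: (1) There is a surjective map of $\mathfrak{S}_m$-modules $S^{\alpha(n,k)'}\to \mathrm{Lie}_n(m)$. (2) If $n\ge k$, then $\gamma_{n,k}=0$.
   Context: LAnKe. A LAnKe (Lie algebra of the $n$th kind, or Filippov algebra) over $\mathbb{K}$ is a $\mathbb{K}$-vector space $\mathcal{L}$ with an $n$-linear bracket $[-,\dots,-]:\mathcal{L}^n\to\mathcal{L}$ such that for all $x_i,y_j\in\mathcal{L}$: (i) $[x_1,\dots,x_n]=\operatorname{sgn}(\sigma)[x_{\sigma(1)},\dots,x_{\sigma(n)}]$ for every $\sigma\in\mathfrak{S}_n$; (ii) $[[x_1,\dots,x_n],y_1,\dots,y_{n-1}]=\sum_{i=1}^n[x_1,\dots,x_{i-1},[x_i,y_1,\dots,y_{n-1}],x_{i+1},\dots,x_n]$. $\mathrm{Lie}_n(m)$ and $\rho_{n,k}$. Let $m=(n-1)k+1$ and $[m]=\{1,\dots,m\}$. The multilinear component $\mathrm{Lie}_n(m)$ of the free LAnKe (with $n$-ary bracket) on the generating set $[m]$ is the subspace spanned by the bracketed words on $[m]$ in which each $i\in[m]$ appears exactly once (each such word has exactly $k$ brackets). The symmetric group $\mathfrak{S}_m$ acts on it by replacing $i$ by $\sigma(i)$ in each bracketed word; the resulting representation is denoted $\rho_{n,k}$. Specht modules. For a partition $\nu$ of $m$, $S^\nu$ denotes the (irreducible) Specht module of $\mathfrak{S}_m$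 over $\mathbb{K}$ (with $S^{(m)}$ trivial). Partitions/skew partitions are identified with their Young diagrams (English convention) and $'$ denotes conjugation. For a skew partition $\lambda/\mu$ with $|\lambda|-|\mu|=m$, the skew Specht module is $S^{\lambda/\mu}:=f(L_{\lambda'/\mu'})$. Here $L_{\lambda'/\mu'}$ is the skew Schur module of $GL_N(\mathbb{K})$, $N\ge m$: the polynomial representation with formal character the skew Schur polynomial $s_{\lambda/\mu}$ (this determines it up to isomorphism in characteristic zero); and $f$ is the Schur functor sending a homogeneous polynomial representation of degree $m$ to its weight space of weight $(1^m,0^{N-m})$, on which $\mathfrak{S}_m$ acts via permutation matrices permuting the first $m$ basis vectors. Equivalently $S^{\lambda/\mu}\simeq\bigoplus_\nu (S^\nu)^{\oplus c^{\lambda}_{\mu,\nu}}$, with $c^\lambda_{\mu,\nu}$ the Littlewood–Richardson coefficients. The shape. For $n,k\ge2$, $\alpha(n,k)$ is the skew partition $(n+k-2,n+k-3,\dots,n,n-1)/(k-2,k-2,k-3,\dots,2,1,0)$ (both partitions having $k$ parts). Its conjugate is $\alpha(n,k)'=(k^{n-1},k-1,k-2,\dots,1)/(k-1,k-2,\dots,2)$, where $k^{n-1}$ means that $k$ appears $n-1$ times. The modules $\beta_{n,k}$ and $\gamma_{n,k}$. For $n\ge2$, $\beta_{n,k}$ is the $\mathfrak{S}_m$-module whose decomposition into irreducibles is obtained by adding a row of length $k$ to the top of each Young diagram appearing (with multiplicity) in the decomposition into irreducibles of $\rho_{n-1,k}$; for $n=1$, $\rho_{1,k}=\beta_{1,k}=S^{(1)}$.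 It is a known theorem (Friedmann–Hanlon–Wachs) that $\rho_{n,k}\simeq\beta_{n,k}\oplus\gamma_{n,k}$ as $\mathfrak{S}_m$-modules for some $\mathfrak{S}_m$-module $\gamma_{n,k}$ all of whose irreducible constituents have Young diagrams with at most $k-1$ columns; this defines $\gamma_{n,k}$ up to isomorphism. (All diagrams occurring in $\beta_{n,k}$ have exactly $k$ columns, so $\gamma_{n,k}$ is the part of $\rho_{n,k}$ consisting of irreducibles whose diagrams have at most $k-1$ columns.) *)

(* Defs.v *)
From HB Require Import structures.
From mathcomp Require Import all_boot all_order all_algebra all_fingroup.
From mathcomp Require Import generic_quotient boolp mpoly.

Set Implicit Arguments.
Unset Strict Implicit.
Unset Printing Implicit Defensive.

Import GRing.Theory.
Local Open Scope ring_scope.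

(* Positions are numbered from 0.  [bcons u y] is (u, y_1, ..., y_(n-1)); the
   entry [y 0] is ignored. *)
Definition bcons (n : nat) (T : Type) (u : T) (y : 'I_n -> T) : 'I_n -> T :=
  fun j => if j == 0 :> nat then u else y j.

Definition bset (n : nat) (T : Type) (x : 'I_n -> T) (i : 'I_n) (u : T) : 'I_n -> T :=
  fun j => if j == i then u else x j.

Definition is_lanke (K : fieldType) (n : nat) (L : lmodType K)
    (br : ('I_n -> L) -> L) : Prop :=
  [/\ forall (x : 'I_n -> L) (i : 'I_n) (a : K) (u v : L),
        br (bset x i (a *: u + v)) =
        a *: br (bset x i u) + br (bset x i v),
      forall (x : 'I_n -> L) (s : 'S_n),
        br x = (-1) ^+ s *: br (fun j => x (s j))
    & forall x y : 'I_n -> L,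
        br (bcons (br x) y) =
        \sum_(i < n) br (bset x i (br (bcons (x i) y)))].

(* The free LAnKe on a set A of generators: formal expressions in the vector
   space operations, the bracket and the elements of A, modulo the smallest
   congruence containing the axioms of vector spaces and of LAnKes. *)
Section FreeLanke.
Variables (K : fieldType) (n : nat).

Inductive lterm (A : Type) : Type :=
| LGen of A
| LZero
| LAdd of lterm A & lterm A
| LScale of K & lterm A
| LBr of ('I_n -> lterm A).
Arguments LZero {A}.

Inductive lcong (A : Type) : lterm A -> lterm A -> Prop :=
| lcong_refl t : lcong t t
| lcong_sym t u : lcong t u -> lcong u t
| lcong_trans t u v : lcong t u -> lcong u v -> lcong t v
| lcong_add t t' u u' :
    lcong t t' -> lcong u u' -> lcong (LAdd t u) (LAdd t' u')
| lcong_scale a t t' : lcong t t' -> lcong (LScale a t) (LScale a t')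
| lcong_br x x' : (forall i, lcong (x i) (x' i)) -> lcong (LBr x) (LBr x')
| lcong_addA t u v : lcong (LAdd t (LAdd u v)) (LAdd (LAdd t u) v)
| lcong_addC t u : lcong (LAdd t u) (LAdd u t)
| lcong_add0 t : lcong (LAdd LZero t) t
| lcong_addN t : lcong (LAdd (LScale (-1) t) t) LZero
| lcong_scaleA a b t : lcong (LScale a (LScale b t)) (LScale (a * b) t)
| lcong_scale1 t : lcong (LScale 1 t) t
| lcong_scaleDr a t u :
    lcong (LScale a (LAdd t u)) (LAdd (LScale a t) (LScale a u))
| lcong_scaleDl a b t :
    lcong (LScale (a + b) t) (LAdd (LScale a t) (LScale b t))
| lcong_linear x i a u v :
    lcong (LBr (bset x i (LAdd (LScale a u) v)))
      (LAdd (LScale a (LBr (bset x i u))) (LBr (bset x i v)))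
| lcong_skew x (s : 'S_n) :
    lcong (LBr x) (LScale ((-1) ^+ s) (LBr (fun j => x (s j))))
| lcong_filippov x y :
    lcong (LBr (bcons (LBr x) y))
      (\big[@LAdd A/LZero]_(i < n) LBr (bset x i (LBr (bcons (x i) y)))).

HB.instance Definition _ A := gen_eqMixin (lterm A).
HB.instance Definition _ A := gen_choiceMixin (lterm A).

Section Quotient.
Variable A : Type.

Definition lcongb (t u : lterm A) : bool := `[< lcong t u >].

Fact lcongb_equiv : equiv_class_of lcongb.
Proof.
split=> [t|t u|u t v].
- by apply/asboolP; apply: lcong_refl.
- by apply/asboolP/asboolP; apply: lcong_sym.
- by move=> /asboolP ? /asboolP ?; apply/asboolP; apply: lcong_trans; eauto.
Qed.

Canonical lcongb_equiv_rel := EquivRelPack lcongb_equiv.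

Definition free_lanke := {eq_quot lcongb}%qT.
HB.instance Definition _ := Choice.on free_lanke.
HB.instance Definition _ := EqQuotient.on free_lanke.

Local Open Scope quotient_scope.
Local Notation pi := (\pi_free_lanke).

Lemma lpiP (t u : lterm A) : (pi t = pi u) <-> lcong t u.
Proof. by split=> [/eqmodP/asboolP|h]; last apply/eqmodP/asboolP. Qed.

Lemma lreprP (t : lterm A) : lcong (repr (pi t)) t.
Proof. by apply/lpiP; rewrite reprK. Qed.

Definition fl_zero : free_lanke := pi LZero.
Definition fl_add (x y : free_lanke) : free_lanke := pi (LAdd (repr x) (repr y)).
Definition fl_scale (a : K) (x : free_lanke) : free_lanke :=
  pi (LScale a (repr x)).
Definition fl_opp (x : free_lanke) : free_lanke := fl_scale (-1) x.

Definition lbr (x : 'I_n -> free_lanke) : free_lanke :=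
  pi (LBr (fun i => repr (x i))).
Definition lgen (a : A) : free_lanke := pi (LGen a).

Lemma fl_addE t u : fl_add (pi t) (pi u) = pi (LAdd t u).
Proof. by apply/lpiP; apply: lcong_add; apply: lreprP. Qed.
Lemma fl_scaleE a t : fl_scale a (pi t) = pi (LScale a t).
Proof. by apply/lpiP; apply: lcong_scale; apply: lreprP. Qed.
Lemma lbrE x : lbr (fun i => pi (x i)) = pi (LBr x).
Proof. by apply/lpiP; apply: lcong_br => i; apply: lreprP. Qed.

Fact fl_addA : associative fl_add.
Proof.
by elim/quotW=> t; elim/quotW=> u; elim/quotW=> v;
  rewrite (fl_addE u v) (fl_addE t (LAdd u v)) (fl_addE t u) (fl_addE (LAdd t u) v);
  apply/lpiP; apply: lcong_addA.
Qed.
Fact fl_addC : commutative fl_add.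
Proof.
by elim/quotW=> t; elim/quotW=> u; rewrite (fl_addE t u) (fl_addE u t);
  apply/lpiP; apply: lcong_addC.
Qed.
Fact fl_add0 : left_id fl_zero fl_add.
Proof. by elim/quotW=> t; rewrite (fl_addE _ t); apply/lpiP; apply: lcong_add0. Qed.
Fact fl_addN : left_inverse fl_zero fl_opp fl_add.
Proof.
by elim/quotW=> t; rewrite /fl_opp (fl_scaleE _ t) (fl_addE _ t); apply/lpiP; apply: lcong_addN.
Qed.
HB.instance Definition _ :=
  GRing.isZmodule.Build free_lanke fl_addA fl_addC fl_add0 fl_addN.

Fact fl_scaleA a b x : fl_scale a (fl_scale b x) = fl_scale (a * b) x.
Proof.
by elim/quotW: x => t; rewrite (fl_scaleE b t) !(fl_scaleE _ t) (fl_scaleE a);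
  apply/lpiP; apply: lcong_scaleA.
Qed.
Fact fl_scale1 : left_id 1 fl_scale.
Proof. by elim/quotW=> t; rewrite (fl_scaleE _ t); apply/lpiP; apply: lcong_scale1. Qed.
Fact fl_scaleDr : right_distributive fl_scale +%R.
Proof.
move=> a; elim/quotW=> t; elim/quotW=> u.
rewrite -[_ + _]/(fl_add _ _) (fl_addE t u) (fl_scaleE a t) (fl_scaleE a u).
rewrite -[RHS]/(fl_add _ _) fl_addE fl_scaleE.
by apply/lpiP; apply: lcong_scaleDr.
Qed.
Fact fl_scaleDl x : {morph fl_scale^~ x : a b / a + b}.
Proof.
move=> a b; elim/quotW: x => t; rewrite !(fl_scaleE _ t) -[RHS]/(fl_add _ _) fl_addE.
by apply/lpiP; apply: lcong_scaleDl.
Qed.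
HB.instance Definition _ := GRing.Zmodule_isLmodule.Build K free_lanke
  fl_scaleA fl_scale1 fl_scaleDr fl_scaleDl.

Lemma lpi0 : pi LZero = 0. Proof. by []. Qed.
Lemma lpiD t u : pi (LAdd t u) = pi t + pi u.
Proof. by rewrite -fl_addE. Qed.
Lemma lpiZ a t : pi (LScale a t) = a *: pi t.
Proof. by rewrite -fl_scaleE. Qed.
Lemma lpiB x : pi (LBr x) = lbr (fun i => pi (x i)).
Proof. by rewrite lbrE. Qed.

Lemma quot_fun (I : Type) (x : I -> free_lanke) : exists t, x = fun i => pi (t i).
Proof. by exists (fun i => repr (x i)); apply: funext => i; rewrite reprK. Qed.

Lemma pi_with (x : 'I_n -> lterm A) (i : 'I_n) t :
  (bset (fun j => pi (x j)) i (pi t)) =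
  (fun j => pi (bset x i t j)).
Proof. by apply: funext => j; rewrite /bset; case: eqP. Qed.

Lemma pi_bcons t (x : 'I_n -> lterm A) :
  bcons (pi t) (fun j => pi (x j)) = (fun j => pi (bcons t x j)).
Proof. by apply: funext => j; rewrite /bcons; case: eqP. Qed.

Theorem free_lankeP : is_lanke lbr.
Proof.
split=> [x i a|x s|x y].
- elim/quotW=> u; elim/quotW=> v; have [t ->] := quot_fun x.
  by rewrite -lpiZ -lpiD !pi_with !lbrE -lpiZ -lpiD; apply/lpiP; apply: lcong_linear.
- have [t ->] := quot_fun x.
  rewrite lbrE (lbrE (fun j => t (s j))) -lpiZ.
  by apply/lpiP; apply: lcong_skew.
- have [t ->] := quot_fun x; have [u ->] := quot_fun y.
  rewrite lbrE pi_bcons lbrE (iffRL (lpiP _ _) (lcong_filippov t u)).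
  rewrite (big_morph (fun t => pi t) lpiD lpi0); apply: eq_bigr => i _.
  by rewrite pi_bcons lbrE pi_with lbrE.
Qed.

End Quotient.

Section UniversalProperty.
Variables (A : Type) (L : lmodType K) (br : ('I_n -> L) -> L) (x : A -> L).

Fixpoint leval (t : lterm A) : L :=
  match t with
  | LGen a => x a
  | LZero => 0
  | LAdd t u => leval t + leval u
  | LScale a t => a *: leval t
  | LBr ts => br (fun i => leval (ts i))
  end.

Lemma leval_cong t u : is_lanke br -> lcong t u -> leval t = leval u.
Proof.
have with_ (f : 'I_n -> lterm A) i v :
    (fun j => leval (bset f i v j)) =
    (bset (fun j => leval (f j)) i (leval v)).
  by apply: funext => j; rewrite /bset; case: eqP.
have cons_ (f : 'I_n -> lterm A) v :
    (fun j => leval (bcons v f j)) = bcons (leval v) (fun j => leval (f j)).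
  by apply: funext => j; rewrite /bcons; case: eqP.
case=> Hlin Hskew Hfil; elim=> {t u} //=.
- by move=> t u v _ -> _ ->.
- by move=> t t' u u' _ -> _ ->.
- by move=> a t t' _ ->.
- by move=> y y' _ IH; congr br; apply: funext.
- by move=> *; rewrite addrA.
- by move=> *; rewrite addrC.
- by move=> *; rewrite add0r.
- by move=> *; rewrite scaleN1r addNr.
- by move=> *; rewrite scalerA.
- by move=> *; rewrite scale1r.
- by move=> *; rewrite scalerDr.
- by move=> *; rewrite scalerDl.
- by move=> y i a u v; rewrite !with_ /= Hlin.
- move=> y y'; rewrite cons_ /= Hfil.
  rewrite (big_morph leval (id1 := 0) (op1 := +%R)) //=.
  by apply: eq_bigr => i _; rewrite with_ /= cons_.
Qed.

Definition free_lift (y : free_lanke A) : L := leval (repr y).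

Hypothesis H : is_lanke br.

Lemma free_lift_pi t : free_lift (\pi_(free_lanke A)%qT t) = leval t.
Proof. by apply: leval_cong => //; apply: lreprP. Qed.

Lemma free_lift_linear : linear free_lift.
Proof.
move=> a; elim/quotW=> t; elim/quotW=> u.
by rewrite -lpiZ -lpiD !free_lift_pi.
Qed.

Lemma free_lift_br y : free_lift (lbr y) = br (fun i => free_lift (y i)).
Proof.
have [t ->] := quot_fun y; rewrite lbrE free_lift_pi /=.
by congr br; apply: funext => i; rewrite free_lift_pi.
Qed.

Lemma free_lift_gen a : free_lift (lgen a) = x a.
Proof. exact: free_lift_pi. Qed.

Lemma free_lift_unique (g : free_lanke A -> L) :
    linear g -> (forall y, g (lbr y) = br (fun i => g (y i))) ->
    (forall a, g (lgen a) = x a) ->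
  g = free_lift.
Proof.
move=> glin gbr ggen; apply: funext; elim/quotW=> t; rewrite free_lift_pi.
have g0 : g 0 = 0.
  by have := glin (-1) 0 0; rewrite !scaleN1r !addNr.
elim: t => /= [a||t <- u <-|a t <-|ts IH].
- by rewrite -ggen.
- by rewrite -g0.
- have := glin 1 (\pi_(free_lanke A)%qT t) (\pi_(free_lanke A)%qT u).
  by rewrite !scale1r -lpiD.
- have := glin a (\pi_(free_lanke A)%qT t) 0.
  by rewrite g0 !addr0 -lpiZ.
- by rewrite lpiB gbr; congr br; apply: funext => i; rewrite IH.
Qed.

Theorem free_lanke_universal :
  exists! f : free_lanke A -> L,
    [/\ linear f, forall y, f (lbr y) = br (fun i => f (y i))
      & forall a, f (lgen a) = x a].
Proof.
exists free_lift; split; last first.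
  by move=> g [? ? ?]; symmetry; apply: free_lift_unique.
by split; [exact: free_lift_linear|exact: free_lift_br|exact: free_lift_gen].
Qed.

End UniversalProperty.

Definition lrename (A B : Type) (f : A -> B) : free_lanke A -> free_lanke B :=
  free_lift (@lbr B) (fun a => lgen (f a)).

Lemma lrename_id A (y : free_lanke A) : lrename id y = y.
Proof.
by rewrite /lrename -(@free_lift_unique A _ _ _ (free_lankeP A) id).
Qed.

Lemma lrename_comp A B C (f : A -> B) (g : B -> C) y :
  lrename g (lrename f y) = lrename (g \o f) y.
Proof.
pose h y := lrename g (lrename f y); rewrite -/(h y).
rewrite /lrename -(@free_lift_unique A _ _ _ (free_lankeP C) h) //.
- by move=> a u v; rewrite /h /lrename !free_lift_linear //; apply: free_lankeP.
- by move=> z; rewrite /h /lrename !free_lift_br //; apply: free_lankeP.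
- by move=> z; rewrite /h /lrename !free_lift_gen //; apply: free_lankeP.
Qed.

Inductive bword (A : Type) : Type :=
| Letter of A
| Bracket of ('I_n -> bword A).

Fixpoint word_elt (A : Type) (w : bword A) : free_lanke A :=
  match w with
  | Letter a => lgen a
  | Bracket ws => lbr (fun i => word_elt (ws i))
  end.

Fixpoint occ (A : eqType) (a : A) (w : bword A) : nat :=
  match w with
  | Letter b => a == b
  | Bracket ws => \sum_(i < n) occ a (ws i)
  end.

Definition multilinear_word (m : nat) (w : bword 'I_m) : Prop :=
  forall i : 'I_m, occ i w = 1%N.

Fixpoint word_rename (A B : Type) (f : A -> B) (w : bword A) : bword B :=
  match w with
  | Letter a => Letter (f a)
  | Bracket ws => Bracket (fun i => word_rename f (ws i))
  end.

Lemma lrename_word A B (f : A -> B) w :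
  lrename f (word_elt w) = word_elt (word_rename f w).
Proof.
elim: w => [a|ws IH] /=; first by rewrite /lrename free_lift_gen //; apply: free_lankeP.
rewrite /lrename free_lift_br; last exact: free_lankeP.
by congr lbr; apply: funext.
Qed.

Lemma occ_rename m (s : 'S_m) (i : 'I_m) w : occ (s i) (word_rename s w) = occ i w.
Proof.
elim: w => [a|ws IH] /=; first by rewrite (inj_eq perm_inj).
by apply: eq_bigr => j _.
Qed.

End FreeLanke.

(* Left modules over the group of permutations of {0, .., m-1} under
   composition; [s * t] is the permutation applying s first, then t. *)
Record symModule (K : fieldType) (m : nat) := SymModule {
  sm_carrier :> lmodType K;
  act : 'S_m -> sm_carrier -> sm_carrier;
  act_linear : forall s, linear (act s);
  act1 : forall v, act 1%g v = v;
  actM : forall s t v, act (s * t)%g v = act t (act s v)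
}.

Section SymModules.
Variables (K : fieldType) (m : nat).
Implicit Types V W : symModule K m.

Lemma act0 V s : act s (0 : V) = 0.
Proof. by have := act_linear s (-1) (0 : V) 0; rewrite !scaleN1r !addNr. Qed.
Lemma actD V s : {morph @act K m V s : u v / u + v}.
Proof. by move=> u v; have := act_linear s 1 u v; rewrite !scale1r. Qed.
Lemma actZ V s a (v : V) : act s (a *: v) = a *: act s v.
Proof. by have := act_linear s a v 0; rewrite act0 !addr0. Qed.

Definition equivariant V W (f : V -> W) : Prop :=
  forall s v, f (act s v) = act s (f v).

Definition sm_surjects V W : Prop :=
  exists2 f : {linear V -> W}, equivariant f & forall w, exists v, f v = w.

Definition sm_iso V W : Prop :=
  exists2 f : {linear V -> W}, equivariant f & bijective f.

Definition sm_is_zero V : Prop := forall v : V, v = 0.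

Section DirectSum.
Variables V W : symModule K m.
Definition sum_act (s : 'S_m) (v : V * W) : V * W := (act s v.1, act s v.2).
Fact sum_act_linear s : linear (sum_act s).
Proof. by move=> a u v; rewrite /sum_act /= !act_linear. Qed.
Fact sum_act1 v : sum_act 1%g v = v.
Proof. by case: v => v w; rewrite /sum_act !act1. Qed.
Fact sum_actM s t v : sum_act (s * t)%g v = sum_act t (sum_act s v).
Proof. by rewrite /sum_act !actM. Qed.
Definition sm_sum : symModule K m := SymModule sum_act_linear sum_act1 sum_actM.
End DirectSum.

Definition sm_zero : symModule K m :=
  @SymModule K m 'rV[K]_0 (fun _ v => v)
    (fun _ _ _ _ => erefl) (fun _ => erefl) (fun _ _ _ => erefl).

Definition sm_bigsum (s : seq (symModule K m)) : symModule K m :=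
  foldr sm_sum sm_zero s.

Definition is_submodule V (P : V -> Prop) : Prop :=
  [/\ P 0, forall a u v, P u -> P v -> P (a *: u + v)
    & forall s v, P v -> P (act s v)].

Section Submodule.
Variables (V : symModule K m) (P : V -> Prop) (HP : is_submodule P).

Definition sub_pred of is_submodule P : {pred V} := fun v => `[< P v >].
Local Notation S := (sub_pred HP).

Fact sub_pred_closed : submod_closed S.
Proof.
have [P0 Plin _] := HP; split=> [|a u v /asboolP Pu /asboolP Pv]; apply/asboolP => //.
exact: Plin.
Qed.
HB.instance Definition _ := GRing.isSubmodClosed.Build K V S sub_pred_closed.

Record sub_carrier := SubCarrier { sub_val :> V; _ : sub_val \in S }.
HB.instance Definition _ := [isSub for sub_val].
HB.instance Definition _ := [Choice of sub_carrier by <:].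
HB.instance Definition _ := [SubChoice_isSubLmodule of sub_carrier by <:].

Fact sub_act_closed s (v : sub_carrier) : act s (sub_val v) \in S.
Proof. by have [_ _ PA] := HP; apply/asboolP/PA/asboolP/(valP v). Qed.
Definition sub_act s (v : sub_carrier) : sub_carrier :=
  SubCarrier (sub_act_closed s v).
Fact sub_act_linear s : linear (sub_act s).
Proof. by move=> a u v; apply: val_inj; rewrite /= act_linear. Qed.
Fact sub_act1 v : sub_act 1%g v = v.
Proof. by apply: val_inj; apply: act1. Qed.
Fact sub_actM s t v : sub_act (s * t)%g v = sub_act t (sub_act s v).
Proof. by apply: val_inj; apply: actM. Qed.
Definition submodule : symModule K m := SymModule sub_act_linear sub_act1 sub_actM.
End Submodule.

Section Span.
Variables (V : symModule K m) (G : V -> Prop).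

Definition span_of (v : V) : Prop :=
  exists (r : nat) (a : 'I_r -> K) (g : 'I_r -> V),
    (forall i, G (g i)) /\ v = \sum_(i < r) a i *: g i.

Hypothesis GA : forall s v, G v -> G (act s v).

Fact span_submodule : is_submodule span_of.
Proof.
split.
- exists 0%N, (fun _ => 0), (fun _ => 0); split; first by case.
  by rewrite big_ord0.
- move=> a u v [r [b [g [Gg ->]]]] [r' [b' [g' [Gg' ->]]]].
  exists (r + r')%N, (fun i => match split i with inl j => a * b j | inr j => b' j end),
    (fun i => match split i with inl j => g j | inr j => g' j end).
  split; first by move=> i; case: split.
  rewrite big_split_ord /= scaler_sumr; congr (_ + _); apply: eq_bigr => i _.
    by rewrite (unsplitK (inl i)) scalerA.
  by rewrite (unsplitK (inr i)).
- move=> s v [r [b [g [Gg ->]]]]; exists r, b, (fun i => act s (g i)); split.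
    by move=> i; apply: GA.
  rewrite (big_morph _ (actD s) (act0 V s)); apply: eq_bigr => i _.
  exact: actZ.
Qed.

Definition span_module : symModule K m := submodule span_submodule.
End Span.

End SymModules.

Section Lie.
Variables (K : fieldType) (n m : nat).

Definition free_act (s : 'S_m) : free_lanke K n 'I_m -> free_lanke K n 'I_m :=
  lrename s.
Fact free_act_linear s : linear (free_act s).
Proof. by apply: free_lift_linear; apply: free_lankeP. Qed.
Fact free_act1 v : free_act 1%g v = v.
Proof.
rewrite /free_act -[RHS]lrename_id; congr (lrename _ _).
by apply: funext => i; rewrite perm1.
Qed.
Fact free_actM s t v : free_act (s * t)%g v = free_act t (free_act s v).
Proof.
rewrite /free_act lrename_comp; congr (lrename _ _).
by apply: funext => i; rewrite permM.
Qed.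
Definition free_lanke_module : symModule K m :=
  SymModule free_act_linear free_act1 free_actM.

Definition multilinear_elt (v : free_lanke_module) : Prop :=
  exists2 w : bword n 'I_m, multilinear_word w & v = word_elt K w.

Fact multilinear_elt_act s v : multilinear_elt v -> multilinear_elt (act s v).
Proof.
case=> w Hw ->; exists (word_rename s w); last exact: lrename_word.
by move=> i; rewrite -[i](permKV s) occ_rename.
Qed.

Definition Lie : symModule K m := span_module multilinear_elt_act.
End Lie.

Definition is_partition (m : nat) (nu : seq nat) : bool :=
  [&& sorted geq nu, 0%N \notin nu & sumn nu == m].

(* The boxes of the diagram of nu are numbered row by row: box p is in row
   [reshape_index nu p] and column [reshape_offset nu p].  A tableau of shape
   nu is given by the permutation t mapping each box to its entry. *)
Section Specht.
Variables (K : fieldType) (m : nat) (nu : seq nat).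

Definition tabloidT := {ffun 'I_(size nu) -> {set 'I_m}}.

Definition tabloid (t : 'S_m) : tabloidT :=
  [ffun r : 'I_(size nu) => [set t p | p : 'I_m & reshape_index nu p == r]].

Definition tabloid_space := {ffun tabloidT -> K^o}.

Definition tabloid_vec (T : tabloidT) : tabloid_space := [ffun T' => (T' == T)%:R].

(* (s f) T = f (s^-1 T), so that s maps the basis vector of T to that of s T. *)
Definition tabloid_act (s : 'S_m) (f : tabloid_space) : tabloid_space :=
  [ffun T : tabloidT => f [ffun r : 'I_(size nu) => s @^-1: T r]].

Fact tabloid_act_linear s : linear (tabloid_act s).
Proof. by move=> a u v; apply/ffunP => T; rewrite !ffunE. Qed.
Fact tabloid_act1 v : tabloid_act 1%g v = v.
Proof.
apply/ffunP => T; rewrite ffunE; congr (v _); apply/ffunP => r; rewrite ffunE.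
by apply/setP => i; rewrite inE perm1.
Qed.
Fact tabloid_actM s t v : tabloid_act (s * t)%g v = tabloid_act t (tabloid_act s v).
Proof.
apply/ffunP => T; rewrite !ffunE; congr (v _); apply/ffunP => r; rewrite !ffunE.
by apply/setP => i; rewrite !inE permM.
Qed.
Definition tabloid_module : symModule K m :=
  SymModule tabloid_act_linear tabloid_act1 tabloid_actM.

Definition column_stab (t : 'S_m) : pred 'S_m := fun s =>
  [forall p, reshape_offset nu ((t^-1)%g (s (t p))) == reshape_offset nu p].

Definition polytabloid (t : 'S_m) : tabloid_module :=
  \sum_(s | column_stab t s) (-1) ^+ s *: tabloid_vec (tabloid (t * s)%g).

Definition is_polytabloid (v : tabloid_module) : Prop :=
  exists t, v = polytabloid t.

Fact tabloid_act_vec s t :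
  tabloid_act s (tabloid_vec (tabloid t)) = tabloid_vec (tabloid (t * s)%g).
Proof.
apply/ffunP => T; rewrite !ffunE; congr (_%:R); congr nat_of_bool.
apply/eqP/eqP => [E|->].
  apply/ffunP => r; move/ffunP/(_ r): E; rewrite !ffunE => E.
  apply/setP => i; rewrite -[i](permKV s).
  have := congr1 (fun X : {set 'I_m} => (s^-1)%g i \in X) E; rewrite /= inE => ->.
  apply/imsetP/imsetP => -[p Hp e]; exists p => //; last first.
    by apply: (@perm_inj _ s); rewrite e permM.
  by rewrite permM e.
apply/ffunP => r; rewrite !ffunE; apply/setP => i; rewrite inE.
apply/imsetP/imsetP => -[p Hp e]; exists p => //.
  by apply: (@perm_inj _ s); rewrite e permM.
by rewrite permM e.
Qed.

Fact is_polytabloid_act s v : is_polytabloid v -> is_polytabloid (act s v).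
Proof.
case=> t ->; exists (t * s)%g; rewrite /polytabloid.
rewrite (big_morph _ (@actD _ _ tabloid_module s) (act0 tabloid_module s)).
rewrite [RHS](reindex_inj (conjg_inj s)) /=.
apply: eq_big => [p|p _].
  apply: eq_forallb => q; by rewrite invMg !permM !permK.
rewrite [LHS](@actZ _ _ tabloid_module) odd_permJ; congr (_ *: _).
rewrite [LHS]tabloid_act_vec; by rewrite conjgE !mulgA mulgK.
Qed.

Definition specht : symModule K m := span_module is_polytabloid_act.
End Specht.

Definition decomposes (K : fieldType) (m : nat) (V : symModule K m)
    (s : seq (seq nat)) : Prop :=
  all (is_partition m) s /\
  sm_iso V (sm_bigsum [seq specht K m nu | nu <- s]).

Definition mdeg (n k : nat) : nat := ((n - 1) * k + 1)%N.

Section RhoBetaGamma.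
Variables (K : fieldType) (n k : nat).

Definition rho : symModule K (mdeg n k) :=
  if n == 1%N then specht K (mdeg n k) [:: 1%N] else Lie K n (mdeg n k).

End RhoBetaGamma.

Definition is_beta (K : fieldType) (n k : nat) (B : symModule K (mdeg n k)) : Prop :=
  exists2 s : seq (seq nat), decomposes (rho K (n - 1) k) s
    & decomposes B [seq k :: nu | nu <- s].

(* This determines C up to isomorphism only; the diagram of nu has [head 0 nu]
   columns. *)
Definition is_gamma (K : fieldType) (n k : nat) (C : symModule K (mdeg n k)) : Prop :=
  (exists2 B, is_beta B & sm_iso (rho K n k) (sm_sum B C)) /\
  (exists2 s : seq (seq nat), decomposes C s
    & all (fun nu => head 0 nu <= k - 1)%N s).

Section VspaceOf.
Variables (K : fieldType) (vT : vectType K) (P : vT -> Prop).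

Fact ex_vspace_of : P 0 -> (forall a u v, P u -> P v -> P (a *: u + v)) ->
  exists U : {vspace vT}, forall v, v \in U <-> P v.
Proof.
move=> P0 Plin.
pose Q d := `[< exists2 U : {vspace vT}, \dim U = d & forall v, v \in U -> P v >].
have Q0 : exists d, Q d.
  exists 0%N; apply/asboolP; exists 0%VS; first exact: dimv0.
  by move=> v; rewrite memv0 => /eqP ->.
have Qb d : Q d -> (d <= \dim {: vT})%N.
  by case/asboolP => U <- _; rewrite dimvS ?subvf.
case: (ex_maxnP Q0 Qb) => d /asboolP [U dU UP] dmax.
exists U => v; split; first exact: UP.
move=> Pv; apply/negPn/negP => vU.
have : Q (\dim (U + <[v]>)%VS).
  apply/asboolP; exists (U + <[v]>)%VS => // _ /memv_addP [u uU [_ /vlineP [a ->] ->]].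
  by rewrite addrC; apply: Plin => //; apply: UP.
move/dmax; rewrite -dU leqNgt => /negP; apply.
rewrite ltnNge; apply/negP => le.
have /eqP E : U == (U + <[v]>)%VS by rewrite eqEdim addvSl le.
by move: vU; rewrite E memvE addvSr.
Qed.
End VspaceOf.

(* Homogeneous polynomial representations of GL_N(K) of degree e on the space
   of column vectors K^d; the N * N variables are the entries of the matrix,
   in the order of [mxvec]. *)
Definition peval (K : fieldType) (N d : nat) (A : 'M[{mpoly K[N * N]}]_d)
    (g : 'M[K]_N) : 'M[K]_d :=
  \matrix_(i, j) (A i j).@[mxvec g 0].

Record polyRep (K : fieldType) (N e d : nat) := PolyRep {
  pr_mx : 'M[{mpoly K[N * N]}]_d;
  pr_homog : forall i j, pr_mx i j \is e.-homog;
  pr1 : peval pr_mx 1%:M = 1%:M;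
  prM : forall g h, g \in unitmx -> h \in unitmx ->
    peval pr_mx (g *m h) = peval pr_mx g *m peval pr_mx h
}.

Definition pr_act (K : fieldType) (N e d : nat) (L : polyRep K N e d)
    (g : 'M[K]_N) (v : 'cV[K]_d) : 'cV[K]_d :=
  peval (pr_mx L) g *m v.

Section Weights.
Variables (K : fieldType) (N e d : nat) (L : polyRep K N e d).

Definition has_weight (w : 'I_N -> nat) (v : 'cV[K]_d) : Prop :=
  forall t : 'rV[K]_N, (forall i, t 0 i != 0) ->
    pr_act L (diag_mx t) v = (\prod_(i < N) t 0 i ^+ w i) *: v.

Fact has_weight0 w : has_weight w 0.
Proof. by move=> t _; rewrite /pr_act mulmx0 scaler0. Qed.
Fact has_weight_linear w a u v :
  has_weight w u -> has_weight w v -> has_weight w (a *: u + v).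
Proof.
move=> Hu Hv t Ht; move: (Hu t Ht) (Hv t Ht); rewrite /pr_act => {}Hu {}Hv.
by rewrite mulmxDr -scalemxAr Hu Hv scalerDr !scalerA mulrC.
Qed.

Definition weight_space (w : 'I_N -> nat) : {vspace 'cV[K]_d} :=
  projT1 (cid (ex_vspace_of (has_weight0 w) (@has_weight_linear w))).

Lemma weight_spaceP w v : v \in weight_space w <-> has_weight w v.
Proof. exact: (projT2 (cid (ex_vspace_of _ _))). Qed.

(* As L is homogeneous of degree e, so are all its weights. *)
Definition formal_character : {mpoly int[N]} :=
  \sum_(w : 'X_{1..N < e.+1}) 'X_[w] *+ \dim (weight_space w).

End Weights.

Section SkewSchur.
Variables (N : nat) (la mu : seq nat).

Definition box : Type :=
  {c : 'I_(size la) * 'I_(head 0 la) | nth 0 mu c.1 <= c.2 < nth 0 la c.1}%N.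
HB.instance Definition _ := Finite.on box.

Definition box_row (c : box) : nat := (val c).1.
Definition box_col (c : box) : nat := (val c).2.

Definition semistandard (T : {ffun box -> 'I_N}) : bool :=
  [forall c : box, forall c' : box,
    ((box_row c == box_row c') && (box_col c < box_col c')%N ==> (T c <= T c')%N) &&
    ((box_col c == box_col c') && (box_row c < box_row c')%N ==> (T c < T c')%N)].

Definition skew_schur : {mpoly int[N]} :=
  \sum_(T | semistandard T) \prod_(c : box) 'X_(T c).

End SkewSchur.

Section SchurFunctor.
Variables (K : fieldType) (N m d : nat) (mN : (m <= N)%N) (L : polyRep K N m d).

Definition ones_weight (i : 'I_N) : nat := (i < m)%N.

(* The matrix mapping the basis vector e_j to e_(s j) if j < m, and fixing it
   otherwise. *)
Definition ext_perm (s : 'S_m) (j : nat) : nat :=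
  if insub j is Some j' then s j' else j.
Definition ext_perm_mx (s : 'S_m) : 'M[K]_N :=
  \matrix_(i, j) (i == ext_perm s j :> nat)%:R.

Lemma ext_perm_lt s (j : nat) : (j < N -> ext_perm s j < N)%N.
Proof.
rewrite /ext_perm; case: insubP => [j' _ _|//] _.
exact: leq_trans (ltn_ord _) mN.
Qed.
Lemma ext_perm1 j : ext_perm 1%g j = j.
Proof. by rewrite /ext_perm; case: insubP => // j' _ <-; rewrite perm1. Qed.
Lemma ext_permM s t j : ext_perm (s * t)%g j = ext_perm t (ext_perm s j).
Proof.
rewrite /ext_perm; case: (insubP _ j) => [j' _ _|nj].
  by rewrite valK permM.
by rewrite insubN.
Qed.
Lemma ext_perm_ltm s j : (ext_perm s j < m)%N = (j < m)%N.
Proof.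
rewrite /ext_perm; case: insubP => [j' jm _|/negbTE] //.
by rewrite jm ltn_ord.
Qed.

Definition ext_ord s (j : 'I_N) : 'I_N := Ordinal (ext_perm_lt s (ltn_ord j)).
Lemma ext_ordK s : cancel (ext_ord s) (ext_ord s^-1%g).
Proof. by move=> j; apply: val_inj; rewrite /= -ext_permM mulgV ext_perm1. Qed.

Lemma ext_perm_mx1 : ext_perm_mx 1%g = 1%:M.
Proof. by apply/matrixP => i j; rewrite !mxE ext_perm1. Qed.
Lemma ext_perm_mxM s t : ext_perm_mx (s * t)%g = ext_perm_mx t *m ext_perm_mx s.
Proof.
apply/matrixP => i j; rewrite !mxE (bigD1 (ext_ord s j)) //= !mxE eqxx mulr1.
rewrite ext_permM big1 ?addr0 // => q; rewrite !mxE -val_eqE /= => /negbTE ->.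
by rewrite mulr0.
Qed.
Lemma ext_perm_unit s : ext_perm_mx s \in unitmx.
Proof.
by have [] := @mulmx1_unit _ _ (ext_perm_mx s) (ext_perm_mx s^-1%g);
  rewrite -?ext_perm_mxM ?mulVg ?ext_perm_mx1.
Qed.

Lemma diag_ext_perm s (t : 'rV[K]_N) :
  diag_mx t *m ext_perm_mx s = ext_perm_mx s *m diag_mx (\row_j t 0 (ext_ord s j)).
Proof.
apply/matrixP => i j; rewrite mul_diag_mx mul_mx_diag !mxE mulrC.
case: eqP => [E|_]; last by rewrite !mul0r.
by congr (_ * t 0 _); apply: val_inj.
Qed.

Definition schur_act (s : 'S_m) (v : 'cV[K]_d) : 'cV[K]_d :=
  pr_act L (ext_perm_mx s) v.
Fact schur_act_linear s : linear (schur_act s).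
Proof. by move=> a u v; rewrite /schur_act /pr_act mulmxDr -scalemxAr. Qed.
Fact schur_act1 v : schur_act 1%g v = v.
Proof. by rewrite /schur_act /pr_act ext_perm_mx1 pr1 mul1mx. Qed.
Fact schur_actM s t v : schur_act (s * t)%g v = schur_act t (schur_act s v).
Proof.
by rewrite /schur_act /pr_act ext_perm_mxM prM ?ext_perm_unit // mulmxA.
Qed.

(* The restriction of L to S_m, of which the weight space is a submodule. *)
Definition restr_module : symModule K m :=
  SymModule schur_act_linear schur_act1 schur_actM.

Fact ones_submodule :
  @is_submodule K m restr_module (has_weight L ones_weight).
Proof.
split; [exact: has_weight0|exact: has_weight_linear|].
move=> s v Hv t Ht; rewrite /= /schur_act /pr_act mulmxA.
have Ud (r : 'rV[K]_N) : (forall i, r 0 i != 0) -> diag_mx r \in unitmx.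
  by move=> Hr; rewrite unitmxE det_diag unitfE; apply/prodf_neq0 => i _.
pose t' : 'rV[K]_N := \row_j t 0 (ext_ord s j).
have Ht' i : t' 0 i != 0 by rewrite mxE.
rewrite -prM ?ext_perm_unit ?Ud // diag_ext_perm prM ?ext_perm_unit ?Ud //.
rewrite -mulmxA [X in _ *m X](Hv t' Ht') -scalemxAr; congr (_ *: _).
rewrite [RHS](reindex_inj (can_inj (ext_ordK s))); apply: eq_bigr => i _.
by rewrite mxE /ones_weight /= ext_perm_ltm.
Qed.

Definition schur_functor : symModule K m := submodule ones_submodule.

End SchurFunctor.

(* Up to isomorphism, the skew Specht module S^(la/mu) is [schur_functor mN L]
   for any polynomial representation L with formal character s_(la/mu). *)
Definition has_skew_schur_character (K : fieldType) (N m d : nat)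
    (L : polyRep K N m d) (la mu : seq nat) : Prop :=
  formal_character L = skew_schur N la mu.

Definition conj_part (la : seq nat) : seq nat :=
  mkseq (fun j => count (fun x => j < x)%N la) (head 0%N la).

Definition alpha_outer (n k : nat) : seq nat := rev (iota (n - 1) k).
Definition alpha_inner (n k : nat) : seq nat := (k - 2)%N :: rev (iota 0 (k - 1)).

Definition alpha_outer' (n k : nat) : seq nat := conj_part (alpha_outer n k).
Definition alpha_inner' (n k : nat) : seq nat := conj_part (alpha_inner n k).

(* Main.v *)
(** Let P be the skew Specht module, realised inside the space of fillings of the
    shape by applying a column antisymmetrizer and a row symmetrizer.

    P maps onto Lie_n(m).  Send a filling to the left-normed bracket that absorbs its
    columns one after the other.  This respects the column antisymmetry, and it
    respects the Garnir relations: for the two innermost brackets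
    [[x_1..x_n], y_1..y_(n-1)], let S(Z, I) be the signed sum of all ways to
    distribute the 2n-1 entries such that, among the entries in Z, exactly those in
    I are inside.  The Filippov identity gives S(Z, 0) = +-(n - |Z|) S(Z, Z), and
    induction on |Z| gives S(Z, Z) = +-S(Z, 0), so that S(Z, I) = 0 as long as
    |Z| <= n - 2.  By straightening, every element of P is a combination of the
    linearly independent semistandard ones, so all relations of P follow from the
    two kinds above.

    f(L) is isomorphic to P for every L with the given character.  Writing S_c for
    the Young subgroup fixing a colouring c of the m letters, the sum over S_c of
    the trace on f(L) is |S_c| times a weight multiplicity of L, and on P it is
    |S_c| times a number of semistandard tableaux.  The two agree, hence so do the
    characters, by induction on cycle types, and in characteristic zero equal
    characters give an isomorphism; only its surjectivity is needed.

    If k <= n, the shape has a row with k boxes, so that an antisymmetrizer of the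
    letters with fewer than k blocks kills P by the pigeonhole principle, hence also
    Lie_n(m) and gamma.  But it does not kill a Specht module with fewer than k
    columns. *)
From HB Require Import structures.
From mathcomp Require Import all_boot all_order all_algebra all_fingroup.
From mathcomp Require Import generic_quotient boolp mpoly zify.
Require Import Defs.
Set Implicit Arguments.
Unset Strict Implicit.
Unset Printing Implicit Defensive.
Import GRing.Theory.
Local Open Scope ring_scope.

(** * Linear spans and permutations of fillings *)

(** [K] is any field of characteristic zero and the modules are bare vector spaces with an action,
    so no splitting field and no character table is at hand. Straightening is therefore stated for
    an arbitrary vector-valued function on fillings that alternates in columns and satisfies the
    Garnir relations. It is applied to pairs of a skew polytabloid and its bracket, so that one
    expansion serves both coordinates, and to sums over Young subgroups, where fillings have
    repeated entries and the semistandard ones count a dimension. The traces of permutations on f(L)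
    reach the formal character through one polynomial in the entries of a matrix h, the trace of the
    action of h followed by the projection to the weight (1^m). Each of its monomials is a product
    of entries h(s i, i) for a permutation s. Summing over the permutation matrices of a Young
    subgroup then amounts to evaluating at E^T E, where the 0-1 matrix E sends the i-th basis vector
    to the c(i)-th. As E is singular in general, the representation has to be extended from
    invertible matrices to all matrices. *)

Section LinearSpan.
Variables (K : fieldType) (V : lmodType K).

(** Inductive, in contrast to [span_of], so that a property of a whole span is proved by
    elimination, on generators and linear combinations. *)
Inductive lspan (G : V -> Prop) : V -> Prop :=
| lspan_zero : lspan G 0
| lspan_gen v of G v : lspan G v
| lspan_lin a u v of lspan G u & lspan G v : lspan G (a *: u + v).

Lemma lspanZ G a v : lspan G v -> lspan G (a *: v).
Proof. by move=> Gv; rewrite -[a *: v]addr0; apply: lspan_lin => //; apply: lspan_zero. Qed.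

Lemma lspanD G u v : lspan G u -> lspan G v -> lspan G (u + v).
Proof. by move=> Gu Gv; rewrite -[u]scale1r; apply: lspan_lin. Qed.

Lemma lspanN G v : lspan G v -> lspan G (- v).
Proof. by rewrite -scaleN1r; apply: lspanZ. Qed.

Lemma lspan_sum G (I : Type) (r : seq I) (P : pred I) (f : I -> V) :
  (forall i, P i -> lspan G (f i)) -> lspan G (\sum_(i <- r | P i) f i).
Proof.
move=> Gf; apply: (big_ind (lspan G)) => //; first exact: lspan_zero.
by move=> u v; apply: lspanD.
Qed.

Lemma lspan_trans (G G' : V -> Prop) v :
  (forall u, G u -> lspan G' u) -> lspan G v -> lspan G' v.
Proof.
move=> GG'; elim=> {v} [|u /GG'//|a u w _ Gu _ Gw]; first exact: lspan_zero.
exact: lspan_lin.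
Qed.

Lemma lspan_fin (I : finType) (p : pred I) (g : I -> V) v :
  lspan (fun u => exists2 i, p i & u = g i) v ->
  exists x : I -> K, v = \sum_(i | p i) x i *: g i.
Proof.
elim=> {v} [|u [i pi ->]|a u w _ [x ->] _ [y ->]].
- by exists (fun=> 0); rewrite big1 // => i _; rewrite scale0r.
- exists (fun j => (j == i)%:R); rewrite (bigD1 i) //= eqxx scale1r big1 ?addr0 //.
  by move=> j /andP[_ /negbTE ->]; rewrite scale0r.
- exists (fun i => a * x i + y i); rewrite scaler_sumr -big_split /=.
  by apply: eq_bigr => i _; rewrite scalerDl scalerA.
Qed.

End LinearSpan.

Lemma lspan_map (K : fieldType) (V W : lmodType K) (f : V -> W) G G' v :
  linear f -> (forall u, G u -> lspan G' (f u)) -> lspan G v -> lspan G' (f v).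
Proof.
move=> f_lin Gf; have f0 : f 0 = 0.
  by have := f_lin (-1) 0 0; rewrite !scaleN1r !addNr.
elim=> {v} [|u /Gf//|a u w _ Gu _ Gw]; first by rewrite f0; apply: lspan_zero.
by rewrite f_lin; apply: lspan_lin.
Qed.

(** The hypothesis that all positive integers are nonzero in [K] is the form in which characteristic
    zero is used up to the final theorem. *)
Lemma oppr_self (K : fieldType) (V : lmodType K) (v : V) :
  (forall n, n.+1%:R != 0 :> K) -> v = - v -> v = 0.
Proof.
move=> natK /eqP; rewrite -subr_eq0 opprK -mulr2n -scaler_nat scaler_eq0.
by rewrite (negbTE (natK 1%N)) => /eqP.
Qed.

Section FillingAction.
Variables (X : finType) (A : Type).

Definition fperm (T : {ffun X -> A}) (s : {perm X}) : {ffun X -> A} :=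
  [ffun x => T (s x)].

Lemma fpermM T s t : fperm (fperm T s) t = fperm T (t * s)%g.
Proof. by apply/ffunP => x; rewrite !ffunE permM. Qed.

Lemma fperm1 T : fperm T 1%g = T.
Proof. by apply/ffunP => x; rewrite !ffunE perm1. Qed.

End FillingAction.

(** Induction on the number of points that [s] moves. It stays among permutations that preserve
    [cls], since the transposition split off exchanges two points of the same class. *)
Lemma alternating_perm (K : fieldType) (V : lmodType K) (X : finType)
    (C : eqType) (cls : X -> C) (f : {perm X} -> V) :
    (forall (s : {perm X}) x y, x != y -> cls x = cls y -> f (tperm x y * s)%g = - f s) ->
  forall s s0 : {perm X}, (forall x, cls (s x) = cls x) -> f (s * s0)%g = (-1) ^+ s *: f s0.
Proof.
move=> f_alt s s0; have [k] := ubnP #|[pred x | s x != x]|.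
elim: k => // k IH in s *; rewrite ltnS => le_s s_cls.
have [x sx|s1] := pickP [pred x | s x != x]; last first.
  have ->: s = 1%g.
    by apply/permP => x; rewrite perm1; apply/eqP/negbFE/s1.
  by rewrite mul1g odd_perm1 scale1r.
(* [t * s] sends [x] to [s y], which is [x], and still fixes every fixed point of [s]. *)
pose y := (s^-1%g) x; pose t := tperm x y.
have sy : s y = x by rewrite /y permKV.
have neq : x != y.
  by apply: contraNneq sx => /= xy; rewrite [X in s X]xy sy eqxx.
have clsxy : cls x = cls y by rewrite -[in LHS]sy s_cls.
have -> : s = (t * (t * s))%g by rewrite mulgA tperm2 mul1g.
rewrite -[(_ * _ * s0)%g]mulgA f_alt // IH.
- by rewrite [in RHS]odd_permM odd_tperm neq signr_addb expr1 mulN1r scaleNr.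
- apply: leq_trans le_s; apply: proper_card; apply/properP; split.
    apply/subsetP => z; rewrite !inE permM; apply: contraNneq => sz.
    rewrite tpermD // ?sz //; last first.
      apply: contraNneq sx => yz; move: sz; rewrite -yz sy => xy.
      by rewrite -xy in neq; rewrite eqxx in neq.
    by apply: contraNneq sx => ->; rewrite sz.
  by exists x; rewrite !inE // permM tpermL sy eqxx.
- move=> z; rewrite permM s_cls /t; case: tpermP => [->|->|] //.
Qed.

(** * Straightening *)

Section Straightening.
Variables (X : finType) (row col : X -> nat) (q : nat).
Implicit Types (T : {ffun X -> 'I_q}) (s : {perm X}).

(** Along rows just neighbours are compared: a failure is then a pair of adjacent boxes, which is
    what a Garnir relation starts from. For shapes with convex rows, [semistd_row] recovers the
    comparison of distant boxes. *)
Definition semistd T : bool :=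
  [forall b, forall b',
    ((col b == col b') && (row b < row b') ==> (T b < T b'))%N &&
    ((row b == row b') && (col b' == (col b).+1) ==> (T b <= T b'))%N].

Definition garnir_set (b0 b1 : X) : {set X} :=
  [set b | (col b == col b0) && (row b0 <= row b)%N]
    :|: [set b | (col b == col b1) && (row b <= row b1)%N].

(** A numerical stand-in for the dominance order: row permutations preserve it, and among the column
    rearrangements of a filling it is greatest on the sorted one. *)
Definition row_moment T : nat := \sum_b row b * T b.

Definition class_perm (cls : X -> nat) : pred {perm X} :=
  fun s => [forall b, cls (s b) == cls b].

Lemma class_permP cls s : reflect (forall b, cls (s b) = cls b) (class_perm cls s).
Proof. by apply: (iffP forallP) => H b; apply/eqP. Qed.

Lemma class_perm1 cls : class_perm cls 1%g.
Proof. by apply/class_permP => b; rewrite perm1. Qed.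

Lemma class_permM cls s t :
  class_perm cls s -> class_perm cls t -> class_perm cls (s * t)%g.
Proof.
by move=> /class_permP Hs /class_permP Ht; apply/class_permP => b; rewrite permM Ht Hs.
Qed.

Lemma class_permV cls s : class_perm cls s -> class_perm cls s^-1%g.
Proof.
by move=> /class_permP Hs; apply/class_permP => b; rewrite -[in RHS](permKV s b) Hs.
Qed.

Lemma class_permMr cls s t :
  class_perm cls t -> class_perm cls (s * t)%g = class_perm cls s.
Proof.
move=> ct; apply/idP/idP => cs; last exact: class_permM.
by rewrite -[s](mulgK t) class_permM ?class_permV.
Qed.

Lemma class_permMl cls s t :
  class_perm cls s -> class_perm cls (s * t)%g = class_perm cls t.
Proof.
move=> ct; apply/idP/idP => cs; last exact: class_permM.
by rewrite -[t](mulKg s) class_permM ?class_permV.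
Qed.

Lemma class_tperm cls b b' : cls b = cls b' -> class_perm cls (tperm b b').
Proof. by move=> e; apply/class_permP => c; case: tpermP => [->|->|]. Qed.

Hypothesis box_inj : forall b b', row b = row b' -> col b = col b' -> b = b'.

Lemma row_moment_swap T b b' :
  (row b < row b')%N -> (T b' < T b)%N ->
  (row_moment T < row_moment (fperm T (tperm b b')))%N.
Proof.
move=> rbb' Tbb'; have neq : b' != b by apply: contraTneq rbb' => ->; rewrite ltnn.
rewrite /row_moment (bigD1 b) // (bigD1 b') //= [X in (_ < X)%N](bigD1 b) //.
rewrite [X in (_ < _ + X)%N](bigD1 b') //= !ffunE tpermL tpermR.
rewrite [X in (_ < _ + (_ + X))%N](eq_bigr (fun c => row c * T c)%N).
  by nia.
by move=> c /andP[cb cb']; rewrite ffunE tpermD // eq_sym.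
Qed.

Lemma moment_max_sorted T s :
    class_perm col s ->
    (forall s', class_perm col s' ->
       (row_moment (fperm T s') <= row_moment (fperm T s))%N) ->
  forall b b', col b = col b' -> (row b < row b')%N ->
    (fperm T s b <= fperm T s b')%N.
Proof.
move=> cs smax b b' cbb' rbb'; rewrite leqNgt; apply/negP => /(row_moment_swap rbb').
by rewrite fpermM ltnNge smax // class_permM ?class_tperm.
Qed.

Lemma moment_argmax T :
  exists2 s, class_perm col s & forall s', class_perm col s' ->
       (row_moment (fperm T s') <= row_moment (fperm T s))%N.
Proof.
case: (@arg_maxnP _ 1%g (class_perm col) (fun s => row_moment (fperm T s)) (class_perm1 _)).
by move=> s; exists s.
Qed.

Variables (K : fieldType) (natK : forall n, n.+1%:R != 0 :> K).
Variables (V : lmodType K) (F : {ffun X -> 'I_q} -> V).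

Hypothesis F_alt : forall T b b', b != b' -> col b = col b' ->
  F (fperm T (tperm b b')) = - F T.
Hypothesis F_garnir : forall T b0 b1, row b0 = row b1 -> col b1 = (col b0).+1 ->
  \sum_(s | perm_on (garnir_set b0 b1) s) (-1) ^+ s *: F (fperm T s) = 0.

Lemma alternating_col T s : class_perm col s -> F (fperm T s) = (-1) ^+ s *: F T.
Proof.
move=> /class_permP cs; rewrite -[s]mulg1.
rewrite (alternating_perm (f := fun s => F (fperm T s)) _ _ cs) ?fperm1 ?mulg1 //.
by move=> s' b b' neq cbb'; rewrite -fpermM F_alt.
Qed.

Lemma alternating_eq0 T b b' : b != b' -> col b = col b' -> T b = T b' -> F T = 0.
Proof.
move=> neq cbb' Tbb'; apply: (oppr_self natK); rewrite -(F_alt _ neq cbb').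
by congr F; apply/ffunP => c; rewrite !ffunE; case: tpermP => [->|->|].
Qed.

Let width := (\max_b col b).+1.
(** Decreases when large entries move to the right, and is invariant under column permutations. As
    [width] exceeds every column number, no subtraction is cut off. *)
Let measure T : nat := \sum_b T b * (width - col b).

Lemma col_lt_width b : (col b < width)%N.
Proof. by rewrite ltnS leq_bigmax. Qed.

Lemma measure_col T s : class_perm col s -> measure (fperm T s) = measure T.
Proof.
move=> /class_permP cs; rewrite /measure [RHS](reindex_inj (@perm_inj _ s)) /=.
by apply: eq_bigr => b _; rewrite ffunE cs.
Qed.

(** With [A] and [B] the parts of the Garnir set in the columns of [b0] and [b1], all entries in [A]
    are at least [T b0], all entries in [B] are at most [T b1], and [T b1 < T b0]. A permutation
    that does not preserve columns brings some entries of [B] into [A], in exchange for as many of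
    [A]. *)
Lemma measure_garnir T b0 b1 s :
    (forall b b', col b = col b' -> (row b < row b')%N -> (T b < T b')%N) ->
    row b0 = row b1 -> col b1 = (col b0).+1 -> (T b1 < T b0)%N ->
    perm_on (garnir_set b0 b1) s -> ~~ class_perm col s ->
  (measure (fperm T s) < measure T)%N.
Proof.
move=> Tcol r01 c01 T10 Gs ncs.
pose A := [set b | (col b == col b0) && (row b0 <= row b)%N].
pose B := [set b | (col b == col b1) && (row b <= row b1)%N].
have GE b : (b \in garnir_set b0 b1) = (b \in A) || (b \in B) by rewrite inE.
have TA b : b \in A -> (T b0 <= T b)%N.
  rewrite inE => /andP[/eqP cb]; rewrite leq_eqVlt => /orP[/eqP rb|rb].
    by rewrite (@box_inj b b0).
  by rewrite ltnW // Tcol.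
have TB b : b \in B -> (T b <= T b1)%N.
  rewrite inE => /andP[/eqP cb]; rewrite leq_eqVlt => /orP[/eqP rb|rb].
    by rewrite (@box_inj b b1).
  by rewrite ltnW // Tcol.
(* Without the extra unit on [A], the weights of the two adjacent columns agree on the Garnir set,
   so that [s] changes nothing but the sum of the entries in [A]. *)
pose w b := (width - col b - (b \in A))%N.
have wA b : (width - col b = w b + (b \in A))%N.
  rewrite /w subnK //; case: (b \in A) => //=; rewrite subn_gt0; exact: col_lt_width.
have wG b : b \in garnir_set b0 b1 -> w b = (width - col b1)%N.
  rewrite GE /w => /orP[bA|bB].
    by rewrite bA; move: bA; rewrite inE => /andP[/eqP ->]; rewrite c01 subnS subn1.
  have -> : (b \in A) = false.
    by move: bB; rewrite !inE => /andP[/eqP -> _]; rewrite c01 gtn_eqF.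
  by move: bB; rewrite inE => /andP[/eqP ->]; rewrite subn0.
have ws b : w (s b) = w b.
  have [bG|bG] := boolP (b \in garnir_set b0 b1); last by rewrite (out_perm Gs).
  by rewrite !wG // perm_closed.
have E S : measure S = (\sum_b S b * w b + \sum_(b in A) S b)%N.
  rewrite [X in (_ + X)%N]big_mkcond -big_split; apply: eq_bigr => b _.
  by rewrite wA mulnDr; case: (b \in A); rewrite ?muln1 ?muln0.
rewrite !E; have -> : (\sum_b fperm T s b * w b = \sum_b T b * w b)%N.
  rewrite [RHS](reindex_inj (@perm_inj _ s)); apply: eq_bigr => b _.
  by rewrite ffunE ws.
rewrite ltn_add2l.
have -> : (\sum_(b in A) fperm T s b = \sum_(b in s @: A) T b)%N.
  rewrite big_imset /=; last by move=> ? ? _ _; apply: perm_inj.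
  by apply: eq_bigr => b _; rewrite ffunE.
have sA : #|s @: A| = #|A| by rewrite card_imset //; apply: perm_inj.
have cD : #|s @: A :\: A| = #|A :\: s @: A|.
  by have := cardsID (s @: A) A; have := cardsID A (s @: A); rewrite setIC sA; lia.
rewrite (big_setID A) [X in (_ < X)%N](big_setID (s @: A)) /= setIC ltn_add2l.
have sub : s @: A :\: A \subset B.
  apply/subsetP => b /setDP[/imsetP[a aA ->] saA].
  have := perm_closed a Gs; rewrite !GE aA => /orP[|//].
  by rewrite (negbTE saA).
have nz : (0 < #|A :\: s @: A|)%N.
  rewrite -cD card_gt0; apply: contra ncs => /eqP sAA.
  have eqA : s @: A = A by apply/eqP; rewrite eqEcard sA leqnn andbT -setD_eq0 sAA.
  apply/class_permP => b; have [bG|bG] := boolP (b \in garnir_set b0 b1); last first.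
    by rewrite (out_perm Gs).
  have sAb : (s b \in A) = (b \in A) by rewrite -[in LHS]eqA mem_imset //; apply: perm_inj.
  have := perm_closed b Gs; rewrite bG GE sAb; move: bG sAb; rewrite GE.
  case: (boolP (b \in A)) => /= [bA _|_ bB _ sbB].
    by move: bA; rewrite !inE => /andP[/eqP -> _] /andP[/eqP -> _].
  by move: bB sbB; rewrite !inE => /andP[/eqP -> _] /andP[/eqP -> _].
apply: (@leq_ltn_trans (#|s @: A :\: A| * T b1)%N).
  rewrite -sum_nat_const; apply: leq_sum => b /(subsetP sub); exact: TB.
apply: (@leq_trans (#|A :\: s @: A| * T b0)%N); first by rewrite cD ltn_pmul2l.
by rewrite -sum_nat_const; apply: leq_sum => b /setDP[/TA].
Qed.

(** Induction on [measure], after sorting the columns. A violation of the row order gives a Garnir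
    relation whose column-preserving terms all equal [F T]; their number is invertible, and the
    other terms are smaller. The conclusion names rearrangements of [T], not arbitrary fillings, so
    that the content is kept. *)
Theorem straightening T :
  lspan (fun v => exists2 s, semistd (fperm T s) & v = F (fperm T s)) (F T).
Proof.
have [k] := ubnP (measure T); elim: k => // k IH in T *; rewrite ltnS => leT.
have [s cs smax] := moment_argmax T.
have {smax} sorted_s := moment_max_sorted cs smax.
suff : lspan (fun v => exists2 s', semistd (fperm (fperm T s) s')
                       & v = F (fperm (fperm T s) s')) (F (fperm T s)).
  rewrite [F (fperm T s)]alternating_col // => /(lspanZ ((-1) ^+ s)).
  rewrite scalerA -expr2 sqrr_sign scale1r.
  apply: lspan_trans => _ [s' ss' ->]; apply: lspan_gen.
  by rewrite fpermM in ss' *; exists (s' * s)%g.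
rewrite -(measure_col T cs) in leT; move: (fperm T s) leT sorted_s => {cs}T leT sorted_T.
have [/forallP Teq|] := boolP [forall b, forall b',
    (col b == col b') && (row b < row b')%N ==> (T b != T b')]; last first.
  move=> /forallPn[b /forallPn[b']]; rewrite negb_imply negbK.
  move=> /andP[/andP[/eqP cbb' rbb'] /eqP Tbb'].
  rewrite (@alternating_eq0 T b b') //; first exact: lspan_zero.
  by apply: contraTneq rbb' => ->; rewrite ltnn.
have Tcol b b' : col b = col b' -> (row b < row b')%N -> (T b < T b')%N.
  move=> cbb' rbb'; rewrite ltn_neqAle sorted_T // andbT.
  by have /forallP/(_ b')/implyP := Teq b; rewrite cbb' eqxx rbb'; apply.
have [Tss|] := boolP (semistd T).
  by apply: lspan_gen; exists 1%g; rewrite fperm1.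
move=> /forallPn[b0 /forallPn[b1]]; rewrite negb_and => /orP[|].
  rewrite negb_imply => /andP[/andP[/eqP cbb' rbb']]; by rewrite Tcol.
rewrite negb_imply -ltnNge => /andP[/andP[/eqP r01 /eqP c01] T10].
have := F_garnir T r01 c01; rewrite (bigID (class_perm col)) /=.
pose N := #|[pred s | perm_on (garnir_set b0 b1) s & class_perm col s]|.
have -> : \sum_(s | perm_on (garnir_set b0 b1) s && class_perm col s)
            (-1) ^+ s *: F (fperm T s) = N%:R *: F T.
  rewrite (eq_bigr (fun=> F T)) => [|s' /andP[_ cs']]; last first.
    by rewrite alternating_col // scalerA -expr2 sqrr_sign scale1r.
  by rewrite big_const iter_addr_0 scaler_nat.
have N0 : N%:R != 0 :> K.
  have : (0 < N)%N by apply/card_gt0P; exists 1%g; rewrite inE perm_on1 class_perm1.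
  by case: N => // N' _; apply: natK.
move=> /eqP; rewrite addr_eq0 => /eqP eqF.
rewrite -[F T]scale1r -(mulVf N0) -scalerA eqF; apply/lspanZ/lspanN/lspan_sum.
move=> s' /andP[Gs' ncs']; apply: lspanZ.
apply: lspan_trans (IH _ (leq_trans (measure_garnir Tcol r01 c01 T10 Gs' ncs') leT)).
move=> _ [s'' ss'' ->]; apply: lspan_gen.
by rewrite fpermM in ss'' *; exists (s'' * s')%g.
Qed.

End Straightening.

(** * Skew polytabloids *)

Section Symmetrizer.
Variables (K : fieldType) (X : finType) (row col : X -> nat).

Definition filling_space (q : nat) := {ffun {ffun X -> 'I_q} -> K^o}.

Definition fvec q (T : {ffun X -> 'I_q}) : filling_space q := [ffun S => (S == T)%:R].

Lemma fvec_sum q (v : filling_space q) : v = \sum_T v T *: fvec T.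
Proof.
apply/ffunP => S; rewrite sum_ffunE (bigD1 S) //= !ffunE eqxx big1 => [|T /negbTE neq].
  by rewrite addr0; apply: esym; apply: mulr1.
by rewrite !ffunE eq_sym neq; apply: mulr0.
Qed.

(* The skew polytabloid of T; two fillings with the same rows up to order are
   identified by the sum over row permutations. *)
Definition symmetrize q (T : {ffun X -> 'I_q}) : filling_space q :=
  \sum_(t | class_perm col t) \sum_(r | class_perm row r)
     (-1) ^+ t *: fvec (fperm T (r * t)%g).

(** [c] may merge letters: it is a permutation for the action of the symmetric group and a colouring
    when Young subgroups are studied. *)
Definition relabel q q' (c : 'I_q -> 'I_q') (T : {ffun X -> 'I_q}) :
  {ffun X -> 'I_q'} := [ffun x => c (T x)].

Definition relabel_space q q' (c : 'I_q -> 'I_q') (v : filling_space q) :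
  filling_space q' := \sum_T v T *: fvec (relabel c T).

Lemma relabel_space_linear q q' (c : 'I_q -> 'I_q') : linear (relabel_space c).
Proof.
move=> a u v; rewrite /relabel_space scaler_sumr -big_split /=.
by apply: eq_bigr => T _; rewrite !ffunE scalerDl scalerA.
Qed.
HB.instance Definition _ q q' (c : 'I_q -> 'I_q') :=
  GRing.isLinear.Build K (filling_space q) (filling_space q') _
    (relabel_space c) (relabel_space_linear c).

Lemma relabel_spaceZ q q' (c : 'I_q -> 'I_q') a v :
  relabel_space c (a *: v) = a *: relabel_space c v.
Proof. exact: linearZ_LR. Qed.

Lemma relabel_fvec q q' (c : 'I_q -> 'I_q') T :
  relabel_space c (fvec T) = fvec (relabel c T).
Proof.
rewrite /relabel_space (bigD1 T) //= ffunE eqxx scale1r big1 ?addr0 // => S /negbTE neq.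
by rewrite ffunE neq scale0r.
Qed.

Lemma relabel_fperm q q' (c : 'I_q -> 'I_q') T s :
  relabel c (fperm T s) = fperm (relabel c T) s.
Proof. by apply/ffunP => x; rewrite !ffunE. Qed.

Lemma relabel_symmetrize q q' (c : 'I_q -> 'I_q') T :
  relabel_space c (symmetrize T) = symmetrize (relabel c T).
Proof.
rewrite /symmetrize raddf_sum /=; apply: eq_bigr => t _.
rewrite raddf_sum /=; apply: eq_bigr => r _.
by rewrite relabel_spaceZ relabel_fvec relabel_fperm.
Qed.

Lemma relabel_space_comp q q' q'' (c : 'I_q -> 'I_q') (c' : 'I_q' -> 'I_q'') v :
  relabel_space c' (relabel_space c v) = relabel_space (c' \o c) v.
Proof.
rewrite [relabel_space c v]/relabel_space raddf_sum /=; apply: eq_bigr => T _.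
rewrite relabel_spaceZ relabel_fvec; congr (_ *: fvec _).
by apply/ffunP => x; rewrite !ffunE.
Qed.

Lemma relabel_space_id q (v : filling_space q) : relabel_space id v = v.
Proof.
rewrite [RHS]fvec_sum; apply: eq_bigr => T _; congr (_ *: fvec _).
by apply/ffunP => x; rewrite ffunE.
Qed.

Hypothesis natK : forall n, n.+1%:R != 0 :> K.
Hypothesis box_inj : forall b b', row b = row b' -> col b = col b' -> b = b'.
Hypothesis row_convex : forall b b', row b = row b' -> (col b < col b')%N ->
  exists b'', row b'' = row b /\ col b'' = (col b).+1.
Hypothesis garnir_rows : forall b0 b1, row b0 = row b1 -> col b1 = (col b0).+1 ->
  exists2 R : seq nat, (size R < #|garnir_set row col b0 b1|)%N
    & forall b, (col b == col b0) || (col b == col b1) -> row b \in R.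

Section FixedAlphabet.
Variable q : nat.
Implicit Types T S : {ffun X -> 'I_q}.

Lemma symmetrize_alt T b b' : b != b' -> col b = col b' ->
  symmetrize (fperm T (tperm b b')) = - symmetrize T.
Proof.
move=> neq cbb'; rewrite /symmetrize [in RHS](reindex_inj (mulIg (tperm b b'))) /= -sumrN.
apply: eq_big => [t|t _]; first by rewrite class_permMr ?class_tperm.
rewrite -sumrN; apply: eq_bigr => r _.
by rewrite odd_permM odd_tperm neq signr_addb expr1 mulrN1 scaleNr opprK fpermM mulgA.
Qed.

(** For each column permutation [t], its inverse moves the boxes of the Garnir set into fewer rows
    than there are boxes, so two of them, [x] and [y], land in one row. Exchanging [x] and [y]
    reverses the sign and is absorbed by the sum over row permutations, so the terms cancel. *)
Lemma symmetrize_garnir T b0 b1 : row b0 = row b1 -> col b1 = (col b0).+1 ->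
  \sum_(s | perm_on (garnir_set row col b0 b1) s)
     (-1) ^+ s *: symmetrize (fperm T s) = 0.
Proof.
move=> r01 c01; set G := garnir_set _ _ _ _.
have [R sizeR rowR] := garnir_rows r01 c01.
under eq_bigr => s _ do rewrite /symmetrize scaler_sumr.
rewrite exchange_big big1 //= => t ct.
have [x [y [xG yG neq rxy]]] : exists x y, [/\ x \in G, y \in G, x != y
    & row (t^-1%g x) = row (t^-1%g y)].
  apply: contrapT => nex; move: sizeR; rewrite ltnNge => /negP; apply.
  rewrite -/G cardE -(size_map (fun x => row (t^-1%g x))); apply: uniq_leq_size.
    rewrite map_inj_in_uniq ?enum_uniq // => x y; rewrite !mem_enum => xG yG e.
    by apply: contrapT => /eqP neq; apply: nex; exists x, y.
  move=> ? /mapP[x]; rewrite mem_enum => xG ->; apply: rowR.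
  have /class_permP -> := class_permV ct.
  by move: xG; rewrite !inE => /orP[/andP[->]|/andP[->]]; rewrite ?orbT.
apply: (oppr_self natK); rewrite -sumrN [LHS](reindex_inj (mulgI (tperm x y))) /=.
have Gt : perm_on G (tperm x y).
  apply/subsetP => z; rewrite inE; case: tpermP => [->|->|_ _]; rewrite ?eqxx //.
apply: eq_big => [s|s _].
  apply/idP/idP => [Gs|]; last exact: perm_onM.
  by rewrite -[s](mulKg (tperm x y)) tpermV perm_onM.
rewrite odd_permM odd_tperm neq signr_addb expr1 mulN1r scaleNr; congr (- (_ *: _)).
(* Conjugated by [t^-1], the exchange of [x] and [y] becomes the exchange of two boxes in one
   row. *)
have rJ : class_perm row (tperm x y ^ t^-1)%g by rewrite tpermJ class_tperm.
rewrite [RHS](reindex_inj (mulIg (tperm x y ^ t^-1)%g)) /=.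
apply: eq_big => [r|r _]; first by rewrite class_permMr.
congr (_ *: fvec _); rewrite !fpermM conjgE invgK.
by rewrite !mulgA mulgKV.
Qed.

(** On each class the boxes with entries at most [a] form an initial segment for [ord], for [T] as
    well as for its rearrangement, and both segments have the same size. *)
Lemma sorted_rearrangement (cls ord : X -> nat) T s :
    (forall b b', cls b = cls b' -> ord b = ord b' -> b = b') -> class_perm cls s ->
    (forall b b', cls b = cls b' -> (ord b < ord b')%N -> (T b <= T b')%N) ->
    (forall b b', cls b = cls b' -> (ord b < ord b')%N ->
       (fperm T s b <= fperm T s b')%N) ->
  fperm T s = T.
Proof.
move=> ord_inj /class_permP cs T_sorted S_sorted; set S := fperm T s in S_sorted *.
pose D U c a := [set b : X | (cls b == c) && ((U : {ffun X -> 'I_q}) b <= a)%N].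
have cardD c a : #|D S c a| = #|D T c a|.
  rewrite -[RHS](card_preimset _ (@perm_inj _ s)); apply: eq_card => b.
  by rewrite !inE /S ffunE cs.
have eqD c a : D S c a = D T c a.
  have [sub|] := boolP (D S c a \subset D T c a).
    by apply/eqP; rewrite eqEcard sub cardD leqnn.
  case/subsetPn=> x xS xT.
  have [sub|] := boolP (D T c a \subset D S c a).
    by apply/eqP; rewrite eq_sym eqEcard sub cardD leqnn.
  case/subsetPn=> y yT yS; move: xS xT yT yS; rewrite !inE.
  move=> /andP[/eqP cx]; rewrite cx eqxx /= -ltnNge => Sx Tx.
  move=> /andP[/eqP cy]; rewrite cy eqxx /= -ltnNge => Ty Sy.
  have cxy : cls x = cls y by rewrite cx.
  have [xy|yx|e] := ltngtP (ord x) (ord y).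
  - by have := T_sorted _ _ cxy xy; lia.
  - by have := S_sorted _ _ (esym cxy) yx; lia.
  - by move: Tx Ty; rewrite (ord_inj _ _ cxy e); lia.
apply/ffunP => b; apply/val_inj/eqP; rewrite eqn_leq.
have /setP/(_ b) := eqD (cls b) (T b); rewrite !inE !eqxx leqnn /= => ->.
by have /setP/(_ b) := eqD (cls b) (S b); rewrite !inE !eqxx leqnn /= => <-.
Qed.

Lemma semistd_col T b b' : semistd row col T -> col b = col b' ->
  (row b < row b')%N -> (T b < T b')%N.
Proof.
move=> /forallP/(_ b)/forallP/(_ b')/andP[/implyP h _] cbb' rbb'; apply: h.
by rewrite cbb' eqxx.
Qed.

Lemma semistd_row T b b' : semistd row col T -> row b = row b' ->
  (col b < col b')%N -> (T b <= T b')%N.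
Proof.
move=> ssT rbb'; have [k] := ubnP (col b' - col b); elim: k => // k IH in b rbb' *.
move=> lek cbb'; have [b'' [r'' c'']] := row_convex rbb' cbb'.
have Tb : (T b <= T b'')%N.
  move: ssT => /forallP/(_ b)/forallP/(_ b'')/andP[_ /implyP]; apply.
  by rewrite r'' c'' !eqxx.
have [e|ne] := eqVneq (col b'') (col b').
  by rewrite -(@box_inj b'' b') ?r''.
apply: leq_trans Tb (IH _ _ _ _); rewrite ?r'' //; first by rewrite c''; lia.
by rewrite ltn_neqAle ne c''.
Qed.

(** The column rearrangement of greatest moment is sorted, hence equal to [T]. If [t] attains that
    moment too, then it fixes [T], and the strictness of columns forces [t = 1]. *)
Lemma moment_col T t : semistd row col T -> class_perm col t -> t != 1%g ->
  (row_moment row (fperm T t) < row_moment row T)%N.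
Proof.
move=> ssT ct t1; have [s cs smax] := moment_argmax row col T.
have Tw b b' : col b = col b' -> (row b < row b')%N -> (T b <= T b')%N.
  by move=> cbb' rbb'; apply/ltnW/semistd_col.
have colrow b b' : col b = col b' -> row b = row b' -> b = b'.
  by move=> cbb' rbb'; apply: box_inj.
have argmaxE s' : class_perm col s' -> (forall s'', class_perm col s'' ->
    (row_moment row (fperm T s'') <= row_moment row (fperm T s'))%N) -> fperm T s' = T.
  move=> cs' s'max; apply: (sorted_rearrangement colrow cs' Tw).
  exact: moment_max_sorted cs' s'max.
have smaxT := argmaxE _ cs smax; rewrite smaxT in smax.
rewrite ltn_neqAle smax // andbT; apply: contra t1 => /eqP eT.
have /ffunP Tt : fperm T t = T by apply: argmaxE => //; rewrite eT.
apply/eqP/permP => b; rewrite perm1; have /class_permP cb := ct.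
apply: box_inj => //; have := Tt b; rewrite ffunE => eb.
have [h|h|//] := ltngtP (row (t b)) (row b).
  by have := semistd_col ssT (cb b) h; rewrite eb ltnn.
by have := semistd_col ssT (esym (cb b)) h; rewrite eb ltnn.
Qed.

Lemma row_moment_row T r : class_perm row r ->
  row_moment row (fperm T r) = row_moment row T.
Proof.
move=> /class_permP cr; rewrite /row_moment [RHS](reindex_inj (@perm_inj _ r)).
by apply: eq_bigr => b _; rewrite ffunE cr.
Qed.

Lemma symmetrize_coef T S : symmetrize T S =
  \sum_(t | class_perm col t) \sum_(r | class_perm row r)
     (-1) ^+ t * (S == fperm T (r * t)%g)%:R :> K.
Proof.
rewrite sum_ffunE; apply: eq_bigr => t _; rewrite sum_ffunE.
by apply: eq_bigr => r _; rewrite !ffunE.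
Qed.

(** A filling that occurs in [symmetrize T] is a row rearrangement of some [fperm T t], so it has
    the moment of [fperm T t], which is smaller than that of [T] unless [t = 1]. In that case [S]
    and [T] are row rearrangements of each other with sorted rows, hence equal. *)
Lemma symmetrize_triangular T S : semistd row col T -> semistd row col S ->
  symmetrize T S != 0 -> S != T -> (row_moment row S < row_moment row T)%N.
Proof.
move=> ssT ssS nz neq; rewrite ltnNge; apply: contra_neqN nz => le.
rewrite symmetrize_coef big1 // => t ct; rewrite big1 // => r cr.
case: eqP => [eS|]; last by rewrite mulr0.
case/eqP: neq; move: le; rewrite eS -fpermM row_moment_row // leqNgt.
have [t1|t1] := eqVneq t 1%g; last by rewrite moment_col.
move: eS; rewrite {ct}t1 mulg1 fperm1 => eS _.
have rowcol b b' : row b = row b' -> col b = col b' -> b = b' by apply: box_inj.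
apply: (sorted_rearrangement rowcol cr); first by move=> *; apply: semistd_row.
by rewrite -eS => *; apply: semistd_row.
Qed.

(** No column permutation other than 1 contributes, by the moment; what remains is the number of row
    permutations that fix [T]. *)
Lemma symmetrize_diag T : semistd row col T -> symmetrize T T != 0.
Proof.
move=> ssT; rewrite symmetrize_coef (bigD1 1%g) ?class_perm1 //= [X in _ + X]big1.
  rewrite addr0 odd_perm1 (bigD1 1%g) ?class_perm1 //= mulg1 fperm1 eqxx.
  under eq_bigr => r _ do rewrite mulg1 mul1r.
  by rewrite mul1r -natr_sum -natrD add1n natK.
move=> t /andP[ct t1]; rewrite big1 // => r cr; case: eqP => [eT|]; last by rewrite mulr0.
have := moment_col ssT ct t1.
have <- : row_moment row T = row_moment row (fperm T t); last by rewrite ltnn.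
by rewrite {1}eT -fpermM row_moment_row.
Qed.

(** At a filling [S] of greatest moment among those with nonzero coefficient, the other summands
    vanish by triangularity. *)
Lemma symmetrize_free (x : {ffun X -> 'I_q} -> K) :
  \sum_(S | semistd row col S) x S *: symmetrize S = 0 ->
  forall S, semistd row col S -> x S = 0.
Proof.
move=> sum0 S0 ss0; apply/eqP/negPn/negP => x0.
have [S /andP[ssS xS] Smax] := @arg_maxnP _ S0
  [pred S | semistd row col S && (x S != 0)] (fun S => row_moment row S)
  (introT andP (conj ss0 x0)).
have /ffunP/(_ S) := sum0; rewrite sum_ffunE (bigD1 S) //= !ffunE big1.
  by rewrite addr0 => /eqP; rewrite mulf_eq0 (negbTE xS) (negbTE (symmetrize_diag ssS)).
move=> T /andP[ssT neq]; rewrite ffunE; have [->|xT] := eqVneq (x T) 0; first exact: mul0r.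
have [->|nz] := eqVneq (symmetrize T S) 0; first exact: mulr0.
have := symmetrize_triangular ssT ssS nz; rewrite eq_sym neq => /(_ isT).
by rewrite ltnNge; have /= -> := Smax T; rewrite //= ssT.
Qed.

End FixedAlphabet.
End Symmetrizer.

(** * Garnir relations for two nested brackets *)

Section BracketBasics.
Variables (K : fieldType) (n : nat) (L : lmodType K).
Variable br : ('I_n.+1 -> L) -> L.
Hypothesis br_lanke : is_lanke br.

Lemma bcons_bset (u : L) (y : 'I_n.+1 -> L) : bcons u y = bset y ord0 u.
Proof. by []. Qed.

Lemma eq_bcons (u : L) (y y' : 'I_n.+1 -> L) :
  (forall i, i != ord0 -> y i = y' i) -> bcons u y = bcons u y'.
Proof.
by move=> eyy'; apply: funext => i; rewrite /bcons; case: eqP => // /eqP; apply: eyy'.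
Qed.

Lemma br_tperm (x : 'I_n.+1 -> L) i j : i != j -> br (fun l => x (tperm i j l)) = - br x.
Proof.
move=> neq; have [_ br_skew _] := br_lanke.
by rewrite [in RHS](br_skew x (tperm i j)) odd_tperm neq expr1 scaleN1r opprK.
Qed.

Lemma br_head_linear (y : 'I_n.+1 -> L) : linear (fun u => br (bcons u y)).
Proof. by move=> a u v; have [br_lin _ _] := br_lanke; rewrite !bcons_bset br_lin. Qed.

Lemma br_head0 (y : 'I_n.+1 -> L) : br (bcons 0 y) = 0.
Proof. by have := br_head_linear y (-1) 0 0; rewrite !scaleN1r !addNr. Qed.

Lemma br_headN (y : 'I_n.+1 -> L) u : br (bcons (- u) y) = - br (bcons u y).
Proof.
by rewrite -scaleN1r -[_ *: u]addr0 br_head_linear br_head0 addr0 scaleN1r.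
Qed.

Lemma br_head_sum (I : Type) (r : seq I) (P : pred I) (a : I -> K) (v : I -> L) y :
  br (bcons (\sum_(i <- r | P i) a i *: v i) y) =
  \sum_(i <- r | P i) a i *: br (bcons (v i) y).
Proof.
elim: r => [|i r IH]; first by rewrite !big_nil br_head0.
by rewrite !big_cons; case: (P i) => //; rewrite br_head_linear IH.
Qed.

End BracketBasics.

Section BracketGarnir.
Variables (K : fieldType) (natK : forall n, n.+1%:R != 0 :> K).
Variables (n : nat) (L : lmodType K) (br : ('I_n.+1 -> L) -> L).
Hypothesis br_lanke : is_lanke br.
Variables (Y : finType) (e0 e1 : 'I_n.+1 -> Y).
Hypothesis e0_inj : injective e0.
Hypothesis e1_inj : forall i j, i != ord0 -> j != ord0 -> e1 i = e1 j -> i = j.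
Hypothesis e01 : forall i j, j != ord0 -> e0 i != e1 j.

(** [e0] and [e1] give the places of the inner and the outer entries. [bcons] overwrites slot 0 of
    the outer bracket, so [e1] is constrained off [ord0], and there are 2n + 1 places in all. *)
Definition two_brackets (u : Y -> L) : L :=
  br (bcons (br (fun i => u (e0 i))) (fun i => u (e1 i))).
Local Notation f := two_brackets.

Let D0 := e0 @: [set: 'I_n.+1].
Let D1 := e1 @: [set~ ord0].
Let D := D0 :|: D1.

Lemma mem_D0 i : e0 i \in D0. Proof. exact: imset_f. Qed.
Lemma mem_D1 i : i != ord0 -> e1 i \in D1.
Proof. by move=> i0; apply: imset_f; rewrite !inE. Qed.
Lemma D0P y : reflect (exists i, y = e0 i) (y \in D0).
Proof. by apply: (iffP imsetP) => [[i _ ->]|[i ->]]; exists i. Qed.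
Lemma D1P y : reflect (exists2 i, i != ord0 & y = e1 i) (y \in D1).
Proof. by apply: (iffP imsetP) => [[i]|[i i0 ->]]; rewrite ?inE; exists i; rewrite ?inE. Qed.
Lemma D01 y : y \in D0 -> y \in D1 = false.
Proof. by case/D0P=> i ->; apply/D1P => -[j j0 /eqP]; apply/negP/e01. Qed.

Lemma two_brackets_swap0 (u : Y -> L) x y : x \in D0 -> y \in D0 -> x != y ->
  f (fun z => u (tperm x y z)) = - f u.
Proof.
case/D0P=> i -> /D0P[j ->] neq; rewrite /f.
have neq' : i != j by apply: contraNneq neq => ->.
rewrite (@eq_bcons _ _ _ _ _ (fun l => u (e1 l))) => [|l l0]; last first.
  by rewrite tpermD // e01.
rewrite -(br_headN br_lanke); congr (br (bcons _ _)).
rewrite -[RHS](br_tperm br_lanke _ neq'); congr br; apply: funext => l.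
by rewrite inj_tperm.
Qed.

Lemma two_brackets_swap1 (u : Y -> L) x y : x \in D1 -> y \in D1 -> x != y ->
  f (fun z => u (tperm x y z)) = - f u.
Proof.
case/D1P=> i i0 -> /D1P[j j0 ->] neq; rewrite /f.
have neq' : i != j by apply: contraNneq neq => ->.
have -> : (fun l => u (tperm (e1 i) (e1 j) (e0 l))) = (fun l => u (e0 l)).
  by apply: funext => l; rewrite tpermD // eq_sym e01.
rewrite -[RHS](br_tperm br_lanke _ neq'); congr br; apply: funext => l.
rewrite /bcons; case: (tpermP i j l) => [->|->|li lj].
- by rewrite (negbTE (i0 : i != 0 :> nat)) (negbTE (j0 : j != 0 :> nat)) tpermL.
- by rewrite (negbTE (i0 : i != 0 :> nat)) (negbTE (j0 : j != 0 :> nat)) tpermR.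
case: ifP => // /negbT l0; rewrite tpermD //; apply/eqP.
  by move/(e1_inj i0 l0) => il; apply: li.
by move/(e1_inj j0 l0) => il; apply: lj.
Qed.

(* Exchanges the two brackets, except for the first entry of the inner one. *)
Definition bracket_swap_fun (x : Y) : Y :=
  if [pick i | (i != ord0) && (e0 i == x)] is Some i then e1 i
  else if [pick i | (i != ord0) && (e1 i == x)] is Some i then e0 i else x.

Lemma bracket_swap0 i : i != ord0 -> bracket_swap_fun (e0 i) = e1 i.
Proof.
move=> i0; rewrite /bracket_swap_fun; case: pickP => [j /andP[_ /eqP /e0_inj -> //]|].
by move/(_ i); rewrite i0 eqxx.
Qed.

Lemma bracket_swap1 i : i != ord0 -> bracket_swap_fun (e1 i) = e0 i.
Proof.
move=> i0; rewrite /bracket_swap_fun; case: pickP => [j /andP[_]|_].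
  by rewrite (negbTE (e01 _ i0)).
case: pickP => [j /andP[j0 /eqP e]|/(_ i)]; last by rewrite i0 eqxx.
by rewrite (e1_inj j0 i0 e).
Qed.

Lemma bracket_swap_head : bracket_swap_fun (e0 ord0) = e0 ord0.
Proof.
rewrite /bracket_swap_fun; case: pickP => [j /andP[j0 /eqP/e0_inj ej]|_].
  by rewrite ej eqxx in j0.
by case: pickP => // j /andP[j0]; rewrite eq_sym (negbTE (e01 _ j0)).
Qed.

Lemma bracket_swap_out x : x \notin D -> bracket_swap_fun x = x.
Proof.
rewrite inE negb_or => /andP[x0 x1]; rewrite /bracket_swap_fun.
case: pickP => [j /andP[_ /eqP e]|_]; first by rewrite -e mem_D0 in x0.
by case: pickP => // j /andP[j0 /eqP e]; rewrite -e mem_D1 in x1.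
Qed.

Lemma DP x : x \in D -> [\/ x = e0 ord0, exists2 i, i != ord0 & x = e0 i
  | exists2 i, i != ord0 & x = e1 i].
Proof.
rewrite inE => /orP[/D0P[i ->]|/D1P[i i0 ->]]; last by constructor 3; exists i.
by have [->|i0] := eqVneq i ord0; [constructor 1|constructor 2; exists i].
Qed.

Lemma bracket_swapK : involutive bracket_swap_fun.
Proof.
move=> x; have [|xD] := boolP (x \in D); last by rewrite !bracket_swap_out.
by case/DP=> [->|[i i0 ->]|[i i0 ->]]; rewrite ?bracket_swap_head //
  ?(bracket_swap0 i0, bracket_swap1 i0).
Qed.

Definition bracket_swap : {perm Y} := perm (inv_inj bracket_swapK).
Local Notation w := bracket_swap.
Let wE x : w x = bracket_swap_fun x. Proof. by rewrite permE. Qed.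

Let t i : {perm Y} := tperm (e0 ord0) (e0 i).

(** Term [i] of the Filippov identity has the new bracket in slot [i]. Moving it to the front costs
    the sign of [t i] and leaves a double bracket in which [t i] puts the [i]-th inner entry into
    the head and [w] exchanges the remaining inner entries with the outer ones. *)
Lemma two_brackets_filippov (u : Y -> L) :
  f u = \sum_i (-1) ^+ t i *: f (fun x => u (t i (w x))).
Proof.
have fw v : f (fun x => v (w x)) =
    br (bcons (br (bcons (v (e0 ord0)) (fun i => v (e1 i)))) (fun i => v (e0 i))).
  rewrite /f; congr br; rewrite (@eq_bcons _ _ _ _ _ (fun i => v (e0 i))) => [|i i0].
    congr bcons; congr br; apply: funext => i; rewrite /bcons wE.
    have [->|i0] := eqVneq i ord0; first by rewrite bracket_swap_head.
    by rewrite (negbTE (i0 : i != 0 :> nat)) bracket_swap0.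
  by rewrite wE bracket_swap1.
have [_ _ br_fil] := br_lanke; rewrite {1}/f br_fil; apply: eq_bigr => i _.
rewrite /t; have [->|i0] := eqVneq i ord0.
  rewrite tperm1 odd_perm1 scale1r bcons_bset.
  have -> : (fun x => u ((1%g : {perm Y}) (w x))) = (fun x => u (w x)).
    by apply: funext => x; rewrite perm1.
  by rewrite fw.
rewrite (fw (fun x => u (t i x))) /t.
have neq : e0 ord0 != e0 i by apply: contraNneq i0 => /e0_inj ->.
rewrite odd_tperm neq expr1 scaleN1r tpermL.
have -> : bcons (u (e0 i)) (fun l => u (tperm (e0 ord0) (e0 i) (e1 l))) =
    bcons (u (e0 i)) (fun l => u (e1 l)).
  by apply: eq_bcons => j j0; rewrite tpermD // e01.
set U := br _; have neq' : ord0 != i by rewrite eq_sym.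
rewrite -[RHS](br_tperm br_lanke _ neq'); congr br; apply: funext => j.
rewrite /bset /bcons; have [->|ji] := eqVneq j i; first by rewrite tpermR.
case: tpermP => [->|ji'|/eqP j0 _]; last 1 first.
- rewrite (negbTE (j0 : j != 0 :> nat)) tpermD //.
    by apply: contraNneq j0 => /e0_inj ->.
  by apply: contraNneq ji => /e0_inj ->.
- by rewrite (negbTE (i0 : i != 0 :> nat)) tpermR.
- by rewrite ji' eqxx in ji.
Qed.

Variable u : Y -> L.

Definition signed_brackets (s : {perm Y}) : L :=
  (-1) ^+ s *: f (fun x => u (s x)).
Local Notation E := signed_brackets.

Lemma signed_brackets_swap x y (s : {perm Y}) :
  (x \in D0) && (y \in D0) || (x \in D1) && (y \in D1) -> E (tperm x y * s)%g = E s.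
Proof.
have [->|neq] := eqVneq x y; first by rewrite tperm1 mul1g.
move=> xy; rewrite /E odd_permM odd_tperm neq signr_addb expr1 mulN1r.
have -> : (fun z => u ((tperm x y * s)%g z)) = (fun z => u (s (tperm x y z))).
  by apply: funext => z; rewrite permM.
case/orP: xy => /andP[xD yD].
  by rewrite (two_brackets_swap0 (fun z => u (s z))) // scaleNr scalerN opprK.
by rewrite (two_brackets_swap1 (fun z => u (s z))) // scaleNr scalerN opprK.
Qed.

Lemma signed_brackets_filippov s : E s = (-1) ^+ w *: \sum_i E (w * t i * s)%g.
Proof.
rewrite {1}/E (two_brackets_filippov (fun x => u (s x))) !scaler_sumr.
apply: eq_bigr => i _; rewrite /E !scalerA; congr (_ *: _).
  rewrite !odd_permM -!signr_addb.
  by case: (odd_perm w) (odd_perm (t i)) (odd_perm s) => [] [] [].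
by congr f; apply: funext => x; rewrite !permM.
Qed.

(** This is S(Z, I): in the term of [s] the entry [u z] stands at the place [s^-1 z], which is
    inside when it lies in [D0]. *)
Definition brackets_sum (Z I : {set Y}) : L :=
  \sum_(s | perm_on D s && [forall z in Z, (s^-1%g z \in D0) == (z \in I)]) E s.
Local Notation S := brackets_sum.

Lemma brackets_sum_split (Z I : {set Y}) z : z \notin Z -> I \subset Z ->
  S Z I = S (z |: Z) I + S (z |: Z) (z |: I).
Proof.
move=> zZ IZ; have zI : z \notin I by apply: contra zZ; apply: (subsetP IZ).
rewrite /S [LHS](bigID (fun s : {perm Y} => s^-1%g z \in D0)) /= addrC.
congr (_ + _); apply: eq_bigl => s; rewrite -andbA; congr (_ && _);
  apply/andP/forall_inP => [[/forall_inP H hz] y|H].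
- by rewrite !inE => /predU1P[->|/H//]; rewrite (negbTE zI) (negbTE hz).
- split; last by have := H z; rewrite !inE eqxx (negbTE zI) => /(_ isT)/eqP ->.
  by apply/forall_inP => y yZ; apply: H; rewrite !inE yZ orbT.
- rewrite !inE => /predU1P[->|yZ]; first by rewrite eqxx hz.
  by rewrite (negbTE (memPn zZ _ yZ)) H.
- split; last by have := H z; rewrite !inE eqxx => /(_ isT)/eqP ->.
  apply/forall_inP => y yZ; have := H y; rewrite !inE yZ orbT => /(_ isT)/eqP ->.
  by rewrite (negbTE (memPn zZ _ yZ)).
Qed.

Lemma bracket_swap_on : perm_on D w.
Proof.
apply/subsetP => x; rewrite inE; apply: contraR => xD.
by rewrite wE bracket_swap_out.
Qed.

Lemma head_tperm_on i : perm_on D (t i).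
Proof.
apply/subsetP => x; rewrite inE /t; case: tpermP => [->|->|]; rewrite ?eqxx // => _.
  by rewrite inE mem_D0.
by rewrite inE mem_D0.
Qed.

Lemma perm_on_mull (A : {set Y}) (s s' : {perm Y}) :
  perm_on A s -> perm_on A (s * s')%g = perm_on A s'.
Proof.
move=> sA; apply/idP/idP => [ssA|]; last exact: perm_onM.
by rewrite -[s'](mulKg s) perm_onM ?perm_onV.
Qed.

Lemma bracket_swap_D0 y : y \in D -> (w y \in D0) = (y == e0 ord0) || (y \in D1).
Proof.
rewrite wE => /DP[->|[i i0 ->]|[i i0 ->]].
- by rewrite bracket_swap_head mem_D0 eqxx.
- rewrite bracket_swap0 // (inj_eq e0_inj) (negbTE i0) /= (D01 (mem_D0 i)).
  by apply/negP => /D01; rewrite mem_D1.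
- by rewrite bracket_swap1 // mem_D0 mem_D1 ?orbT.
Qed.

Lemma head_tperm_D0 i y : (t i y \in D0) = (y \in D0).
Proof. by rewrite /t; case: tpermP => [->|->|]; rewrite ?mem_D0. Qed.

(** [t i] exchanges two inner places, so it leaves [E] unchanged, and it turns the condition of
    avoiding the place [e0 i] into that of avoiding the head. *)
Lemma brackets_sum_head (Z : {set Y}) i :
  \sum_(s | perm_on D s && [forall z in Z, s^-1%g z \in D0 :\ e0 i]) E s =
  \sum_(s | perm_on D s && [forall z in Z, s^-1%g z \in D0 :\ e0 ord0]) E s.
Proof.
rewrite [RHS](reindex_inj (mulgI (t i))) /=; apply: eq_big => [s|s _]; last first.
  by rewrite signed_brackets_swap // !mem_D0.
rewrite perm_on_mull ?head_tperm_on //; congr (_ && _).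
apply: eq_forallb_in => z _; rewrite invMg permM tpermV 2!inE [in RHS]inE.
rewrite -/(t i) head_tperm_D0 inE; congr (~~ _ && _).
by rewrite -(inj_eq (@perm_inj _ (t i))) /t tpermR.
Qed.

(** After Filippov, the entries of [Z] that were outside are inside, away from the head; by
    [brackets_sum_head] the place they avoid may be taken to be [e0 i]. Summed over [i], an
    arrangement with all of [Z] inside is counted once for each of the [n.+1 - #|Z|] inner places
    free of [Z]. *)
Lemma brackets_sum_filippov (Z : {set Y}) : Z \subset D -> (#|Z| <= n.+1)%N ->
  S Z set0 = ((-1) ^+ w * (n.+1 - #|Z|)%:R) *: S Z Z.
Proof.
move=> ZD cardZ; rewrite {1}/S.
under eq_bigr => s _ do rewrite signed_brackets_filippov scaler_sumr.
rewrite exchange_big /=.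
transitivity ((-1) ^+ w *: \sum_(i < n.+1)
  \sum_(s | perm_on D s && [forall z in Z, s^-1%g z \in D0 :\ e0 i]) E s).
  rewrite scaler_sumr; apply: eq_bigr => i _.
  rewrite -scaler_sumr; congr (_ *: _); rewrite brackets_sum_head.
  rewrite [RHS](reindex_inj (mulgI (w * t i)%g)) /=; apply: eq_bigl => s.
  have wtD : perm_on D (w * t i)%g by rewrite perm_onM ?bracket_swap_on ?head_tperm_on.
  rewrite perm_on_mull //; case: (boolP (perm_on D s)) => //= sD.
  apply: eq_forallb_in => z zZ; rewrite in_set0 eqbF_neg invMg permM.
  have : (s^-1%g z) \in D by rewrite perm_closed ?perm_onV // (subsetP ZD).
  have : (w * t i)%g ((w * t i)^-1%g (s^-1%g z)) = s^-1%g z by rewrite permKV.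
  set y := (w * t i)^-1%g _ => ey yD.
  have yD' : y \in D by rewrite -(perm_closed y wtD) ey.
  rewrite -ey permM head_tperm_D0 bracket_swap_D0 // !inE negb_or.
  move: yD'; rewrite inE; case: (boolP (y \in D0)) => [/D01 ->|_ /= ->]; rewrite ?andbT ?andbF //.
transitivity ((-1) ^+ w *: \sum_(s | perm_on D s && [forall z in Z, (s^-1%g z \in D0) == (z \in Z)])
   (n.+1 - #|Z|)%:R *: E s); last by rewrite -scaler_sumr scalerA.
congr (_ *: _); under eq_bigr => i _ do rewrite big_mkcondr /=.
rewrite exchange_big /= big_mkcondr; apply: eq_bigr => s sD.
rewrite -big_mkcond /= sumr_const -scaler_nat; case: ifPn => [/forall_inP ZI|].
  congr (_%:R *: _).
  have -> : (n.+1 - #|Z| = #|[set: 'I_n.+1] :\: [set i | s (e0 i) \in Z]|)%N.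
    rewrite cardsD setTI cardsT card_ord; congr (_ - _)%N.
    have se_inj : injective (fun i => s (e0 i)) by move=> i j /perm_inj/e0_inj.
    rewrite -(card_imset _ se_inj); apply: eq_card => z.
    apply/idP/imsetP => [zZ|[i]]; last by rewrite inE => ? ->.
    have := ZI z zZ; rewrite zZ => /eqP /D0P[i ei].
    by exists i; rewrite ?inE -ei permKV.
  apply: eq_card => i; rewrite !inE andbT; apply/forall_inP/idP => [H|sZ z zZ].
    by apply/negP => /H; rewrite permK !inE eqxx.
  have := ZI z zZ; rewrite zZ !inE => /eqP ->; rewrite andbT.
  by apply: contra sZ => /eqP <-; rewrite permKV.
case/forall_inPn=> z zZ; rewrite zZ eqb_id => zD; rewrite eq_card0 ?scale0r // => i.
by apply/negbTE/forall_inPn; exists z => //; rewrite !inE negb_and zD orbT.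
Qed.

(** By induction the sum for [Z :\ z] is 0, and splitting it at [z] shows that moving one entry
    inside changes the sign. With [brackets_sum_filippov] this makes S(Z, 0) equal to +-(n + 1 -
    |Z|) times itself, and the factor has absolute value at least 2. *)
Lemma brackets_sum_eq0 (Z I : {set Y}) :
  Z \subset D -> (#|Z|.+2 <= n.+1)%N -> I \subset Z -> S Z I = 0.
Proof.
have [k] := ubnP #|Z|; elim: k => // k IH in Z I *; rewrite ltnS => leZ ZD cardZ IZ.
have alt (J : {set Y}) : J \subset Z -> S Z J = (-1) ^+ #|J| *: S Z set0.
  have [l] := ubnP #|J|; elim: l => // l IHl in J *; rewrite ltnS => leJ JZ.
  have [->|[z zJ]] := set_0Vmem J; first by rewrite cards0 scale1r.
  have zZ := subsetP JZ z zJ; have JzZ : J :\ z \subset Z :\ z by apply: setSD.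
  have cJ := cardsD1 z J; have cZ := cardsD1 z Z; rewrite zJ zZ in cJ cZ.
  have : S (Z :\ z) (J :\ z) = 0.
    by apply: IH => //; [lia|apply: subset_trans ZD; apply: subsetDl|lia].
  rewrite (@brackets_sum_split _ _ z) ?setD11 ?setD1K // => /eqP; rewrite addr_eq0 => /eqP e.
  rewrite -[LHS]opprK -e IHl ?cJ ?exprS ?mulN1r ?scaleNr //; first by lia.
  by apply: subset_trans JZ; apply: subsetDl.
have := brackets_sum_filippov ZD; rewrite (alt Z (subxx _)) scalerA; move=> /(_ ltac:(lia)) e.
suff S0 : S Z set0 = 0 by rewrite alt // S0 scaler0.
move/eqP: e; rewrite -subr_eq0 -{1}[S Z set0]scale1r -scalerBl scaler_eq0 => /orP[|/eqP //].
(* Neither 1 + (p + 2) nor 1 - (p + 2) vanishes in characteristic zero. *)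
have [p ->] : exists p, (n.+1 - #|Z| = p.+2)%N by exists (n.+1 - #|Z| - 2)%N; lia.
rewrite mulrAC -[(-1) ^+ #|Z|]signr_odd -signr_addb subr_eq0.
case: (_ (+) _); rewrite ?expr0 ?expr1.
  by rewrite mulN1r -addr_eq0 -(natrD _ 1) add1n (negbTE (natK _)).
rewrite mul1r -[p.+2]addn1 natrD -subr_eq0 opprD addrCA subrr addr0.
by rewrite oppr_eq0 (negbTE (natK _)).
Qed.

Lemma card_D : (#|D| <= n.+1 + n)%N.
Proof.
apply: leq_trans (leq_card_setU _ _) _; apply: leq_add.
  by apply: leq_trans (leq_imset_card _ _) _; rewrite cardsT card_ord.
by apply: leq_trans (leq_imset_card _ _) _; rewrite cardsC1 card_ord.
Qed.

(** The places outside [G] form a set [Z] of at most n - 1 elements, as [D] has at most 2n + 1. A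
    permutation that keeps each entry of [Z] on its side can be corrected by exchanges within a
    side, which do not change [E], until it fixes [Z]. So a positive multiple of the sum over [G] is
    a sum of copies of S(Z, I), which is 0. *)
Theorem bracket_garnir (G : {set Y}) : G \subset D -> (n.+2 <= #|G|)%N ->
  \sum_(s | perm_on G s) (-1) ^+ s *: f (fun x => u (s x)) = 0.
Proof.
move=> GD cardG; pose Z := D :\: G.
have GZ : G = D :\: Z by rewrite setDDr setDv set0U; apply/esym/setIidPr.
have ZD : Z \subset D by apply: subsetDl.
have cardZ : (#|Z|.+2 <= n.+1)%N.
  by have := card_D; have := cardsID G D; rewrite (setIidPr GD) -/Z; lia.
pose I := D0 :&: Z; have IZ : I \subset Z by apply: subsetIr.
pose cond (s : {perm Y}) := perm_on D s && [forall z in Z, (s^-1%g z \in D0) == (z \in I)].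
pose alt s := \sum_(s' | perm_on G s') E (s * s')%g.
have GsubD s : perm_on G s -> perm_on D s by move=> /subset_trans; apply.
have out s z : perm_on G s -> z \in Z -> s z = z.
  by move=> Gs; rewrite inE => /andP[zG _]; apply: out_perm Gs zG.
have alt1 s : cond s -> alt s = alt 1%g.
  have [k] := ubnP #|[set z in Z | s z != z]|; elim: k => // k IH in s *.
  rewrite ltnS => lek /andP[sD /forall_inP sI].
  have [s0|[z]] := set_0Vmem [set z in Z | s z != z].
    rewrite /alt [RHS](reindex_inj (mulgI s)) /=; apply: eq_big => [s'|s' _]; last by rewrite mul1g.
    rewrite perm_on_mull //; apply/subsetP => y; rewrite inE => sy.
    rewrite GZ inE; apply/andP; split; last first.
      by apply: contraR sy => yD; rewrite (out_perm sD).
    by apply/negP => yZ; have := in_set0 y; rewrite -s0 in_set yZ sy.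
  rewrite inE => /andP[zZ sz]; pose z' := s^-1%g z.
  have sz' : s z' = z by rewrite /z' permKV.
  have zz' : z != z' by apply: contraNneq sz => {1}->; rewrite sz'.
  have z'D : z' \in D by rewrite -(perm_closed _ sD) sz' (subsetP ZD).
  have zD := subsetP ZD z zZ.
  have D0z : (z' \in D0) = (z \in D0) by rewrite (eqP (sI z zZ)) inE zZ andbT.
  have D1z y : y \in D -> (y \in D1) = (y \notin D0).
    by rewrite inE; case: (boolP (y \in D0)) => [/D01 ->|_ /= ->].
  have -> : alt s = alt (tperm z z' * s)%g.
    apply: eq_bigr => s' _; rewrite -mulgA signed_brackets_swap //.
    by rewrite !D1z // D0z; case: (z \in D0).
  have tD : perm_on D (tperm z z').
    by apply/subsetP => y; rewrite inE; case: tpermP => [->|->|]; rewrite ?eqxx.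
  apply: IH; last first.
    rewrite /cond perm_on_mull // sD; apply/forall_inP => y yZ.
    rewrite -(eqP (sI y yZ)) invMg permM tpermV.
    by case: tpermP => [->|->|_ _] //; rewrite D0z.
  apply: leq_trans lek; apply: proper_card; apply/properP; split.
    apply/subsetP => y; rewrite !inE permM => /andP[-> /=]; apply: contraNneq => sy.
    rewrite tpermD ?sy //; first by apply: contraNneq sz => ->; rewrite sy.
    by apply: contraNneq zz' => e; rewrite -sz' e sy -e.
  by exists z; rewrite in_set zZ //= permM tpermL sz' eqxx.
have := brackets_sum_eq0 ZD cardZ IZ => S0.
have : \sum_(s | cond s) alt s = 0.
  rewrite /alt exchange_big big1 //= => s' Gs'; rewrite -[RHS]S0 /S.
  rewrite [RHS](reindex_inj (mulIg s')) /=; apply: eq_bigl => s.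
  have sD' := GsubD _ Gs'; rewrite /cond; congr (_ && _).
    apply/idP/idP => [|H]; first by move/perm_onM; apply.
    by rewrite -[s](mulgK s') perm_onM ?perm_onV.
  apply: eq_forallb_in => z zZ; rewrite invMg permM.
  by rewrite (out s'^-1%g) ?perm_onV.
rewrite (eq_bigr (fun=> alt 1%g)) // big_const iter_addr_0 -scaler_nat => /eqP.
rewrite scaler_eq0 => /orP[|/eqP alt0].
  have : (0 < #|cond|)%N.
    apply/card_gt0P; exists 1%g; rewrite unfold_in perm_on1 /=.
    by apply/forall_inP => z zZ; rewrite invg1 perm1 inE zZ andbT.
  by case: #|_| => // c _; rewrite (negbTE (natK c)).
by rewrite -[RHS]alt0; apply: eq_bigr => s _; rewrite mul1g.
Qed.

End BracketGarnir.

(** * The shape and its left-normed brackets *)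

Section OptionPerm.
Variable X : finType.

(** [None] stands for the bracket of the earlier columns, which occupies a slot without being the
    entry of a box. Permutations of boxes are extended by fixing it. *)
Definition option_perm (s : {perm X}) : {perm option X} :=
  perm (inj_omap (@perm_inj _ s)).

Lemma option_permE s x : option_perm s x = omap s x.
Proof. by rewrite permE. Qed.

Lemma option_perm_inj : injective option_perm.
Proof.
move=> s s' /permP e; apply/permP => x; have := e (Some x).
by rewrite !option_permE => -[].
Qed.

Lemma option_perm_sign (K : fieldType) s : (-1) ^+ option_perm s = (-1) ^+ s :> K.
Proof.
pose f (s : {perm X}) : K^o := (-1) ^+ option_perm s.
have f_alt (s' : {perm X}) x y : x != y -> tt = tt -> f (tperm x y * s')%g = - f s'.
  move=> neq _; rewrite /f.
  have -> : option_perm (tperm x y * s') = (tperm (Some x) (Some y) * option_perm s')%g.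
    apply/permP => -[z|]; rewrite option_permE permM option_permE /=; last first.
      by rewrite tpermD // option_permE.
    have -> : tperm (Some x) (Some y) (Some z) = Some (tperm x y z).
      by rewrite inj_tperm //; apply: Some_inj.
    by rewrite permM.
  rewrite odd_permM odd_tperm (inj_eq Some_inj) neq.
  by case: (odd_perm _); rewrite /= ?expr0 ?expr1 ?opprK.
have := alternating_perm (cls := fun=> tt) f_alt (s := s) 1%g (fun=> erefl).
rewrite mulg1 /f => ->; have -> : option_perm 1 = 1%g.
  by apply/permP => -[z|]; rewrite option_permE !perm1 //= perm1.
by rewrite odd_perm1; apply: mulr1.
Qed.

Lemma option_perm_sum (K : fieldType) (V : lmodType K) (G : {set X})
    (phi : (option X -> option X) -> V) :
  \sum_(s | perm_on G s) (-1) ^+ s *: phi (omap s) =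
  \sum_(s : {perm option X} | perm_on (Some @: G) s) (-1) ^+ s *: phi s.
Proof.
transitivity (\sum_(s in option_perm @: [set s | perm_on G s]) (-1) ^+ s *: phi s).
  rewrite big_imset /=; last by move=> ? ? _ _; apply: option_perm_inj.
  apply: eq_big => [s|s _]; first by rewrite inE.
  by rewrite option_perm_sign; congr (_ *: phi _); apply: funext => x; rewrite option_permE.
apply: eq_bigl; suff -> : option_perm @: [set s | perm_on G s] =
    [set s | perm_on (Some @: G) s] by move=> s; rewrite inE.
apply/eqP; rewrite eqEcard; apply/andP; split.
  apply/subsetP => ? /imsetP[s]; rewrite inE => Gs ->; rewrite inE.
  apply/subsetP => -[x|]; rewrite inE option_permE //=.
  by rewrite (inj_eq Some_inj) => sx; apply/imset_f/(subsetP Gs).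
rewrite (card_imset _ option_perm_inj) !cardsE !card_perm card_imset //.
exact: Some_inj.
Qed.

End OptionPerm.

Section Boxes.
Variables (k n : nat).

(* The boxes of alpha(n+1, k)': the column number comes first and boxes are
   numbered along the diagonals, so that a box (j, i) with i > 0 is to the right
   of the box (j-1, i-1).  Only the first column has a box number 0. *)
Definition cbox : Type :=
  {b : 'I_k * 'I_n.+1 | (b.1 == 0 :> nat) || (b.2 != ord0)}.
HB.instance Definition _ := Finite.on cbox.

Definition ccol (b : cbox) : nat := (val b).1.
Definition cidx (b : cbox) : nat := (val b).2.
(** The shift k - 2 puts the top box of the last column, with [ccol] equal to k - 1 and [cidx] equal
    to 1, into row 0; hence for k at least 2 the subtraction is never cut off. *)
Definition crow (b : cbox) : nat := (k - 2 + cidx b - ccol b)%N.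

Lemma cboxP (b : cbox) :
  [/\ (ccol b < k)%N, (cidx b <= n)%N & (ccol b == 0%N) || (cidx b != 0%N)].
Proof. by split; [exact: ltn_ord|rewrite -ltnS ltn_ord|exact: (valP b)]. Qed.

Lemma cbox_ext b b' : ccol b = ccol b' -> cidx b = cidx b' -> b = b'.
Proof.
move=> ec ei; apply: val_inj; rewrite [LHS]surjective_pairing [RHS]surjective_pairing.
by congr (_, _); apply: val_inj.
Qed.

Lemma cbox_exists j i : (j < k)%N -> (i <= n)%N -> (j == 0%N) || (i != 0%N) ->
  exists b, ccol b = j /\ cidx b = i.
Proof.
move=> lj; rewrite -[(i <= n)%N]/(i < n.+1)%N => li ji.
by exists (exist _ (Ordinal lj, Ordinal li) ji : cbox).
Qed.

Hypothesis k2 : (2 <= k)%N.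

Lemma cbox_inj b b' : crow b = crow b' -> ccol b = ccol b' -> b = b'.
Proof.
have [] := cboxP b; have [] := cboxP b'; rewrite /crow => lc' li' v' lc li v e ec.
by apply: cbox_ext => //; lia.
Qed.

Lemma cbox_convex b b' : crow b = crow b' -> (ccol b < ccol b')%N ->
  exists b'', crow b'' = crow b /\ ccol b'' = (ccol b).+1.
Proof.
have [] := cboxP b; have [] := cboxP b'; rewrite /crow => lc' li' v' lc li v e ec.
have [|||b'' [c'' i'']] := @cbox_exists (ccol b).+1 (cidx b).+1; [lia|lia|by []|].
by exists b''; rewrite c'' i''; lia.
Qed.

(** With [i] for [cidx b0], the box [b1] has number i + 1, and its column starts at number 1. So n +
    1 - i boxes come from the column of [b0] and i + 1 from that of [b1], which adds up to the size
    that [bracket_garnir] asks for. *)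
Lemma card_cgarnir b0 b1 : crow b0 = crow b1 -> ccol b1 = (ccol b0).+1 ->
  (n.+2 <= #|garnir_set crow ccol b0 b1|)%N.
Proof.
have [] := cboxP b0; have [] := cboxP b1; rewrite /crow => lc' li' v' lc li v e ec.
have ei : cidx b1 = (cidx b0).+1 by lia.
have /choice[h hP] (a : 'I_n.+2) : exists b, if (a <= n - cidx b0)%N
    then ccol b = ccol b0 /\ cidx b = (cidx b0 + a)%N
    else ccol b = ccol b1 /\ cidx b = (a - (n - cidx b0))%N.
  have lan := ltn_ord a; case: leqP => la; apply: cbox_exists; lia.
have h_inj : injective h.
  move=> a a' eh; have := hP a; have := hP a'; rewrite eh.
  by case: leqP => ?; case: leqP => ? [? ?] [? ?]; apply: val_inj => /=; lia.
rewrite -[n.+2]card_ord -(card_codom h_inj); apply/subset_leq_card/subsetP.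
move=> ? /codomP[a ->]; have lan := ltn_ord a; have := hP a; rewrite !inE /crow.
case: leqP => la [-> ->]; first by rewrite eqxx /=; lia.
by rewrite eqxx andTb; lia.
Qed.

(** Two adjacent columns j and j + 1 meet just n + 1 rows, the consecutive ones from k - 2 - j
    on. *)
Lemma cgarnir_rows b0 b1 : crow b0 = crow b1 -> ccol b1 = (ccol b0).+1 ->
  exists2 R : seq nat, (size R < #|garnir_set crow ccol b0 b1|)%N
    & forall b, (ccol b == ccol b0) || (ccol b == ccol b1) -> crow b \in R.
Proof.
move=> r01 c01; exists (iota (k - 2 - ccol b0) n.+1).
  by rewrite size_iota; apply: card_cgarnir.
have [lc1 _ _] := cboxP b1 => b; have [lc li v] := cboxP b.
by rewrite mem_iota /crow; lia.
Qed.

Definition cbox_at (j : nat) (i : 'I_n.+1) : option cbox :=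
  [pick b | (ccol b == j) && (cidx b == i)].

Lemma cbox_at_Some b j (i : 'I_n.+1) : ccol b = j -> cidx b = i -> cbox_at j i = Some b.
Proof.
move=> ec ei; rewrite /cbox_at; case: pickP => [b' /andP[/eqP c' /eqP i']|/(_ b)].
  by congr Some; apply: cbox_ext; rewrite ?c' ?i'.
by rewrite ec ei !eqxx.
Qed.

Variant cbox_at_spec j (i : 'I_n.+1) : option cbox -> Type :=
| CboxSome b of ccol b = j & cidx b = i : cbox_at_spec j i (Some b)
| CboxNone of j != 0%N & i = ord0 : cbox_at_spec j i None.

Lemma cbox_atP j i : (j < k)%N -> cbox_at_spec j i (cbox_at j i).
Proof.
move=> jk; rewrite /cbox_at; case: pickP => [b /andP[/eqP c' /eqP i']|nb]; first by constructor.
have nv : ~~ ((j == 0%N) || (i != 0 :> nat)).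
  apply/negP => v; have [|b [cb ib]] := cbox_exists jk _ v; first by rewrite -ltnS.
  by have := nb b; rewrite cb ib !eqxx.
by constructor; [case: (j) nv|apply/val_inj/eqP/negPn; move: nv; rewrite negb_or => /andP[]].
Qed.

Lemma cbox_at_inj j : (j < k)%N -> injective (cbox_at j).
Proof.
move=> jk i i'; case: (cbox_atP i jk) => [b cb ib|j0 ->]; case: (cbox_atP i' jk) => //.
  by move=> b' cb' ib' [e]; apply: val_inj; rewrite /= -ib -ib' e.
Qed.

End Boxes.

Section Combs.
Variables (K : fieldType) (natK : forall a, a.+1%:R != 0 :> K).
Variables (k n : nat) (k2 : (2 <= k)%N).
Variables (L : lmodType K) (br : ('I_n.+1 -> L) -> L).
Hypothesis br_lanke : is_lanke br.
Local Notation cbox := (cbox k n).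
Local Notation cbox_at := (@cbox_at k n).

(* Left-normed brackets; cbox_at j 0 is None for j > 0, which is where the bracket
   of the previous columns goes.  The value 0 at j = 0 is never used. *)
Fixpoint comb (u : cbox -> L) (j : nat) : L :=
  if j is j'.+1 then br (fun i => oapp u (comb u j') (cbox_at j' i)) else 0.

Lemma comb_local u u' j : (forall b, (ccol b < j)%N -> u b = u' b) -> comb u j = comb u' j.
Proof.
elim: j => //= j IH uu'; rewrite IH => [|b bj]; last by apply: uu'; apply: ltnW.
congr br; apply: funext => i; rewrite /cbox_at.
by case: pickP => //= b /andP[/eqP cb _]; apply: uu'; rewrite cb.
Qed.

Lemma comb_bcons u j : (0 < j < k)%N ->
  comb u j.+1 = br (bcons (comb u j) (fun i => oapp u 0 (cbox_at j i))).
Proof.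
case/andP=> j0 jk; rewrite [comb u j.+1]/=; congr br; apply: funext => i.
rewrite /bcons; case: (cbox_atP i jk) => [b cb ib|_ ->] //=.
by case: eqP => // i0; have [_ _] := cboxP b; rewrite cb ib i0 /= orbF; case: (j) j0.
Qed.

(** The later columns are absorbed one at a time by brackets linear in their first entry, so a
    relation among the first [J] columns survives. *)
Lemma comb_relation (I : Type) (r : seq I) (P : pred I) (a : I -> K)
    (us : I -> cbox -> L) (u : cbox -> L) (J j : nat) :
    (0 < J)%N -> (J <= j <= k)%N ->
    (forall i b, P i -> (J <= ccol b)%N -> us i b = u b) ->
    \sum_(i <- r | P i) a i *: comb (us i) J = 0 ->
  \sum_(i <- r | P i) a i *: comb (us i) j = 0.
Proof.
move=> J0 + usE sumJ; elim: j => [|j IH]; first by rewrite leqn0 => /andP[/eqP <-].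
case/andP=> Jj jk; have [<- //|neq] := eqVneq J j.+1.
have Jj' : (J <= j)%N by rewrite -ltnS ltn_neqAle neq.
have jk' : (0 < j < k)%N by rewrite jk andbT (leq_trans J0).
have {}IH := IH ltac:(by rewrite Jj' ltnW).
transitivity (\sum_(i <- r | P i) a i *:
  br (bcons (comb (us i) j) (fun l => oapp u 0 (cbox_at j l)))).
  apply: eq_bigr => i Pi; rewrite comb_bcons //; congr (_ *: br (bcons _ _)).
  apply: funext => l; rewrite /cbox_at; case: pickP => //= b /andP[/eqP cb _].
  by apply: usE; rewrite ?cb.
by rewrite -(br_head_sum br_lanke) IH (br_head0 br_lanke).
Qed.

Lemma comb_alternating u b b' : b != b' -> ccol b = ccol b' ->
  comb (fun c => u (tperm b b' c)) k = - comb u k.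
Proof.
move=> neq cbb'; set ut := fun c => _; set j := ccol b in cbb'.
have [jk _ _] := cboxP b.
suff : \sum_(i : bool) 1 *: comb (if i then ut else u) k = 0.
  by rewrite big_bool !scale1r => /eqP; rewrite addr_eq0 => /eqP.
have out c : ccol c != j -> ut c = u c.
  by move=> cj; rewrite /ut tpermD //; apply: contraNneq cj => <-; rewrite -?cbb'.
apply: (@comb_relation _ _ _ _ _ u j.+1) => //; first by rewrite jk leqnn.
  by move=> [] // c _ cj; rewrite out // gtn_eqF.
rewrite big_bool !scale1r /=; apply/eqP; rewrite addr_eq0; apply/eqP.
rewrite (@comb_local ut u) => [|c cj]; last by rewrite out // ltn_eqF.
have [i bi] : exists i, cbox_at j i = Some b.
  by exists (val b).2; apply: cbox_at_Some.
have [i' bi'] : exists i, cbox_at j i = Some b'.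
  by exists (val b').2; apply: cbox_at_Some.
have neq' : i != i' by apply: contraNneq neq => ii'; move: bi; rewrite ii' bi' => -[->].
rewrite -(br_tperm br_lanke _ neq'); congr br; apply: funext => l.
rewrite (inj_tperm _ _ _ (cbox_at_inj jk)) bi bi' /ut.
case: (cbox_at j l) => [c|]; last by rewrite tpermD.
by rewrite -(inj_tperm _ _ _ (@Some_inj _)).
Qed.

(** At the two columns involved the relation is [bracket_garnir] on the places [option cbox];
    [comb_relation] carries it past the remaining columns. *)
Lemma comb_garnir u b0 b1 : crow b0 = crow b1 -> ccol b1 = (ccol b0).+1 ->
  \sum_(s | perm_on (garnir_set (@crow k n) (@ccol k n) b0 b1) s)
    (-1) ^+ s *: comb (fun c => u (s c)) k = 0.
Proof.
move=> r01 c01; set G := garnir_set _ _ _ _; set j := ccol b0 in c01.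
have [jk _ _] := cboxP b1; rewrite c01 in jk.
have colG c : c \in G -> (ccol c == j) || (ccol c == j.+1).
  by rewrite !inE c01 => /orP[/andP[->]|/andP[->]]; rewrite ?orbT.
have out s c : perm_on G s -> ccol c != j -> ccol c != j.+1 -> s c = c.
  move=> Gs cj cj1; rewrite (out_perm Gs) //; apply/negP => /colG.
  by rewrite (negbTE cj) (negbTE cj1).
apply: (@comb_relation _ _ _ _ _ u j.+2) => //; first by rewrite jk leqnn.
  by move=> s c Gs cj; rewrite (out s) // gtn_eqF //; lia.
set v := comb u j.
transitivity (\sum_(s | perm_on G s) (-1) ^+ s *:
  two_brackets br (cbox_at j) (cbox_at j.+1) (fun x => oapp u v (omap s x))).
  apply: eq_bigr => s Gs; congr (_ *: _); rewrite comb_bcons ?jk //= /two_brackets.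
  rewrite (@comb_local _ u) => [|c cj]; last by rewrite (out s) // ltn_eqF //; lia.
  congr br; set w := br _; set w' := br _.
  have -> : w = w'.
    by congr br; apply: funext => i; case: (cbox_at j i).
  apply: eq_bcons => i i0; case: (cbox_atP i jk) => [c _ _|_ i0'] //.
  by rewrite i0' eqxx in i0.
rewrite (option_perm_sum G (fun h => two_brackets br (cbox_at j) (cbox_at j.+1)
  (fun x => oapp u v (h x)))).
have jk' : (j < k)%N by apply: ltnW.
apply: bracket_garnir => //.
- exact: cbox_at_inj.
- by move=> i i' _ _; apply: cbox_at_inj.
- move=> i i' i'0; case: (cbox_atP i' jk) => [c cc _|_ e]; last by rewrite e eqxx in i'0.
  case: (cbox_atP i jk') => // c' cc' _; apply/eqP => -[e]; move: cc cc'.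
  by rewrite e => ->; lia.
- apply/subsetP => _ /imsetP[c cG ->]; rewrite inE.
  have := colG c cG => /orP[|] /eqP cc.
    apply/orP; left; apply/imsetP; exists (val c).2 => //.
    by apply/esym/cbox_at_Some.
  apply/orP; right; apply/imsetP; exists (val c).2; last by apply/esym/cbox_at_Some.
  by have [_ _] := cboxP c; rewrite cc !inE.
- rewrite card_imset; [exact: card_cgarnir|exact: Some_inj].
Qed.

End Combs.

(** * Left-normed brackets span the free LAnKe *)

Section FreeCombs.
Variables (K : fieldType) (n : nat) (A : eqType).
Local Notation FL := (free_lanke K n.+1 A).
Local Notation br := (@lbr K n.+1 A).
Local Notation gen := (@lgen K n.+1 A).
Let br_lanke : is_lanke br := @free_lankeP K n.+1 A.

Lemma bset_id (T : Type) (x : 'I_n.+1 -> T) i : bset x i (x i) = x.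
Proof. by apply: funext => j; rewrite /bset; case: eqP => [->|]. Qed.

Lemma br_slot_linear (x : 'I_n.+1 -> FL) i : linear (fun u => br (bset x i u)).
Proof. by move=> a u v; have [br_lin _ _] := br_lanke; rewrite br_lin. Qed.

Lemma br_slot0 (x : 'I_n.+1 -> FL) i : x i = 0 -> br x = 0.
Proof.
move=> xi; rewrite -(bset_id x i) xi.
by have := br_slot_linear x i (-1) 0 0; rewrite !scaleN1r !addNr.
Qed.

Lemma br_swap_head (u v : FL) y p : p != ord0 ->
  br (bcons u (bset y p v)) = - br (bcons v (bset y p u)).
Proof.
move=> p0; have p0' : ord0 != p by rewrite eq_sym.
rewrite -(br_tperm br_lanke _ p0'); congr br; apply: funext => j; rewrite /bset /bcons.
case: tpermP => [->|->|j0 jp].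
- by rewrite (negbTE (p0 : p != 0 :> nat)) !eqxx.
- by rewrite (negbTE (p0 : p != 0 :> nat)) !eqxx.
- by rewrite (introF eqP jp); move/eqP: j0 => /negbTE; rewrite -val_eqE => /= ->.
Qed.

Definition lcomb (a : A) (es : seq ('I_n.+1 -> A)) : FL :=
  foldl (fun v e => br (bcons v (fun i => gen (e i)))) (gen a) es.

(** The number of brackets is recorded because it must come out equal to the number of columns. *)
Definition comb_span (s : nat) : FL -> Prop :=
  lspan (fun v => exists a es, size es = s /\ v = lcomb a es).

Lemma comb_span_gen a : comb_span 0 (gen a).
Proof. by apply: lspan_gen; exists a, [::]. Qed.

Lemma comb_span_bracket s v e :
  comb_span s v -> comb_span s.+1 (br (bcons v (fun i => gen (e i)))).
Proof.
move=> Hv; apply: (lspan_map (br_head_linear br_lanke _) _ Hv) => _ [a [es [<- ->]]].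
by apply: lspan_gen; exists a, (rcons es e); rewrite size_rcons /lcomb foldl_rcons.
Qed.

Lemma bset_gen (e : 'I_n.+1 -> A) p a :
  bset (fun i => gen (e i)) p (gen a) = fun i => gen (bset e p a i).
Proof. by apply: funext => i; rewrite /bset; case: eqP. Qed.

(** Induction on the brackets of [v]. Write [v] as the bracket of [v'] with letters, exchange [u]
    and [v], and expand by Filippov: either [u] is bracketed with the shorter [v'], or [u] first
    absorbs letters, becoming a longer left-normed bracket, and then meets [v']. Hence [u] and [s]
    are generalized in the induction. *)
Lemma comb_span_bracket2 s s' u v e p : p != ord0 ->
  comb_span s u -> comb_span s' v ->
  comb_span (s + s').+1 (br (bcons u (bset (fun i => gen (e i)) p v))).
Proof.
move=> p0 Hu Hv.
have lin_v : linear (fun v => br (bcons u (bset (fun i => gen (e i)) p v))).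
  move=> a x y; rewrite !(br_swap_head u) // (br_head_linear br_lanke).
  by rewrite opprD scalerN.
apply: (lspan_map lin_v _ Hv) => {lin_v Hv} _ [a [es [<- ->]]] {v}.
elim/last_ind: es a => [|es e' IH] a in s u e p p0 Hu *.
  by rewrite addn0 bset_gen; apply: comb_span_bracket.
rewrite size_rcons /lcomb foldl_rcons -/(lcomb a es); set v' := lcomb a es.
rewrite br_swap_head //; apply: lspanN.
have [_ _ ->] := br_lanke; apply: lspan_sum => i _.
have [->|i0] := eqVneq i ord0.
  have -> : bcons v' (fun i => gen (e' i)) ord0 = v' by [].
  have -> z : bset (bcons v' (fun i => gen (e' i))) ord0 z = bcons z (fun i => gen (e' i)).
    by apply: funext => j; rewrite /bset /bcons -[j == ord0]/(j == 0 :> nat); case: ifP => // ->.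
  rewrite addnS; apply: comb_span_bracket; rewrite br_swap_head //; apply: lspanN.
  exact: IH.
have -> : bcons v' (fun i => gen (e' i)) i = gen (e' i).
  by rewrite /bcons (negbTE (i0 : i != 0 :> nat)).
have -> z : bset (bcons v' (fun i => gen (e' i))) i z = bcons v' (bset (fun i => gen (e' i)) i z).
  apply: funext => j; rewrite /bset /bcons; have [->|//] := eqVneq j i.
  by rewrite (negbTE (i0 : i != 0 :> nat)).
rewrite br_swap_head //; apply: lspanN; rewrite addnS -addSn; apply: IH => //.
rewrite br_swap_head // bset_gen; apply: lspanN; exact: comb_span_bracket.
Qed.

(** The slots are expanded one after the other; [l] lists those still to be expanded. *)
Lemma lspan_multilinear (G : 'I_n.+1 -> FL -> Prop) (Q : FL -> Prop) :
    (forall v, (forall i, G i (v i)) -> lspan Q (br v)) ->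
  forall v, (forall i, lspan (G i) (v i)) -> lspan Q (br v).
Proof.
move=> GQ v vG.
suff H (l : seq 'I_n.+1) : forall w, (forall i, i \in l -> lspan (G i) (w i)) ->
    (forall i, i \notin l -> G i (w i)) -> lspan Q (br w).
  by apply: (H (enum 'I_n.+1)) => i //; rewrite mem_enum.
elim: l => [|p l IH] w wl wnl; first by apply: GQ => i; apply: wnl.
have [pl|pl] := boolP (p \in l).
  apply: IH => i il; first by apply: wl; rewrite inE il orbT.
  by apply: wnl; rewrite inE negb_or il andbT; apply: contraNneq il => ->.
rewrite -(bset_id w p); apply: (lspan_map (br_slot_linear w p) _ (wl p (mem_head _ _))).
move=> u Gu; apply: IH => i il; rewrite /bset; case: eqP => [e|/eqP ip].
- by rewrite -e il in pl.
- by apply: wl; rewrite inE il orbT.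
- by rewrite e.
- by apply: wnl; rewrite inE negb_or ip.
Qed.

(** Induction on the total number of brackets. An entry that is not a letter is brought to the front
    as the bracket of [v'] with letters. In each term of the Filippov expansion the new inner
    bracket has fewer brackets in its entries, so it is a combination of left-normed ones, and
    [comb_span_bracket] or [comb_span_bracket2] finishes. *)
Lemma comb_span_br (s : 'I_n.+1 -> nat) v :
  (forall i, comb_span (s i) (v i)) -> comb_span (\sum_i s i).+1 (br v).
Proof.
have [k] := ubnP (\sum_i s i); elim: k => // k IH in s v *; rewrite ltnS => lek.
apply: lspan_multilinear => {}v vs.
have [s0|/existsP[p sp]] := boolP [forall i, s i == 0%N].
  have /choice[a va] i : exists a, v i = gen a.
    have [a [es [ses ->]]] := vs i; exists a.
    by case: es ses => // e es /= ; rewrite (eqP (forallP s0 i)).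
  rewrite big1 => [|i _]; last exact/eqP/(forallP s0).
  have -> : v = bcons (gen (a ord0)) (fun i => gen (a i)).
    apply: funext => i; rewrite va /bcons.
    by case: eqP => // i0; congr (gen (a _)); apply: val_inj.
  exact/comb_span_bracket/comb_span_gen.
have [a [es [ses vp]]] := vs p.
case/lastP: es => [|es e] in ses vp; first by rewrite -ses eqxx in sp.
rewrite /lcomb foldl_rcons -/(lcomb a es) size_rcons in ses vp; set v' := lcomb a es in vp.
pose y i := v (tperm ord0 p i).
have sum_s : (\sum_i s i = s p + \sum_(i | i != ord0) s (tperm ord0 p i))%N.
  rewrite (reindex_inj (@perm_inj _ (tperm ord0 p))) (bigD1 ord0) //=.
  by rewrite tpermL.
have yE : y = bcons (v p) y.
  apply: funext => i; rewrite /bcons; case: eqP => // i0.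
  by rewrite /y (_ : i = ord0) ?tpermL //; apply: val_inj.
suff Hy : comb_span (\sum_i s i).+1 (br y).
  have [p0|p0] := eqVneq ord0 p; last first.
    by rewrite -[br v]opprK -(br_tperm br_lanke _ p0); apply: lspanN.
  suff <- : y = v by []; apply: funext => i; by rewrite /y -p0 tperm1 perm1.
have vE i : comb_span (s i) (v i) by apply: lspan_gen; apply: vs.
have Hy u s0 : comb_span s0 u -> (s0 < s p)%N ->
    comb_span (s0 + \sum_(i | i != ord0) s (tperm ord0 p i)).+1 (br (bcons u y)).
  move=> Hu s0p.
  pose s' (i : 'I_n.+1) := if i == ord0 then s0 else s (tperm ord0 p i).
  have <- : (\sum_i s' i = s0 + \sum_(i | i != ord0) s (tperm ord0 p i))%N.
    rewrite (bigD1 ord0) //= /s' eqxx; congr (_ + _)%N.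
    by apply: eq_bigr => i /negbTE ->.
  apply: IH.
    rewrite (bigD1 ord0) //= {1}/s' eqxx (eq_bigr (fun i => s (tperm ord0 p i))).
      by apply: leq_trans lek; rewrite sum_s -addSn leq_add2r.
    by move=> i /negbTE i0; rewrite /s' i0.
  move=> i; rewrite /s' /bcons -[i == ord0]/(i == 0 :> nat).
  by case: eqP => // _; apply: vE.
have Hv' : comb_span (size es) v' by apply: lspan_gen; exists a, es.
rewrite yE vp; have [_ _ ->] := br_lanke; apply: lspan_sum => i _.
have [->|i0] := eqVneq i ord0.
  have -> : bcons v' (fun i => gen (e i)) ord0 = v' by [].
  have -> z : bset (bcons v' (fun i => gen (e i))) ord0 z = bcons z (fun i => gen (e i)).
    by apply: funext => j; rewrite /bset /bcons -[j == ord0]/(j == 0 :> nat); case: ifP => // ->.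
  apply: comb_span_bracket; rewrite sum_s -ses addSn; apply: Hy => //.
  by rewrite -ses.
have -> : bcons v' (fun i => gen (e i)) i = gen (e i).
  by rewrite /bcons (negbTE (i0 : i != 0 :> nat)).
have -> z : bset (bcons v' (fun i => gen (e i))) i z = bcons v' (bset (fun i => gen (e i)) i z).
  apply: funext => j; rewrite /bset /bcons; have [->|//] := eqVneq j i.
  by rewrite (negbTE (i0 : i != 0 :> nat)).
rewrite sum_s -ses addSn -addnS; apply: comb_span_bracket2 => //.
by rewrite -[X in comb_span X.+1]add0n; apply: Hy; [exact: comb_span_gen|rewrite -ses].
Qed.

Fixpoint nbr (w : bword n.+1 A) : nat :=
  if w is Bracket ws then (\sum_i nbr (ws i)).+1 else 0%N.

Lemma comb_span_word w : comb_span (nbr w) (word_elt K w).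
Proof.
by elim: w => [a|ws IH] /=; [exact: comb_span_gen|exact: comb_span_br].
Qed.

End FreeCombs.

Section CombVanish.
Variables (K : fieldType) (k n : nat) (A : eqType).
Local Notation FL := (free_lanke K n.+1 A).
Local Notation br := (@lbr K n.+1 A).
Local Notation gen := (@lgen K n.+1 A).
Local Notation cbox := (cbox k n).
Let br_lanke : is_lanke br := @free_lankeP K n.+1 A.

Lemma comb_of_lcomb a (es : seq ('I_n.+1 -> A)) : (0 < k)%N -> size es = k ->
  exists T : {ffun cbox -> A}, lcomb K a es = comb br (fun b => gen (T b)) k.
Proof.
move=> k0 ses; pose T := [ffun b : cbox => if cidx b == 0%N then a
  else nth (fun=> a) es (ccol b) (val b).2].
exists T; suff H j : (0 < j <= k)%N -> comb br (fun b => gen (T b)) j = lcomb K a (take j es).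
  by rewrite H ?k0 ?leqnn // take_oversize // ses.
elim: j => // j IH jk; rewrite (take_nth (fun=> a)) ?ses // /lcomb foldl_rcons.
rewrite -/(lcomb K a _) [LHS]/=; congr br; apply: funext => i; rewrite /bcons.
case: (cbox_atP i jk) => [b cb ib|j0 ->] /=; last first.
  by apply: IH; move: jk; case: (j) j0 => // j' _ /ltnW.
rewrite ffunE ib; case: eqP => [i0|_]; last first.
  by rewrite cb; congr (gen (nth _ _ _ _)); apply: val_inj.
have [_ _] := cboxP b; rewrite cb ib i0 orbF => /eqP ->.
by rewrite take0.
Qed.

Lemma comb_eq0 (u : cbox -> FL) b j : (ccol b < j)%N -> (j <= k)%N -> u b = 0 ->
  comb br u j = 0.
Proof.
elim: j => // j IH; rewrite ltnS leq_eqVlt => cbj jk ub; rewrite [LHS]/=.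
have [cb|cb] := eqVneq (ccol b) j.
  apply: (@br_slot0 _ _ _ _ (val b).2).
  by rewrite (@cbox_at_Some _ _ b) ?cb.
have /(_ _ (ltnW jk) ub) {}IH := IH; rewrite (negbTE cb) /= in cbj.
apply: (@br_slot0 _ _ _ _ ord0); case: (cbox_atP ord0 jk) => [b' cb' ib'|_ _] /=; last exact: IH.
by have [_ _] := cboxP b'; rewrite cb' ib' orbF => /eqP j0; rewrite j0 in cbj.
Qed.

Lemma free_lift_comb (L : lmodType K) (br' : ('I_n.+1 -> L) -> L) (x : A -> L) u j :
  is_lanke br' ->
  free_lift br' x (comb br u j) = comb br' (fun b : cbox => free_lift br' x (u b)) j.
Proof.
move=> br'_lanke; elim: j => [|j IH].
  by have := free_lift_linear x br'_lanke (-1) 0 0; rewrite !scaleN1r !addNr.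
rewrite /= free_lift_br //; congr br'; apply: funext => i.
by case: (cbox_at _ _ _) => //=.
Qed.

(** The LAnKe endomorphism that sets one letter to 0. It detects whether a letter occurs, in place
    of a grading of the free LAnKe by multidegree. *)
Definition kill_letter (a : A) : FL -> FL :=
  free_lift br (fun b => if b == a then 0 else gen b).

Lemma kill_letter_linear a : linear (kill_letter a).
Proof. exact: free_lift_linear. Qed.

Lemma kill_letter_gen a b : kill_letter a (gen b) = if b == a then 0 else gen b.
Proof. exact: free_lift_gen. Qed.

Lemma kill_letter_combT a (T : cbox -> A) :
  kill_letter a (comb br (fun b => gen (T b)) k) =
  if [exists b, T b == a] then 0 else comb br (fun b => gen (T b)) k.
Proof.
rewrite /kill_letter free_lift_comb // -/(kill_letter a); case: existsP => [[b /eqP Tb]|nT].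
  have [bk _ _] := cboxP b; apply: (comb_eq0 bk) => //.
  by rewrite kill_letter_gen Tb eqxx.
apply: comb_local => b _; rewrite kill_letter_gen; case: eqP => // Tb.
by case: nT; exists b; rewrite Tb.
Qed.

Lemma kill_letter_word a w : occ a w != 0%N -> kill_letter a (word_elt K w) = 0.
Proof.
elim: w => [b|ws IH] /=; first by rewrite kill_letter_gen (eq_sym b); case: (a == b).
rewrite sum_nat_eq0 negb_forall => /existsP[i /= wi].
rewrite /kill_letter free_lift_br //; apply: (@br_slot0 _ _ _ _ i); exact: IH.
Qed.

End CombVanish.

Lemma card_cbox k n : (0 < k)%N -> #|{: cbox k n}| = (k * n + 1)%N.
Proof.
move=> k0; transitivity (\sum_(i < k) \sum_(j < n.+1) ((i == 0 :> nat) || (j != ord0)))%N.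
  rewrite card_sig -sum1_card big_mkcond /= pair_bigA /=.
  by apply: eq_bigr => -[i j] _; rewrite unfold_in /=; case: ifP.
rewrite (eq_bigr (fun i : 'I_k => (n + (i == 0 :> nat)))%N) => [|i _]; last first.
  rewrite big_ord_recl /= orbF addnC; congr (_ + _)%N.
  rewrite (eq_bigr (fun=> 1%N)) ?sum_nat_const ?card_ord ?muln1 // => j _.
  by rewrite orbT.
rewrite big_split /= sum_nat_const card_ord; congr (_ + _)%N.
case: k k0 => // k _; rewrite big_ord_recl big1 // => i _.
Qed.

Section LieCombs.
Variables (K : fieldType) (k n : nat) (k0 : (0 < k)%N) (n0 : (0 < n)%N).
Local Notation m := (mdeg n.+1 k).
Local Notation br := (@lbr K n.+1 'I_m).
Local Notation cbox := (cbox k n).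

Definition lie_comb (T : {ffun cbox -> 'I_m}) : free_lanke K n.+1 'I_m :=
  comb br (fun b => lgen K n.+1 (T b)) k.

Lemma occ_total (A : finType) (w : bword n.+1 A) :
  (\sum_a occ a w = nbr w * n + 1)%N.
Proof.
elim: w => [b|ws IH] /=.
  by rewrite (bigD1 b) //= eqxx big1 // => a /negbTE ->.
rewrite exchange_big /= (eq_bigr (fun i => nbr (ws i) * n + 1)%N) => [|i _]; last exact: IH.
by rewrite big_split /= sum_nat_const card_ord -big_distrl /=; lia.
Qed.

Lemma surjective_filling (T : {ffun cbox -> 'I_m}) :
  (forall a, a \in codom T) -> injective T.
Proof.
move=> Tsurj; apply/injectiveP; rewrite /injectiveb /dinjectiveb.
have enumE : {subset enum 'I_m <= codom T} by move=> a _.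
apply: (leq_size_uniq (enum_uniq 'I_m) enumE).
by rewrite size_enum_ord size_codom card_cbox // /mdeg subn1 mulnC.
Qed.

(** Counting letters shows that the word has [k] brackets. For each letter [a] in turn, the map
    sending [v] to [v - kill_letter a v] fixes the word and erases the left-normed brackets in which
    [a] is missing; those left have all [m] letters in [m] boxes. *)
Lemma multilinear_comb_span w : multilinear_word w ->
  lspan (fun v => exists2 T : {ffun cbox -> 'I_m}, injective T & v = lie_comb T)
    (word_elt K w).
Proof.
move=> w_ml; have nw : nbr w = k.
  have E : (m = nbr w * n + 1)%N.
    rewrite -occ_total (eq_bigr (fun=> 1%N)) => [|a _]; last exact: w_ml.
    by rewrite sum_nat_const card_ord muln1.
  have mE : (m = n * k + 1)%N by rewrite /mdeg subn1.
  have /eqP := etrans (esym E) mE.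
  by rewrite eqn_add2r mulnC eqn_pmul2l // => /eqP.
suff H (l : seq 'I_m) : lspan (fun v => exists2 T : {ffun cbox -> 'I_m},
    (forall a, a \in l -> a \in codom T) & v = lie_comb T) (word_elt K w).
  apply: lspan_trans (H (enum 'I_m)) => _ [T Tsurj ->]; apply: lspan_gen.
  by exists T => //; apply: surjective_filling => a; apply: Tsurj; rewrite mem_enum.
elim: l => [|a l IH].
  apply: lspan_trans (comb_span_word K w) => _ [a [es [ses ->]]].
  rewrite nw in ses; have [T ->] := comb_of_lcomb K a k0 ses.
  by apply: lspan_gen; exists T.
pose g (v : free_lanke K n.+1 'I_m) := v - kill_letter a v.
have g_lin : linear g.
  by move=> c u v; rewrite /g kill_letter_linear scalerBr addrACA opprD.
have -> : word_elt K w = g (word_elt K w).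
  by rewrite /g kill_letter_word ?subr0 // w_ml.
apply: (lspan_map g_lin _ IH) => _ [T Tl ->].
rewrite /g /lie_comb kill_letter_combT; case: existsP => [[b /eqP Tb]|_]; last first.
  by rewrite subrr; apply: lspan_zero.
rewrite subr0; apply: lspan_gen; exists T => // c; rewrite inE => /predU1P[->|/Tl//].
by rewrite -Tb codom_f.
Qed.

Fixpoint comb_word (T : cbox -> 'I_m) (d : 'I_m) (j : nat) : bword n.+1 'I_m :=
  if j is j'.+1 then
    Bracket (fun i => oapp (fun b => @Letter n.+1 'I_m (T b)) (comb_word T d j') (cbox_at k j' i))
  else Letter n.+1 d.

Lemma comb_wordE T d j : (0 < j <= k)%N ->
  word_elt K (comb_word T d j) = comb br (fun b => lgen K n.+1 (T b)) j.
Proof.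
elim: j => // j IH jk; rewrite /=; congr br; apply: funext => i.
case: (cbox_atP i jk) => //= j1 _; apply: IH.
by move: jk j1; case: (j) => // j' /ltnW.
Qed.

Lemma sum_cbox_col (f : cbox -> nat) x j : (j < k)%N ->
  (\sum_i oapp f x (cbox_at k j i) = (j != 0%N) * x + \sum_(b | ccol b == j) f b)%N.
Proof.
move=> jk; rewrite (partition_big (fun b : cbox => (val b).2) xpredT) //=.
have H i : (\sum_(b : cbox | (ccol b == j) && ((val b).2 == i)) f b =
            oapp f 0 (cbox_at k j i))%N.
  case: (cbox_atP i jk) => [b cb ib|j1 ->] /=.
    rewrite (big_pred1 b) // => b'; apply/andP/eqP => [[/eqP c' /eqP i']|->].
      by apply: cbox_ext; rewrite ?c' ?cb // ib -i'.
    by rewrite cb eqxx; split => //; apply/eqP/val_inj.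
  rewrite big_pred0 // => b; apply/negP => /andP[/eqP cb /eqP ib].
  by have [_ _] := cboxP b; rewrite cb (negbTE j1) /cidx ib.
under [in RHS]eq_bigr => i _ do rewrite H.
rewrite big_ord_recl [in RHS]big_ord_recl addnA; congr (_ + _)%N; last first.
  by apply: eq_bigr => i _; case: (cbox_atP _ jk).
case: (cbox_atP ord0 jk) => [b cb ib|-> _] /=; last by rewrite mul1n addn0.
by have [_ _] := cboxP b; rewrite cb ib orbF => ->.
Qed.

Lemma occ_comb_word T d j a : (0 < j <= k)%N ->
  occ a (comb_word T d j) = (\sum_(b : cbox | ccol b < j) (T b == a))%N.
Proof.
elim: j => // j IH jk; rewrite [LHS]/=.
transitivity (\sum_i oapp (fun b : cbox => nat_of_bool (T b == a))
    (occ a (comb_word T d j)) (cbox_at k j i))%N.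
  by apply: eq_bigr => i _; case: (cbox_at k j i) => //= b; rewrite eq_sym.
rewrite sum_cbox_col // [RHS](bigID (fun b => ccol b == j)) /= addnC; congr (_ + _)%N.
  by apply: eq_bigl => b; case: eqP => [->|]; rewrite ?leqnn ?andbF.
have [j0|j0] := eqVneq j 0%N.
  by rewrite j0 mul0n big1 // => b /andP[]; rewrite ltnS leqn0 => /eqP ->.
rewrite mul1n IH; last by move: jk j0; case: (j) => // j' /ltnW.
by apply: eq_bigl => b; rewrite ltnS ltn_neqAle andbC.
Qed.

Lemma lie_comb_multilinear (T : {ffun cbox -> 'I_m}) : injective T ->
  @multilinear_elt K n.+1 m (lie_comb T).
Proof.
move=> T_inj; have m0 : (0 < m)%N by rewrite /mdeg addn1.
exists (comb_word T (Ordinal m0) k); last by rewrite comb_wordE // k0 leqnn.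
move=> a; rewrite occ_comb_word ?k0 ?leqnn //.
have /codomP[b ->] : a \in codom T.
  by apply: inj_card_onto => //; rewrite card_ord card_cbox // /mdeg subn1 mulnC.
rewrite (bigD1 b) /=; last by have [] := cboxP b.
rewrite eqxx big1 // => b' /andP[_ neq].
by rewrite (inj_eq T_inj) (negbTE neq).
Qed.

End LieCombs.

(** * From the skew Specht module to Lie_n(m) *)

(** Uniqueness of the value at 0 is enough, by taking differences. Thus a map can be given by a
    graph spanned by chosen pairs, with no basis of [V]. *)
Lemma sm_surjects_of_relation (K : fieldType) (m : nat) (V W : symModule K m)
    (R : V -> W -> Prop) :
    (forall a v v' w w', R v w -> R v' w' -> R (a *: v + v') (a *: w + w')) ->
    (forall v, exists w, R v w) -> (forall w, exists v, R v w) ->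
    (forall w, R 0 w -> w = 0) ->
    (forall s v w, R v w -> R (act s v) (act s w)) ->
  sm_surjects V W.
Proof.
move=> R_lin R_tot R_onto R_fun R_act; have /choice[f fR] := R_tot.
have R_uniq v w w' : R v w -> R v w' -> w = w'.
  move=> Rw Rw'; apply/eqP; rewrite -subr_eq0; apply/eqP/R_fun.
  by have := R_lin (-1) _ _ _ _ Rw' Rw; rewrite !scaleN1r addNr addrC.
have f_lin : linear f.
  by move=> a u v; apply: R_uniq (fR _) _; apply: R_lin.
pose fL := HB.pack_for {linear V -> W} f (GRing.isLinear.Build K V W _ f f_lin).
exists fL => [s v|w] /=; first by apply: R_uniq (fR _) _; apply: R_act.
by have [v vw] := R_onto w; exists v; apply: R_uniq vw.
Qed.

Lemma lspan_span_of (K : fieldType) (m : nat) (V : symModule K m) (G : V -> Prop) v :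
  lspan G v <-> span_of G v.
Proof.
split=> [|[r [a [g [Gg ->]]]]]; last first.
  by apply: lspan_sum => i _; apply/lspanZ/lspan_gen.
elim=> {v} [|v Gv|a u v _ Gu _ Gv].
- by exists 0%N, (fun=> 0), (fun=> 0); split=> [[]//|]; rewrite big_ord0.
- by exists 1%N, (fun=> 1), (fun=> v); split=> //; rewrite big_ord1 scale1r.
- have [r [b [g [Gg ->]]]] := Gu; have [r' [b' [g' [Gg' ->]]]] := Gv.
  exists (r + r')%N, (fun i => match split i with inl j => a * b j | inr j => b' j end),
    (fun i => match split i with inl j => g j | inr j => g' j end).
  split; first by move=> i; case: split.
  rewrite big_split_ord /= scaler_sumr; congr (_ + _); apply: eq_bigr => i _.
    by rewrite (unsplitK (inl i)) scalerA.
  by rewrite (unsplitK (inr i)).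
Qed.

Section SkewModule.
Variables (K : fieldType) (X : finType) (row col : X -> nat) (m : nat).
Local Notation W := (filling_space K X m).

Definition letter_act (s : 'S_m) : W -> W := relabel_space s.
Fact letter_act_linear s : linear (letter_act s).
Proof. exact: relabel_space_linear. Qed.
Fact letter_act1 v : letter_act 1%g v = v.
Proof.
rewrite -[RHS]relabel_space_id /letter_act; congr (relabel_space _ v).
by apply: funext => i; rewrite perm1.
Qed.
Fact letter_actM s t v : letter_act (s * t)%g v = letter_act t (letter_act s v).
Proof.
rewrite /letter_act relabel_space_comp; congr (relabel_space _ v).
by apply: funext => i; rewrite permM.
Qed.
Definition filling_module : symModule K m :=
  SymModule letter_act_linear letter_act1 letter_actM.

Definition is_symmetrized (v : filling_module) : Prop :=
  exists2 T : {ffun X -> 'I_m}, injective T & v = symmetrize K row col T.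

Lemma relabel_inj (s : 'S_m) (T : {ffun X -> 'I_m}) : injective T -> injective (relabel s T).
Proof. by move=> T_inj x y; rewrite !ffunE => /perm_inj/T_inj. Qed.

Fact is_symmetrized_act s v : is_symmetrized v -> is_symmetrized (act s v).
Proof.
case=> T T_inj ->; exists (relabel s T); first exact: relabel_inj.
exact: relabel_symmetrize.
Qed.

Definition skew_module : symModule K m := span_module is_symmetrized_act.

End SkewModule.

Section SkewToLie.
Variables (K : fieldType) (natK : forall a, a.+1%:R != 0 :> K).
Variables (k n : nat) (k2 : (2 <= k)%N) (n0 : (0 < n)%N).
Local Notation m := (mdeg n.+1 k).
Local Notation cbox := (cbox k n).
Local Notation row := (@crow k n).
Local Notation col := (@ccol k n).
Local Notation FL := (free_lanke_module K n.+1 m).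
Local Notation W := (filling_module K cbox m).

Let k0 : (0 < k)%N. Proof. exact: ltnW. Qed.
Let br_lanke := @free_lankeP K n.+1 'I_m.

(** The pair is straightened as a whole, so that a polytabloid and its bracket receive the same
    coefficients. *)
Definition skew_lie_pair (T : {ffun cbox -> 'I_m}) : (W * FL)%type :=
  (symmetrize K row col T, lie_comb K T).

Lemma lie_comb_fperm T (s : {perm cbox}) : lie_comb K (fperm T s) =
  comb (@lbr K n.+1 'I_m) (fun b => lgen K n.+1 (T (s b))) k.
Proof. by rewrite /lie_comb; congr (comb _ _ k); apply: funext => b; rewrite ffunE. Qed.

Lemma sum_pair (I : Type) (r : seq I) (P : pred I) (f : I -> W * FL) :
  \sum_(i <- r | P i) f i = (\sum_(i <- r | P i) (f i).1, \sum_(i <- r | P i) (f i).2).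
Proof. by elim/big_rec3: _ => // i x y z _ ->; case: (f i). Qed.

Lemma skew_lie_pair_straight T : lspan
  (fun v => exists2 s, semistd row col (fperm T s) & v = skew_lie_pair (fperm T s))
  (skew_lie_pair T).
Proof.
apply: straightening => //.
- exact: cbox_inj.
- move=> {}T b b' neq cbb'; apply: (congr2 pair).
    exact: symmetrize_alt.
  by rewrite lie_comb_fperm (comb_alternating br_lanke (fun b => lgen K n.+1 (T b)) neq cbb').
- move=> {}T b0 b1 r01 c01; rewrite sum_pair; apply: (congr2 pair).
    apply: symmetrize_garnir => //; exact: cgarnir_rows.
  under eq_bigr => s _ do rewrite /= lie_comb_fperm.
  exact: (comb_garnir natK k2 br_lanke (fun b => lgen K n.+1 (T b))).
Qed.

Definition skew_lie_graph : (W * FL)%type -> Prop :=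
  lspan (fun v => exists2 T : {ffun cbox -> 'I_m}, injective T & v = skew_lie_pair T).

(** Expand into semistandard pairs. Their first coordinates are independent, so all coefficients
    vanish, and with them the second coordinate. *)
Lemma skew_lie_graph_fun y : skew_lie_graph (0, y) -> y = 0.
Proof.
move=> gr; have : lspan (fun v => exists2 S, semistd row col S & v = skew_lie_pair S) (0, y).
  apply: lspan_trans gr => _ [T _ ->]; apply: lspan_trans (skew_lie_pair_straight T).
  by move=> _ [s ss ->]; apply: lspan_gen; exists (fperm T s).
case/lspan_fin=> x; rewrite sum_pair => -[e ->].
have x0 := symmetrize_free natK (@cbox_inj k n k2) (@cbox_convex k n k2) (esym e).
by rewrite big1 // => S ssS; rewrite x0 // scale0r.
Qed.

Lemma free_act_lie_comb (s : 'S_m) T : free_act s (lie_comb K T) = lie_comb K (relabel s T).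
Proof.
rewrite /free_act /lrename free_lift_comb //; congr (comb _ _ k); apply: funext => b.
by rewrite free_lift_gen // ffunE.
Qed.

Theorem skew_module_surjects_Lie : sm_surjects (skew_module K row col m) (Lie K n.+1 m).
Proof.
pose R (v : skew_module K row col m) (w : Lie K n.+1 m) := skew_lie_graph (val v, val w).
have lie_in (T : {ffun cbox -> 'I_m}) : injective T ->
    @span_of K m FL (@multilinear_elt K n.+1 m) (lie_comb K T).
  by move=> T_inj; apply/lspan_span_of/lspan_gen/lie_comb_multilinear.
have sym_in (T : {ffun cbox -> 'I_m}) : injective T ->
    @span_of K m W (@is_symmetrized K cbox row col m) (symmetrize K row col T).
  by move=> T_inj; apply/lspan_span_of/lspan_gen; exists T.
apply: (@sm_surjects_of_relation _ _ _ _ R).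
- move=> a v v' w w' Rvw Rvw'; exact: (lspan_lin a Rvw Rvw').
- case=> v /= vP; have /asboolP/lspan_span_of H := vP.
  have [w [wP gr]] : exists w,
      @span_of K m FL (@multilinear_elt K n.+1 m) w /\ skew_lie_graph (v, w).
    elim: H => {v vP} [|v [T T_inj ->]|a u v _ [w [wP gw]] _ [w' [wP' gw']]].
    - exists 0; split; [apply/lspan_span_of|]; exact: lspan_zero.
    - exists (lie_comb K T); split; first exact: lie_in.
      by apply: lspan_gen; exists T.
    - exists (a *: w + w'); split; last exact: (lspan_lin a gw gw').
      by apply/lspan_span_of/lspan_lin; apply/lspan_span_of.
  by have wP' := asboolT wP; exists (SubCarrier wP').
- case=> w /= wP; have /asboolP/lspan_span_of H := wP.
  have [v [vP gr]] : exists v,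
      @span_of K m W (@is_symmetrized K cbox row col m) v /\ skew_lie_graph (v, w).
    have : lspan (fun v => exists2 T : {ffun cbox -> 'I_m}, injective T & v = lie_comb K T) w.
      by apply: lspan_trans H => _ [w' w'P ->]; apply: multilinear_comb_span.
    elim=> {w wP H} [|w [T T_inj ->]|a u w _ [v [vP gv]] _ [v' [vP' gv']]].
    - exists 0; split; [apply/lspan_span_of|]; exact: lspan_zero.
    - exists (symmetrize K row col T); split; first exact: sym_in.
      by apply: lspan_gen; exists T.
    - exists (a *: v + v'); split; last exact: (lspan_lin a gv gv').
      by apply/lspan_span_of/lspan_lin; apply/lspan_span_of.
  by have vP' := asboolT vP; exists (SubCarrier vP').
- by move=> w gr; apply: val_inj; apply: skew_lie_graph_fun.
- move=> s v w; rewrite /R /=.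
  pose g (p : W * FL) : W * FL := (letter_act s p.1, free_act s p.2).
  have g_lin : linear g.
    by move=> a p q; rewrite /g /= letter_act_linear free_act_linear.
  move=> gr; apply: (lspan_map g_lin _ gr) => _ [T T_inj ->].
  rewrite /g /= free_act_lie_comb /letter_act relabel_symmetrize.
  by apply: lspan_gen; exists (relabel s T) => //; apply: relabel_inj.
Qed.

End SkewToLie.

(** * Representations with equal traces *)

(** In C R C R = C R the column base C cancels on the left and the row base R on the right. *)
Lemma idem_base (K : fieldType) n (E : 'M[K]_n) :
  E *m E = E -> row_base E *m col_base E = 1%:M.
Proof.
move=> EE; apply: (row_full_inj (col_base_full E)); apply: (row_free_inj (row_base_free E)) => /=.
by rewrite mulmx1 mulmx_base mulmxA mulmx_base -mulmxA mulmx_base.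
Qed.

Lemma mxtrace_idem (K : fieldType) n (E : 'M[K]_n) : E *m E = E -> \tr E = (\rank E)%:R.
Proof. by move=> EE; rewrite -{1}(mulmx_base E) mxtrace_mulC idem_base // mxtrace1. Qed.

Lemma mul_delta_entry (K : fieldType) m n p q (A : 'M[K]_(m, n)) (B : 'M[K]_(p, q)) i j a b :
  (A *m delta_mx i j *m B) a b = A a i * B j b.
Proof.
rewrite -(mul_delta_mx (0 : 'I_1)) mulmxA -[_ *m _ *m B]mulmxA -colE -rowE.
by rewrite mxE big_ord1 !mxE.
Qed.

Lemma mxtrace_lin_mx (K : fieldType) n (f : {linear 'M[K]_n -> 'M[K]_n}) :
  \tr (lin_mx f) = \sum_i \sum_j f (delta_mx i j) i j.
Proof.
rewrite /mxtrace (reindex _ (curry_mxvec_bij _ _)) /= pair_bigA /=.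
by apply: eq_bigr => -[i j] _; rewrite !mxE /= -mxvec_delta mxvecK mxvecE.
Qed.

Section EqualTraces.
Variables (K : fieldType) (natK : forall a, a.+1%:R != 0 :> K).
Variables (gT : finGroupType).

Definition mx_hom n (r : gT -> 'M[K]_n) :=
  r 1%g = 1%:M /\ forall g h, r (g * h)%g = r g *m r h.

Lemma mx_homV n (r : gT -> 'M[K]_n) g : mx_hom r -> r g *m r g^-1%g = 1%:M.
Proof. by case=> r1 rM; rewrite -rM mulgV r1. Qed.

Lemma mx_homVl n (r : gT -> 'M[K]_n) g : mx_hom r -> r g^-1%g *m r g = 1%:M.
Proof. by case=> r1 rM; rewrite -rM mulVg r1. Qed.

Let cardK : #|gT|%:R != 0 :> K.
Proof.
have gT0 : (0 < #|gT|)%N by apply/card_gt0P; exists 1%g.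
by case: #|gT| gT0 => // c _; apply: natK.
Qed.

Lemma sum_translate n1 n2 (r1 : gT -> 'M[K]_n1) (r2 : gT -> 'M[K]_n2) X h :
  mx_hom r1 -> mx_hom r2 ->
  r1 h *m (\sum_g r1 g^-1%g *m X *m r2 g) = (\sum_g r1 g^-1%g *m X *m r2 g) *m r2 h.
Proof.
move=> [_ r1M] [_ r2M]; rewrite mulmx_sumr mulmx_suml.
rewrite (reindex_inj (mulIg h)) /=; apply: eq_bigr => g _.
by rewrite !mulmxA -r1M invMg mulgA mulgV mul1g r2M !mulmxA.
Qed.

(** The average [P] of the maps sending [X] to [r g^-1 f X f r g] is a projection on the space of
    matrices, and its trace is the mean of the given products of traces. Trace 0 means rank 0 in
    characteristic zero, while [P] fixes [f]. *)
Lemma traces_orthogonal_eq0 n (r : gT -> 'M[K]_n) (f : 'M[K]_n) :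
    mx_hom r -> f *m f = f -> (forall g, r g *m f = f *m r g) ->
    \sum_g \tr (r g^-1%g *m f) * \tr (r g *m f) = 0 -> f = 0.
Proof.
move=> rH ff rf tr0; have [r1 rM] := rH.
pose P X := #|gT|%:R^-1 *: \sum_g r g^-1%g *m (f *m X *m f) *m r g.
have P_lin : linear P.
  move=> a X Y; rewrite /P scalerA mulrC -scalerA -scalerDr; congr (_ *: _).
  rewrite scaler_sumr -big_split /=; apply: eq_bigr => g _.
  by rewrite mulmxDr mulmxDl mulmxDr mulmxDl -!(scalemxAr, scalemxAl).
have P_f X : P X = f *m P X *m f.
  rewrite /P -scalemxAr -scalemxAl mulmx_sumr mulmx_suml; congr (_ *: _).
  apply: eq_bigr => g _; rewrite !mulmxA -(rf g^-1%g) -[r _ *m f *m f]mulmxA ff.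
  by rewrite -[_ *m r g *m f]mulmxA (rf g) mulmxA -[_ *m f *m f]mulmxA ff.
have P_r X g : r g *m P X = P X *m r g.
  by rewrite /P -scalemxAr -scalemxAl sum_translate.
have PP X : P (P X) = P X.
  rewrite {1}/P (eq_bigr (fun=> P X)) => [|g _]; last first.
    by rewrite -P_f -mulmxA -P_r mulmxA mx_homVl // mul1mx.
  by rewrite sumr_const -scaler_nat scalerA mulVf // scale1r.
pose PL := HB.pack_for {linear 'M[K]_n -> 'M[K]_n} P (GRing.isLinear.Build K _ _ _ P P_lin).
have PL2 : lin_mx PL *m lin_mx PL = lin_mx PL.
  by apply/row_matrixP => i; rewrite !rowE mulmxA !mul_rV_lin /= mxvecK PP.
have : \tr (lin_mx PL) = 0.
  transitivity (#|gT|%:R^-1 * \sum_g \tr (r g^-1%g *m f) * \tr (r g *m f)).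
    rewrite mxtrace_lin_mx mulr_sumr.
  under eq_bigr => i _ do under eq_bigr => j _ do rewrite /= /P !mxE summxE mulr_sumr.
  under eq_bigr => i _ do rewrite exchange_big /=.
  rewrite exchange_big /=; apply: eq_bigr => g _.
  rewrite [\tr (r g *m f)]/mxtrace [\tr (r g^-1%g *m f)]/mxtrace big_distrl mulr_sumr.
  apply: eq_bigr => i _; rewrite big_distrr mulr_sumr; apply: eq_bigr => j _.
  congr (_ * _); rewrite (_ : _ *m _ *m _ = r g^-1%g *m f *m delta_mx i j *m (r g *m f)).
    by rewrite mul_delta_entry.
  by rewrite (rf g) !mulmxA.
  by rewrite tr0 mulr0.
rewrite mxtrace_idem // => /eqP; case er : (\rank _) => [|c]; last by rewrite (negbTE (natK c)).
move/eqP: er; rewrite mxrank_eq0 => /eqP PL0 _.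
have : PL f = 0 by rewrite -[PL f]mxvecK -mul_vec_lin PL0 mulmx0 linear0.
rewrite /= /P (eq_bigr (fun=> f)) => [|g _]; last first.
  by rewrite !ff -mulmxA -rf mulmxA mx_homVl // mul1mx.
by rewrite sumr_const -scaler_nat scalerA mulVf // scale1r.
Qed.

(** An equivariant [T] of greatest rank has, by averaging, an equivariant quasi-inverse [Tp]; on row
    vectors [e] projects onto the kernel of [T] and [f] onto a complement of its image. A nonzero
    equivariant map from the one to the other would raise the rank, so there is none, yet both have
    the same traces. Then [traces_orthogonal_eq0] gives [f = 0]. *)
Theorem equal_traces_surjection n1 n2 (r1 : gT -> 'M[K]_n1) (r2 : gT -> 'M[K]_n2) :
    mx_hom r1 -> mx_hom r2 -> (forall g, \tr (r1 g) = \tr (r2 g)) ->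
  exists2 T : 'M_(n1, n2), (forall g, r1 g *m T = T *m r2 g) & row_full T.
Proof.
move=> r1H r2H tr12; pose equi (T : 'M_(n1, n2)) := forall g, r1 g *m T = T *m r2 g.
pose Q d := `[< exists2 T, equi T & \rank T = d >].
have Q0 : exists d, Q d.
  by exists 0%N; apply/asboolP; exists 0; [move=> g; rewrite mulmx0 mul0mx|rewrite mxrank0].
have Qb d : Q d -> (d <= n1)%N by case/asboolP => T _ <-; apply: rank_leq_row.
have [d /asboolP[T Teq rT] Tmax] := ex_maxnP Q0 Qb.
exists T => //; have [P TPT] : exists P, T *m P *m T = T by exists (pinvmx T); apply: mulmxKpV.
pose Tp := #|gT|%:R^-1 *: \sum_g r2 g^-1%g *m P *m r1 g.
have TpE g : r2 g *m Tp = Tp *m r1 g.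
  by rewrite /Tp -scalemxAr -scalemxAl sum_translate.
have TTpT : T *m Tp *m T = T.
  rewrite /Tp -scalemxAr -scalemxAl mulmx_sumr mulmx_suml.
  rewrite (eq_bigr (fun=> T)) => [|g _]; last first.
    rewrite !mulmxA -Teq -[_ *m r1 g *m T]mulmxA (Teq g) mulmxA.
    rewrite -[_ *m T *m P]mulmxA -[_ *m (T *m P) *m T]mulmxA TPT.
    by rewrite -mulmxA -Teq mulmxA mx_homVl // mul1mx.
  by rewrite sumr_const -scaler_nat scalerA mulVf // scale1r.
pose e := 1%:M - T *m Tp; pose f := 1%:M - Tp *m T.
have eT : e *m T = 0 by rewrite mulmxBl mul1mx TTpT subrr.
have Tf : T *m f = 0 by rewrite mulmxBr mulmx1 mulmxA TTpT subrr.
have ee : e *m e = e by rewrite {2}/e mulmxBr mulmx1 mulmxA eT mul0mx subr0.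
have ff : f *m f = f by rewrite {1}/f mulmxBl mul1mx -mulmxA Tf mulmx0 subr0.
have re g : r1 g *m e = e *m r1 g.
  by rewrite mulmxBl mulmxBr mulmx1 mul1mx mulmxA Teq -!mulmxA TpE.
have rf g : r2 g *m f = f *m r2 g.
  by rewrite mulmxBl mulmxBr mulmx1 mul1mx mulmxA TpE -!mulmxA Teq.
have tr_ef g : \tr (r1 g *m e) = \tr (r2 g *m f).
  rewrite !mulmxBr !mulmx1 !raddfB /= tr12; congr (_ - _).
  by rewrite mulmxA Teq -mulmxA mxtrace_mulC -mulmxA.
pose S X := \sum_g r1 g^-1%g *m (e *m X *m f) *m r2 g.
have S0 X : S X = 0.
  have eS : e *m S X = S X.
    rewrite /S mulmx_sumr; apply: eq_bigr => g _.
    by rewrite !mulmxA -re -[r1 _ *m e *m e]mulmxA ee.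
  have Sf : S X *m f = S X.
    rewrite /S mulmx_suml; apply: eq_bigr => g _.
    by rewrite -!mulmxA rf (mulmxA f f) ff.
  (* [T] is [(1 - e) U], so its row space lies in that of [U]; the ranks agree by maximality, so
     [S X = e U] lies in the row space of [T], which [f] kills. *)
  pose U := T + S X.
  have Ueq : equi U.
    by move=> g; rewrite mulmxDr mulmxDl Teq; congr (_ + _); apply: sum_translate.
  have TU : T = (1%:M - e) *m U by rewrite mulmxBl mul1mx !mulmxDr eT eS add0r addrK.
  have SU : S X = e *m U by rewrite mulmxDr eT add0r eS.
  have TsubU : (T <= U)%MS by rewrite {1}TU submxMl.
  have SsubT : (S X <= T)%MS.
    rewrite SU (submx_trans (submxMl _ _)) //.
    have : (U == T)%MS.
      rewrite andbC -(mxrank_leqif_eq TsubU) eqn_leq mxrankS //= rT.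
      by apply: Tmax; apply/asboolP; exists U.
    by case/andP.
  by have /submxP[Y SY] := SsubT; rewrite -Sf SY -mulmxA Tf mulmx0.
have f0 : f = 0.
  apply: (traces_orthogonal_eq0 r2H ff rf).
  transitivity (\sum_i \sum_j S (delta_mx i j) i j); last first.
    by rewrite big1 // => i _; rewrite big1 // => j _; rewrite S0 mxE.
  rewrite /S; under [RHS]eq_bigr => i _ do under eq_bigr => j _ do rewrite summxE.
  under [RHS]eq_bigr => i _ do rewrite exchange_big /=.
  rewrite [RHS]exchange_big /=; apply: eq_bigr => g _.
  rewrite -tr_ef [\tr (r2 g *m f)]/mxtrace [\tr (r1 g^-1%g *m e)]/mxtrace big_distrl.
  apply: eq_bigr => i _; rewrite big_distrr; apply: eq_bigr => j _ /=.
  rewrite (_ : _ *m _ *m _ = r1 g^-1%g *m e *m delta_mx i j *m (r2 g *m f)).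
    by rewrite mul_delta_entry.
  by rewrite (rf g) !mulmxA.
by apply/row_fullP; exists Tp; apply/eqP; rewrite -subr_eq0 -opprB oppr_eq0; apply/eqP.
Qed.

End EqualTraces.

(** * Class functions and Young subgroups *)

Section YoungSums.
Variable m : nat.
Implicit Types g h t : 'S_m.

Lemma expg_porbit_mod g x a b :
  ((g ^+ a)%g x == (g ^+ b)%g x) = (a == b %[mod #|porbit g x|]).
Proof.
set L := #|porbit g x|; have L0 : (0 < L)%N by rewrite lt0n card_porbit_neq0.
have red c : (g ^+ c)%g x = nth x (traject g x L) (c %% L).
  have iterL i : iter (i * L) g x = x.
    by elim: i => // i IH; rewrite mulSn iterD IH iter_porbit.
  rewrite nth_traject ?ltn_mod // permX {1}(divn_eq c L) addnC iterD.
  by rewrite iterL.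
rewrite !red nth_uniq ?uniq_traject_porbit ?size_traject ?ltn_mod //.
Qed.

(** Fix a representative of each cycle and send its [a]-th iterate under [g] to its [a]-th iterate
    under [h]; equal orbits have equal lengths, so this is well defined. *)
Lemma same_porbits_conj g h :
  (forall x, porbit h x = porbit g x) -> exists t, h = (g ^ t)%g.
Proof.
move=> hg; pose r x := odflt x [pick y in porbit g x].
have r_in x : r x \in porbit g x.
  by rewrite /r; case: pickP => //= _; apply: porbit_id.
have r_eq x y : porbit g x = porbit g y -> r x = r y.
  by rewrite /r => ->; case: pickP => // /(_ y); rewrite porbit_id.
have porbit_r x : porbit g (r x) = porbit g x by apply/eqP; rewrite eq_porbit_mem.
have /choice[a aP] x : exists i, x = (g ^+ i)%g (r x).
  by apply/porbitP; rewrite porbit_r porbit_id.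
pose f x := (h ^+ a x)%g (r x).
have eq_mod x i j : ((g ^+ i)%g (r x) == (g ^+ j)%g (r x)) = ((h ^+ i)%g (r x) == (h ^+ j)%g (r x)).
  by rewrite !expg_porbit_mod hg.
have f_inj : injective f.
  move=> x y e; have rxy : r x = r y.
    apply: r_eq; rewrite -(porbit_r x) -(porbit_r y) -!hg.
    by rewrite -(porbit_perm h (a x) (r x)) -(porbit_perm h (a y) (r y)) -/(f x) -/(f y) e.
  by rewrite (aP x) (aP y) -rxy; apply/eqP; rewrite eq_mod; apply/eqP; move: e; rewrite /f -rxy.
pose t := perm f_inj; exists t; apply: (mulgI t); rewrite conjgE mulKVg.
apply/permP => x; rewrite !permM !permE.
have rg : r (g x) = r x by apply: r_eq; have := porbit_perm g 1 x; rewrite expg1.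
rewrite /f rg; apply/esym/eqP.
have -> : h ((h ^+ a x)%g (r x)) = (h ^+ (a x).+1)%g (r x) by rewrite expgSr permM.
by rewrite -eq_mod -{1}rg -aP expgSr permM -aP.
Qed.

(** Induction, starting from the permutations with most cycles. Colour the letters by the cycles of
    [g]. A permutation that preserves the colours has either the same orbits as [g], and is then
    conjugate to it, or strictly more orbits. The sum for this colouring is thus a positive multiple
    of [D g]. *)
Lemma young_sums_eq0 (K : fieldType) (natK : forall a, a.+1%:R != 0 :> K) (D : 'S_m -> K) :
    (forall g t, D (g ^ t)%g = D g) ->
    (forall c : 'I_m -> 'I_m, \sum_(s : 'S_m | [forall i, c (s i) == c i]) D s = 0) ->
  forall g, D g = 0.
Proof.
move=> Dclass Dsum g; have [p] := ubnP (m - #|porbits g|).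
elim: p => // p IH in g *; rewrite ltnS => lep.
pose c x := odflt x [pick y in porbit g x].
have c_in x : c x \in porbit g x.
  by rewrite /c; case: pickP => //= _; apply: porbit_id.
have c_eq x y : (c x == c y) = (porbit g x == porbit g y).
  apply/eqP/eqP => [e|e].
    have /eqP <- : porbit g (c x) == porbit g x by rewrite eq_porbit_mem.
    by apply/eqP; rewrite e eq_porbit_mem.
  by rewrite /c e; case: pickP => // /(_ y); rewrite porbit_id.
have cg : [forall i, c (g i) == c i].
  by apply/forallP => i; rewrite c_eq eq_porbit_mem -{1}[g]expg1 mem_porbit.
have := Dsum c; rewrite (bigID (fun s => [forall x, porbit s x == porbit g x])) /=.
rewrite [X in _ + X]big1 ?addr0 => [|s /andP[/forallP cs]]; last first.
  move=> /forallPn[x0 nx0]; apply: IH.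
  have sub x : porbit s x \subset porbit g x.
    apply/subsetP => y /porbitP[i ->]; elim: i => [|i IHi]; first by rewrite expg0 perm1 porbit_id.
    rewrite expgSr permM; move: IHi; rewrite -!eq_porbit_mem => /eqP <-.
    by rewrite -c_eq.
  pose phi (A : {set 'I_m}) := if [pick y in A] is Some y then porbit g y else A.
  have phiE x : phi (porbit s x) = porbit g x.
    rewrite /phi; case: pickP => [y ys|/(_ x)]; last by rewrite porbit_id.
    by apply/eqP; rewrite eq_porbit_mem; apply: (subsetP (sub x)).
  have im : phi @: porbits s = porbits g.
    rewrite /porbits -imset_comp; apply: eq_imset => x; exact: phiE.
  have le : (#|porbits g| <= #|porbits s|)%N by rewrite -im leq_imset_card.
  have ne : #|porbits g| != #|porbits s|.
    apply: contra nx0 => /eqP ec.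
    have phi_inj : {in porbits s &, injective phi} by apply/imset_injP; rewrite im ec.
    rewrite eqEsubset sub; apply/subsetP => y yx.
    have : porbit s y = porbit s x0.
      apply: phi_inj; rewrite ?imset_f // !phiE; apply/eqP; by rewrite eq_porbit_mem.
    by move=> <-; apply: porbit_id.
  have : (#|porbits s| <= m)%N by rewrite -[X in (_ <= X)%N]card_ord leq_imset_card.
  by move: le ne lep; lia.
rewrite (eq_bigr (fun=> D g)) => [|s /andP[_ /forallP sg]]; last first.
  by have [t ->] := same_porbits_conj (fun x => eqP (sg x)); apply: Dclass.
rewrite big_const iter_addr_0 => /eqP; rewrite -mulr_natr mulf_eq0 => /orP[/eqP //|].
set N := #|_|; have : (0 < N)%N.
  by apply/card_gt0P; exists g; rewrite unfold_in cg; apply/forallP.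
by case: N => // N _; rewrite (negbTE (natK N)).
Qed.

End YoungSums.

(** * Polynomial functions *)

Section PolynomialFunctions.
Variables (K : fieldType) (natK : forall a, a.+1%:R != 0 :> K).

Lemma natr_injK : injective (fun a => a%:R : K).
Proof.
move=> a b; wlog le_ab : a b / (a <= b)%N => [H e|].
  by case: (leqP a b) => [/H|/ltnW/H/(_ (esym e))]; [apply|].
move/eqP; rewrite eq_sym -subr_eq0 -natrB //.
by case e: (b - a)%N => [|c]; [lia|rewrite (negbTE (natK c))].
Qed.

(** Doubling a variable in which [w] and [w0] have different exponents, and subtracting a multiple
    of the original relation, removes [w0]. The coefficient of [w] is multiplied by a difference of
    distinct powers of 2, nonzero in characteristic zero. *)
Lemma monomials_free n (s : seq 'X_{1..n}) (a : 'X_{1..n} -> K) : uniq s ->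
    (forall t : 'I_n -> K, (forall i, t i != 0) ->
      \sum_(w <- s) a w * \prod_i t i ^+ w i = 0) ->
  forall w, w \in s -> a w = 0.
Proof.
elim: s a => // w0 s IH a /= /andP[w0s us] sum0.
have as0 w : w \in s -> a w = 0.
  move=> ws; have [i wi] : exists i, w i != w0 i.
    apply/existsP; apply: contraNT w0s; rewrite negb_exists => /forallP e.
    by rewrite (_ : w0 = w) //; apply/mnmP => i; apply/esym/eqP/negbNE/e.
  pose u (j : 'I_n) : K := if j == i then 2%:R else 1.
  have uw (v : 'X_{1..n}) : \prod_j u j ^+ v j = (2 ^ v i)%:R.
    rewrite (bigD1 i) //= /u eqxx -natrX big1 ?mulr1 // => j /negbTE ->.
    exact: expr1n.
  have : a w * ((2 ^ w i)%:R - (2 ^ w0 i)%:R) = 0.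
    apply: (IH (fun v => a v * ((2 ^ v i)%:R - (2 ^ w0 i)%:R))) => // t t0.
    have t0' j : u j * t j != 0.
      by rewrite mulf_neq0 // /u; case: (j == i); [apply: (natK 1)|apply: oner_neq0].
    have utE (v : 'X_{1..n}) :
        \prod_j (u j * t j) ^+ v j = (2 ^ v i)%:R * \prod_j t j ^+ v j.
      by rewrite -uw -big_split; apply: eq_bigr => j _; rewrite exprMn.
    have := sum0 _ t0'; rewrite big_cons utE.
    have := sum0 t t0; rewrite big_cons => /eqP; rewrite addr_eq0 => /eqP e0.
    rewrite mulrCA e0 mulrN => e; rewrite -[RHS]e addrC mulr_sumr -sumrB.
    apply: eq_bigr => v _.
    by rewrite utE mulrBr mulrBl -mulrA; congr (_ - _); rewrite mulrAC mulrC mulrA.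
  move/eqP; rewrite mulf_eq0 subr_eq0 => /orP[/eqP //|/eqP /natr_injK /eqP].
  by rewrite eqn_exp2l // (negbTE wi).
have one_prod (v : 'X_{1..n}) : \prod_(i < n) (1 : K) ^+ v i = 1.
  by rewrite big1 // => i _; apply: expr1n.
have := sum0 (fun=> 1) (fun=> oner_neq0 _).
rewrite big_cons one_prod mulr1 big_seq big1 => [|v /as0 ->]; last exact: mul0r.
by rewrite addr0 => a0 v; rewrite inE => /predU1P[->|/as0].
Qed.

Lemma mpoly_eval_eq0 n (p : {mpoly K[n]}) :
  (forall t : 'I_n -> K, (forall i, t i != 0) -> p.@[t] = 0) -> p = 0.
Proof.
move=> p0; apply/mpolyP => w; rewrite mcoeff0.
have [wp|] := boolP (w \in msupp p); last exact: memN_msupp_eq0.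
apply: (@monomials_free _ _ (fun v => p@_v) (msupp_uniq p) _ w wp) => t t0.
by rewrite -mevalE p0.
Qed.

Lemma mpoly_eval_inj n (p q : {mpoly K[n]}) :
  (forall t : 'I_n -> K, (forall i, t i != 0) -> p.@[t] = q.@[t]) -> p = q.
Proof.
move=> pq; apply/eqP; rewrite -subr_eq0; apply/eqP/mpoly_eval_eq0 => t t0.
by rewrite mevalB pq // subrr.
Qed.

Definition mpoly_scale n (t : 'I_n -> K) (p : {mpoly K[n]}) : {mpoly K[n]} :=
  \sum_(w <- msupp p) (p@_w * \prod_i t i ^+ w i) *: 'X_[w].

Lemma mpoly_scale_eval n (t : 'I_n -> K) p s :
  (mpoly_scale t p).@[s] = p.@[fun i => t i * s i].
Proof.
rewrite [RHS]mevalE /mpoly_scale raddf_sum /=; apply: eq_bigr => w _.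
rewrite mevalZ mevalX -mulrA -big_split; congr (_ * _); apply: eq_bigr => i _.
by rewrite exprMn.
Qed.

Lemma mpoly_scale_coef n (t : 'I_n -> K) p w :
  (mpoly_scale t p)@_w = p@_w * \prod_i t i ^+ w i.
Proof.
rewrite /mpoly_scale raddf_sum /=.
under eq_bigr => v _ do rewrite mcoeffZ mcoeffX.
have [wp|wp] := boolP (w \in msupp p).
  rewrite (bigD1_seq w) ?msupp_uniq //= eqxx mulr1 [X in _ + X]big1 ?addr0 // => v /negbTE ->.
  by rewrite mulr0.
rewrite memN_msupp_eq0 // mul0r big_seq big1 // => v vp.
by case: eqP => [e|]; [rewrite -e vp in wp|rewrite mulr0].
Qed.

Definition polyfun (f : K -> K) := exists p : {poly K}, forall x, f x = p.[x].

Lemma polyfun_const c : polyfun (fun=> c).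
Proof. by exists c%:P => x; rewrite hornerC. Qed.
Lemma polyfun_id : polyfun id.
Proof. by exists 'X => x; rewrite hornerX. Qed.
Lemma polyfunD f g : polyfun f -> polyfun g -> polyfun (fun x => f x + g x).
Proof. by case=> p fp [q gq]; exists (p + q) => x; rewrite hornerD fp gq. Qed.
Lemma polyfunM f g : polyfun f -> polyfun g -> polyfun (fun x => f x * g x).
Proof. by case=> p fp [q gq]; exists (p * q) => x; rewrite hornerM fp gq. Qed.
Lemma polyfunB f g : polyfun f -> polyfun g -> polyfun (fun x => f x - g x).
Proof. by case=> p fp [q gq]; exists (p - q) => x; rewrite hornerD hornerN fp gq. Qed.
Lemma polyfunX f a : polyfun f -> polyfun (fun x => f x ^+ a).
Proof. by case=> p fp; exists (p ^+ a) => x; rewrite horner_exp fp. Qed.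
Lemma polyfun_sum (I : Type) (r : seq I) (P : pred I) (f : I -> K -> K) :
  (forall i, polyfun (f i)) -> polyfun (fun x => \sum_(i <- r | P i) f i x).
Proof.
move=> /choice[p fp]; exists (\sum_(i <- r | P i) p i) => x.
by rewrite horner_sum; apply: eq_bigr => i _.
Qed.
Lemma polyfun_prod (I : Type) (r : seq I) (P : pred I) (f : I -> K -> K) :
  (forall i, polyfun (f i)) -> polyfun (fun x => \prod_(i <- r | P i) f i x).
Proof.
move=> /choice[p fp]; exists (\prod_(i <- r | P i) p i) => x.
by rewrite horner_prod; apply: eq_bigr => i _.
Qed.
Lemma polyfun_meval n (p : {mpoly K[n]}) (t : K -> 'I_n -> K) :
  (forall i, polyfun (t^~ i)) -> polyfun (fun x => p.@[t x]).
Proof.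
move=> tp; under eq_fun => x do rewrite mevalE.
apply: polyfun_sum => w; apply: polyfunM; first exact: polyfun_const.
by apply: polyfun_prod => i; apply: polyfunX.
Qed.

Lemma poly_eval_eq0 (p : {poly K}) : (forall x, p.[x] = 0) -> p = 0.
Proof.
move=> p0; apply/eqP/negPn/negP => nz.
pose rs := [seq a%:R : K | a <- iota 0 (size p)].
have := max_poly_roots nz (rs := rs); rewrite size_map size_iota ltnn => H.
apply: notF; apply: H; first by apply/allP => x _; rewrite rootE p0.
by rewrite map_inj_uniq ?iota_uniq //; apply: natr_injK.
Qed.

(** The product with [q] vanishes at all points of the infinite field [K]. *)
Lemma polyfun_eq0 f (q : {poly K}) : q != 0 -> polyfun f ->
  (forall x, q.[x] != 0 -> f x = 0) -> forall x, f x = 0.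
Proof.
move=> q0 [p fp] f0 x; rewrite fp; suff -> : p = 0 by rewrite horner0.
apply/eqP; have : p * q = 0.
  apply: poly_eval_eq0 => y; rewrite hornerM.
  by have [->|/f0] := eqVneq q.[y] 0; rewrite ?mulr0 // fp => ->; rewrite mul0r.
by move/eqP; rewrite mulf_eq0 (negbTE q0) orbF.
Qed.

Lemma shift_unit n (g : 'M[K]_n) x : (char_poly (- g)).[x] != 0 -> g + x%:M \in unitmx.
Proof.
move=> cp; rewrite unitmxE unitfE; apply: contraNneq cp => d0.
rewrite /char_poly -[_.[x]]/(horner_eval x _) -det_map_mx -d0; apply/eqP.
congr (\det _); apply/matrixP => i j; rewrite !mxE /= /horner_eval.
by rewrite hornerD hornerN hornerMn hornerX hornerC opprK addrC.
Qed.

End PolynomialFunctions.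

(** * Weights of polynomial representations *)

Section PolynomialRepresentations.
Variables (K : fieldType) (natK : forall a, a.+1%:R != 0 :> K).
Variables (N m d : nat) (L : polyRep K N m d).
Local Notation A := (peval (pr_mx L)).

Lemma polyfun_peval (G : K -> 'M[K]_N) i j :
  (forall a b, polyfun (fun x => G x a b)) -> polyfun (fun x => A (G x) i j).
Proof.
move=> Gp; under eq_fun => x do rewrite mxE.
apply: polyfun_meval => l; case/mxvec_indexP: l => a b.
by under eq_fun => x do rewrite mxvecE.
Qed.

(* prM holds for invertible matrices; it extends to all of them by considering
   g + x and h + x for a variable x. *)
Lemma pevalM g h : A (g *m h) = A g *m A h.
Proof.
apply/matrixP => i j; apply/eqP; rewrite -subr_eq0; apply/eqP.
pose f x := A ((g + x%:M) *m (h + x%:M)) i j - (A (g + x%:M) *m A (h + x%:M)) i j.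
suff /(_ 0) : forall x, f x = 0.
  have M0 : 0%:M = 0 :> 'M[K]_N by apply/matrixP => a b; rewrite !mxE mul0rn.
  by rewrite /f M0 !addr0.
have sh (u : 'M[K]_N) a b : polyfun (fun x => (u + x%:M) a b).
  under eq_fun => x do rewrite !mxE -mulr_natr.
  by do ?[apply: polyfunD|apply: polyfunM]; (exact: polyfun_const || exact: polyfun_id).
have nz : char_poly (- g) * char_poly (- h) != 0.
  by rewrite mulf_neq0 // monic_neq0 // char_poly_monic.
apply: (polyfun_eq0 natK nz).
  apply: polyfunB.
    apply: polyfun_peval => a b; under eq_fun => x do rewrite mxE.
    by apply: polyfun_sum => l; apply: polyfunM.
  under eq_fun => x do rewrite mxE.
  by apply: polyfun_sum => l; apply: polyfunM; apply: polyfun_peval.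
move=> x; rewrite hornerM mulf_eq0 negb_or => /andP[gx hx].
by rewrite /f prM ?shift_unit // subrr.
Qed.

Definition diag_poly (p : {mpoly K[N * N]}) : {mpoly K[N]} :=
  p \mPo [tuple mxvec (diag_mx (\row_i 'X_i)) 0 l | l < N * N].

Lemma diag_poly_eval p (t : 'I_N -> K) :
  (diag_poly p).@[t] = p.@[mxvec (diag_mx (\row_i t i)) 0].
Proof.
rewrite comp_mpoly_meval; apply: meval_eq => l; rewrite tnth_mktuple.
case/mxvec_indexP: l => a b; rewrite !mxvecE !mxE.
by case: eqP => _; rewrite ?mulr1n ?mulr0n ?mevalXU ?meval0.
Qed.

(** The coefficient of t^w in the matrix by which diag(t) acts; it is the projection onto the weight
    space of [w]. *)
Definition weight_proj (w : 'X_{1..N}) : 'M[K]_d :=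
  \matrix_(i, j) (diag_poly (pr_mx L i j))@_w.
Local Notation P := weight_proj.

Lemma row_mxE (t : 'rV[K]_N) : \row_i t 0 i = t.
Proof. by apply/rowP => i; rewrite mxE. Qed.

Lemma peval_diag (t : 'I_N -> K) i j :
  A (diag_mx (\row_l t l)) i j = (diag_poly (pr_mx L i j)).@[t].
Proof. by rewrite diag_poly_eval mxE. Qed.

(** Compare the coefficients of s^w in A(diag t) A(diag s) = A(diag ts). *)
Lemma peval_diag_proj (t : 'I_N -> K) w :
  A (diag_mx (\row_l t l)) *m P w = (\prod_i t i ^+ w i) *: P w.
Proof.
apply/matrixP => i j; rewrite !mxE.
pose p := \sum_l A (diag_mx (\row_l t l)) i l *: diag_poly (pr_mx L l j).
have -> : \sum_l A (diag_mx (\row_l t l)) i l * P w l j = p@_w.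
  by rewrite raddf_sum /=; apply: eq_bigr => l _; rewrite mcoeffZ [P _ _ _]mxE.
rewrite mulrC -mpoly_scale_coef; congr (_@__); apply: (mpoly_eval_inj natK) => s _.
rewrite mpoly_scale_eval -peval_diag /p raddf_sum /=.
transitivity ((A (diag_mx (\row_l t l)) *m A (diag_mx (\row_l s l))) i j).
  by rewrite mxE; apply: eq_bigr => l _; rewrite mevalZ -peval_diag.
rewrite -pevalM mulmx_diag; congr (A (diag_mx _) i j).
by apply/rowP => l; rewrite !mxE.
Qed.

Lemma weight_proj_fix (w : 'X_{1..N}) v : has_weight L w v -> P w *m v = v.
Proof.
move=> wv; apply/matrixP => i j; rewrite !mxE ord1.
pose p := \sum_l v l 0 *: diag_poly (pr_mx L i l).
have -> : \sum_l P w i l * v l 0 = p@_w.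
  by rewrite raddf_sum /=; apply: eq_bigr => l _; rewrite mcoeffZ [P _ _ _]mxE mulrC.
have -> : p = v i 0 *: 'X_[w]; last by rewrite mcoeffZ mcoeffX eqxx mulr1.
apply: (mpoly_eval_inj natK) => t t0; rewrite /p raddf_sum /= mevalZ mevalX.
have := wv (\row_l t l); rewrite /pr_act => /(_ ltac:(by move=> l; rewrite mxE)).
move/matrixP/(_ i 0); rewrite !mxE mulrC => e.
rewrite (eq_bigr (fun l => A (diag_mx (\row_l t l)) i l * v l 0)) => [|l _]; last first.
  by rewrite mevalZ -peval_diag mulrC.
by rewrite e; congr (_ * _); apply: eq_bigr => l _; rewrite mxE.
Qed.

Lemma weight_proj_weight (w : 'X_{1..N}) v : has_weight L w (P w *m v).
Proof.
move=> t _; rewrite /pr_act mulmxA -(row_mxE t) peval_diag_proj -scalemxAl.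
by congr (_ *: _); apply: eq_bigr => i _; rewrite mxE.
Qed.

Lemma has_weightP (w : 'X_{1..N}) v : has_weight L w v <-> P w *m v = v.
Proof. by split=> [|<-]; [exact: weight_proj_fix|exact: weight_proj_weight]. Qed.

Lemma weight_proj_mul (w : 'X_{1..N}) n (B : 'M_(d, n)) :
  (forall t : 'I_N -> K, (forall i, t i != 0) ->
     A (diag_mx (\row_l t l)) *m B = (\prod_i t i ^+ w i) *: B) ->
  P w *m B = B.
Proof.
move=> wB; apply: trmx_inj; apply/row_matrixP => i; rewrite -!tr_col; congr trmx.
rewrite !colE -mulmxA; apply: weight_proj_fix => t t0.
rewrite /pr_act mulmxA -(row_mxE t) wB => [|l]; last exact: t0.
by rewrite -scalemxAl; congr (_ *: _); apply: eq_bigr => l _; rewrite mxE.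
Qed.

Lemma weight_proj_idem w : P w *m P w = P w.
Proof. by apply: weight_proj_mul => t _; apply: peval_diag_proj. Qed.

Lemma dim_weight_space (w : 'X_{1..N}) : \dim (weight_space L w) = \rank (P w).
Proof.
pose f := linfun (mulmx (col_base (P w)) : 'cV_(\rank (P w)) -> 'cV_d).
have fE x : f x = col_base (P w) *m x by rewrite lfunE.
have f0 : (lker f == 0)%VS.
  apply/lker0P => x y; rewrite !fE => /(row_full_inj (col_base_full _)) //.
have <- : \dim (fullv : {vspace 'cV[K]_(\rank (P w))}) = \rank (P w).
  by rewrite dimvf /dim /= muln1.
rewrite -(limg_dim_eq (f := f)); last by rewrite (eqP f0) capv0.
congr (\dim _); apply/vspaceP => v; apply/idP/memv_imgP.
  move/weight_spaceP/has_weightP => <-; exists (row_base (P w) *m v); first exact: memvf.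
  by rewrite fE mulmxA mulmx_base.
case=> x _ ->; apply/weight_spaceP/has_weightP; rewrite fE -{1}(mulmx_base (P w)).
by rewrite -mulmxA (mulmxA (row_base _)) idem_base ?weight_proj_idem // mul1mx.
Qed.

Lemma mxtrace_weight_proj w : \tr (P w) = (\dim (weight_space L w))%:R.
Proof. by rewrite dim_weight_space mxtrace_idem ?weight_proj_idem. Qed.

End PolynomialRepresentations.

Section YoungTraces.
Variables (K : fieldType) (natK : forall a, a.+1%:R != 0 :> K).
Variables (N m d : nat) (mN : (m <= N)%N) (L : polyRep K N m d).
Local Notation A := (peval (pr_mx L)).
Local Notation P := (weight_proj L).
Local Notation wd := (widen_ord mN).

Definition ones_mnm : 'X_{1..N} := [multinom nat_of_bool (i < m)%N | i < N].
Local Notation ones := ones_mnm.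

Lemma peval_proj_diag (t : 'I_N -> K) w :
  P w *m A (diag_mx (\row_l t l)) = (\prod_i t i ^+ w i) *: P w.
Proof.
apply/matrixP => i j; rewrite !mxE.
pose p := \sum_l A (diag_mx (\row_l t l)) l j *: diag_poly (pr_mx L i l).
have -> : \sum_l P w i l * A (diag_mx (\row_l t l)) l j = p@_w.
  by rewrite raddf_sum /=; apply: eq_bigr => l _; rewrite mcoeffZ [P _ _ _]mxE mulrC.
rewrite mulrC -mpoly_scale_coef; congr (_@__); apply: (mpoly_eval_inj natK) => s _.
rewrite mpoly_scale_eval -peval_diag /p raddf_sum /=.
transitivity ((A (diag_mx (\row_l s l)) *m A (diag_mx (\row_l t l))) i j).
  by rewrite mxE; apply: eq_bigr => l _; rewrite mevalZ -peval_diag mulrC.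
rewrite -pevalM // mulmx_diag; congr (A (diag_mx _) i j).
by apply/rowP => l; rewrite !mxE mulrC.
Qed.

Lemma widen_inj : injective wd.
Proof. by move=> i j /(congr1 val) /= /val_inj. Qed.

Lemma prod_widen (f : 'I_N -> K) :
  \prod_i f i ^+ ones i = \prod_(i < m) f (wd i).
Proof.
rewrite -(big_ord_narrow (F := f)) [RHS]big_mkcond /=.
by apply: eq_bigr => i _; rewrite mnmE; case: (i < m)%N; rewrite ?expr1 ?expr0.
Qed.

Section Content.
Variable c : 'I_m -> 'I_N.

Definition content_mnm : 'X_{1..N} := [multinom #|[set i | c i == a]| | a < N].
Local Notation mu := content_mnm.

(** Sends the basis vector [i < m] to the basis vector [c i] and the others to 0, so it carries the
    weight (1^m) to the content of [c]. The entries 1 of E^T E mark the pairs of letters of equal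
    colour. *)
Definition content_mx : 'M[K]_N := \sum_(i < m) delta_mx (c i) (wd i).
Local Notation E := content_mx.

Definition young_stab : pred 'S_m := fun s => [forall i, c (s i) == c i].

Lemma prod_content (f : 'I_N -> K) : \prod_a f a ^+ mu a = \prod_i f (c i).
Proof.
rewrite [RHS](partition_big c xpredT) //=; apply: eq_bigr => a _.
rewrite mnmE (eq_bigr (fun=> f a)) => [|i /eqP -> //].
by rewrite prodr_const; congr (_ ^+ _); rewrite cardsE.
Qed.

Lemma content_mxE a i : E a (wd i) = (a == c i)%:R.
Proof.
rewrite /E summxE (bigD1 i) //= !mxE eqxx andbT big1 ?addr0 // => j ji.
by rewrite !mxE (inj_eq widen_inj) (eq_sym i) (negbTE ji) andbF.
Qed.

Lemma content_mx_out a (l : 'I_N) : ~~ (l < m)%N -> E a l = 0.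
Proof.
move=> lm; rewrite /E summxE big1 // => i _; rewrite !mxE; case: eqP => //= _.
by case: eqP => // e; rewrite e /= ltn_ord in lm.
Qed.

Lemma sum_widen (G : 'I_N -> K) : (forall l : 'I_N, ~~ (l < m)%N -> G l = 0) ->
  \sum_l G l = \sum_(i < m) G (wd i).
Proof.
move=> G0; rewrite -(big_ord_narrow (F := G)) [RHS]big_mkcond /=.
by apply: eq_bigr => l _; case: ifPn => // /G0.
Qed.

Lemma content_mx_diag (t : 'I_N -> K) :
  diag_mx (\row_l t l) *m E =
  E *m diag_mx (\row_l (if insub (l : nat) is Some i then t (c i) else 1)).
Proof.
apply/matrixP => a b; rewrite mul_diag_mx mul_mx_diag !mxE.
have [bm|bm] := boolP (b < m)%N; last by rewrite content_mx_out // mulr0 mul0r.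
have -> : b = wd (Ordinal bm) by apply: val_inj.
rewrite content_mxE mulrC; case: eqP => [->|_]; last by rewrite !mul0r.
by rewrite insubT; congr (_ * t (c _)); apply: val_inj.
Qed.

Lemma content_mx_conj (t : 'I_N -> K) :
  E *m diag_mx (\row_l t l) *m E^T =
  diag_mx (\row_a \sum_(i | c i == a) t (wd i)).
Proof.
apply/matrixP => a b; rewrite mxE sum_widen => [|l lm]; last first.
  by rewrite mul_mx_diag mxE [E^T _ _]mxE !content_mx_out // mulr0.
rewrite !mxE -sumrMnl [RHS]big_mkcond; apply: eq_bigr => i _ /=.
rewrite mul_mx_diag mxE [E^T _ _]mxE !content_mxE mxE eq_sym.
case: eqP => [->|_]; last by rewrite !mul0r.
by rewrite mul1r eq_sym; case: eqP => _; rewrite ?mulr1 ?mulr0.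
Qed.

Lemma content_mx_gram i j : (E^T *m E) (wd i) (wd j) = (c i == c j)%:R.
Proof.
rewrite mxE (bigD1 (c i)) //= mxE !content_mxE eqxx mul1r big1 ?addr0 // => a ai.
by rewrite mxE !content_mxE (negbTE ai) mul0r.
Qed.

(** The value of the weight [mu] at the diagonal matrix E diag(t) E^T. Its coefficient at the
    product of the first m variables counts the ways to choose distinct [i] of colour [c j] for all
    [j], that is, the elements of [young_stab]. *)
Definition stab_poly : {mpoly K[N]} :=
  \prod_(j < m) \sum_(i < m | c i == c j) 'X_(wd i).

Lemma stab_poly_eval (t : 'I_N -> K) :
  stab_poly.@[t] = \prod_a (\sum_(i | c i == a) t (wd i)) ^+ mu a.
Proof.
rewrite prod_content /stab_poly rmorph_prod /=; apply: eq_bigr => j _.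
by rewrite raddf_sum /=; apply: eq_bigr => i _; rewrite mevalXU.
Qed.

Lemma stab_poly_coef : stab_poly@_ones = #|young_stab|%:R.
Proof.
rewrite /stab_poly bigA_distr_big_dep /= raddf_sum /=.
transitivity (\sum_(f : {ffun 'I_m -> 'I_m} |
    (f \in family (fun j => [pred i | c i == c j])) && injectiveb f) (1 : K)).
  rewrite big_mkcondr /=; apply: eq_bigr => f _.
  rewrite mprodXE mcoeffX; have -> : ((\sum_(j < m) U_(wd (f j)))%MM == ones) = injectiveb f.
    apply/eqP/injectiveP => [e|f_inj].
      move=> i j fij; apply/eqP/negPn/negP => neq.
      have /mnmP/(_ (wd (f i))) := e; rewrite mnm_sumE mnmE /= ltn_ord (bigD1 i) // (bigD1 j) /=.
        by rewrite !mnm1E fij !eqxx.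
      by rewrite eq_sym.
    apply/mnmP => a; rewrite mnm_sumE mnmE; have [am|am] := ltnP a m.
      have /codomP[j ej] : Ordinal am \in codom f by apply: inj_card_onto.
      have ea : a = wd (f j) by rewrite -ej; apply: val_inj.
      rewrite (bigD1 j) //= mnm1E -ea eqxx big1 // => i ij.
      rewrite mnm1E ea (inj_eq widen_inj) (inj_eq f_inj).
      by rewrite (negbTE ij).
    rewrite big1 // => j _; rewrite mnm1E; case: eqP => // e.
    by have := ltn_ord (f j); rewrite -[X in (X < _)%N]/(wd (f j) : nat) e ltnNge am.
  by case: injectiveb.
rewrite sumr_const; congr (_ *+ _).
have h_inj : injective (fun s : 'S_m => [ffun i => s i]).
  by move=> s s' /ffunP e; apply/permP => i; have := e i; rewrite !ffunE.
rewrite -(card_image h_inj); apply: eq_card => f; rewrite unfold_in.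
apply/andP/imageP => [[/familyP fc /injectiveP f_inj]|[s sc ->]].
  exists (perm f_inj); last by apply/ffunP => i; rewrite ffunE permE.
  by apply/forallP => i; rewrite permE; apply: fc.
split; last by apply/injectiveP => i j; rewrite !ffunE => /perm_inj.
by apply/familyP => i; rewrite ffunE inE (forallP sc).
Qed.

(** [P ones] is the coefficient of t^ones in A(diag t), so the left side is that coefficient in A(E
    diag(t) E^T) [P mu], which is [stab_poly] times [P mu]. *)
Lemma young_conj_proj :
  A E *m P ones *m A E^T *m P mu = #|young_stab|%:R *: P mu.
Proof.
apply/matrixP => i j; set B := A E^T *m P mu.
pose p := \sum_l \sum_l' (A E i l * B l' j) *: diag_poly (pr_mx L l l').
have -> : (A E *m P ones *m A E^T *m P mu) i j = p@_ones.
  rewrite -[_ *m _ *m _ *m P mu]mulmxA -/B -mulmxA mxE /p raddf_sum /=.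
  apply: eq_bigr => l _; rewrite [(_ *m B) l j]mxE mulr_sumr raddf_sum /=; apply: eq_bigr => l' _.
  by rewrite mcoeffZ [P _ _ _]mxE mulrCA mulrC.
have -> : p = P mu i j *: stab_poly.
  apply: (mpoly_eval_inj natK) => t _; rewrite mevalZ stab_poly_eval mulrC.
  transitivity ((A E *m A (diag_mx (\row_l t l)) *m A E^T *m P mu) i j).
    rewrite -[_ *m _ *m _ *m P mu]mulmxA -/B -mulmxA mxE /p raddf_sum /=.
    apply: eq_bigr => l _; rewrite [(_ *m B) l j]mxE mulr_sumr raddf_sum /=; apply: eq_bigr => l' _.
    by rewrite mevalZ -peval_diag mulrCA mulrC.
  by rewrite -!pevalM // content_mx_conj peval_diag_proj // mxE.
by rewrite mcoeffZ stab_poly_coef [RHS]mxE mulrC.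
Qed.

Lemma proj_young_conj :
  P mu *m (A E *m P ones *m A E^T) = A E *m P ones *m A E^T.
Proof.
apply: weight_proj_mul => // t t0; rewrite !mulmxA -pevalM // content_mx_diag pevalM //.
rewrite -[A E *m A _ *m _]mulmxA peval_diag_proj // -scalemxAr -!scalemxAl.
congr (_ *: _); rewrite prod_widen prod_content; apply: eq_bigr => i _.
by rewrite /= insubT ?ltn_ord // => im; congr (t (c _)); apply: val_inj.
Qed.

Lemma young_gram_trace :
  \tr (P ones *m A (E^T *m E)) = #|young_stab|%:R * \tr (P mu).
Proof.
rewrite pevalM // mulmxA mxtrace_mulC mulmxA -proj_young_conj mxtrace_mulC.
by rewrite young_conj_proj mxtraceZ.
Qed.

End Content.
End YoungTraces.

Section PermutationTraces.
Variables (K : fieldType) (natK : forall a, a.+1%:R != 0 :> K).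
Variables (N m d : nat) (mN : (m <= N)%N) (L : polyRep K N m d).
Local Notation A := (peval (pr_mx L)).
Local Notation P := (weight_proj L).
Local Notation wd := (widen_ord mN).
Local Notation ones := (ones_mnm N m).

Definition ones_trace_poly : {mpoly K[N * N]} :=
  \sum_k \sum_l P ones l k *: pr_mx L k l.

Lemma ones_trace_poly_eval (h : 'M[K]_N) :
  ones_trace_poly.@[mxvec h 0] = \tr (A h *m P ones).
Proof.
rewrite /ones_trace_poly /mxtrace raddf_sum /=; apply: eq_bigr => k _.
rewrite raddf_sum [RHS]mxE; apply: eq_bigr => l _.
by rewrite /= mevalZ mulrC [A h k l]mxE.
Qed.

Lemma ones_trace_scale_row (t : 'I_N -> K) h :
  \tr (A (diag_mx (\row_l t l) *m h) *m P ones) =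
  (\prod_i t i ^+ ones i) * \tr (A h *m P ones).
Proof.
by rewrite pevalM // -mulmxA mxtrace_mulC -mulmxA peval_proj_diag // -scalemxAr mxtraceZ.
Qed.

Lemma ones_trace_scale_col (t : 'I_N -> K) h :
  \tr (A (h *m diag_mx (\row_l t l)) *m P ones) =
  (\prod_i t i ^+ ones i) * \tr (A h *m P ones).
Proof.
by rewrite pevalM // -mulmxA peval_diag_proj // -scalemxAr mxtraceZ.
Qed.

Section Support.
Variable W : 'X_{1..N * N}.
Local Notation w a b := (W (mxvec_index a b)).
Hypothesis W_supp : ones_trace_poly@_W != 0.

Lemma support_weight (u : 'I_N * 'I_N -> K) (x : K) :
    (forall h : 'M[K]_N, \tr (A (\matrix_(a, b) (u (a, b) * h a b)) *m P ones) =
       x * \tr (A h *m P ones)) ->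
  \prod_a \prod_b u (a, b) ^+ w a b = x.
Proof.
move=> scale; pose uv (l : 'I_(N * N)) := mxvec (\matrix_(a, b) u (a, b)) 0 l.
have e : mpoly_scale uv ones_trace_poly = x *: ones_trace_poly.
  apply: (mpoly_eval_inj natK) => v _; rewrite mpoly_scale_eval mevalZ.
  pose h : 'M[K]_N := vec_mx (\row_l v l).
  have vE : v =1 mxvec h 0 by move=> l; rewrite vec_mxK mxE.
  rewrite [X in _ = _ * X](meval_eq _ vE) ones_trace_poly_eval -scale.
  rewrite -ones_trace_poly_eval; apply: meval_eq => l; rewrite vE /uv.
  by case/mxvec_indexP: l => a b; rewrite !mxvecE !mxE.
have /(congr1 (mcoeff W)) := e; rewrite mpoly_scale_coef mcoeffZ mulrC => /(mulIf W_supp) <-.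
rewrite pair_bigA [RHS](reindex _ (curry_mxvec_bij _ _)) /=.
by apply: eq_bigr => -[a b] _; rewrite /uv mxvecE mxE.
Qed.

(** Doubling row [a] of the matrix multiplies the polynomial by 2 to the power [ones a], and the
    monomial of [W] by 2 to its degree in that row. *)
Lemma support_row a : (\sum_b w a b)%N = ones a.
Proof.
pose t (a' : 'I_N) : K := if a' == a then 2%:R else 1.
have tE (F : 'I_N -> nat) : \prod_b t b ^+ F b = (2 ^ F a)%:R.
  by rewrite (bigD1 a) //= /t eqxx big1 ?mulr1 ?natrX // => b /negbTE ->; rewrite expr1n.
have : \prod_a' \prod_b' t a' ^+ w a' b' = (2 ^ ones a)%:R.
  apply: (support_weight (u := fun ab => t ab.1)) => h.
  rewrite -(tE ones) -ones_trace_scale_row; congr (\tr (A _ *m _)).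
  by apply/matrixP => i j; rewrite mul_diag_mx !mxE.
under eq_bigr => i _ do rewrite prodrXr.
by rewrite tE => /(natr_injK natK)/eqP; rewrite eqn_exp2l // => /eqP.
Qed.

Lemma support_col b : (\sum_a w a b)%N = ones b.
Proof.
pose t (b' : 'I_N) : K := if b' == b then 2%:R else 1.
have tE (F : 'I_N -> nat) : \prod_a t a ^+ F a = (2 ^ F b)%:R.
  by rewrite (bigD1 b) //= /t eqxx big1 ?mulr1 ?natrX // => a /negbTE ->; rewrite expr1n.
have : \prod_a' \prod_b' t b' ^+ w a' b' = (2 ^ ones b)%:R.
  apply: (support_weight (u := fun ab => t ab.2)) => h.
  rewrite -(tE ones) -ones_trace_scale_col; congr (\tr (A _ *m _)).
  by apply/matrixP => i j; rewrite mul_mx_diag !mxE mulrC.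
rewrite exchange_big /=.
under eq_bigr => i _ do rewrite prodrXr.
by rewrite tE => /(natr_injK natK)/eqP; rewrite eqn_exp2l // => /eqP.
Qed.

(** The exponents form a matrix of natural numbers with row and column sums 1 on the first m indices
    and 0 beyond, hence a permutation matrix. *)
Lemma support_perm : exists s : 'S_m, forall h : 'M[K]_N,
  \prod_a \prod_b h a b ^+ w a b = \prod_i h (wd (s i)) (wd i).
Proof.
have row0 (a b : 'I_N) : ~~ (a < m)%N -> w a b = 0%N.
  move=> am; apply/eqP; have := support_row a; rewrite mnmE (negbTE am) => /eqP.
  by rewrite sum_nat_eq0 => /forallP/(_ b).
have col0 (a b : 'I_N) : ~~ (b < m)%N -> w a b = 0%N.
  move=> bm; apply/eqP; have := support_col b; rewrite mnmE (negbTE bm) => /eqP.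
  by rewrite sum_nat_eq0 => /forallP/(_ a).
have /choice[f fP] (i : 'I_m) : exists j, w (wd j) (wd i) != 0%N.
  have := support_col (wd i); rewrite mnmE /= ltn_ord => sum1.
  have [a wa] : exists a, w a (wd i) != 0%N.
    apply/existsP; apply: contraPT sum1; rewrite negb_exists => /forallP z.
    by rewrite big1 // => a _; apply/eqP/negbNE/z.
  have am : (a < m)%N by apply: contraR wa => /row0 ->.
  by exists (Ordinal am); rewrite (_ : wd _ = a) //; apply: val_inj.
have colE i a : w a (wd i) = (a == wd (f i)).
  have := support_col (wd i); rewrite mnmE /= ltn_ord (bigD1 (wd (f i))) //=.
  have := fP i; case e: (w _ _) => [//|x] _; rewrite addSn => -[/eqP].
  rewrite addn_eq0 => /andP[/eqP x0 rest]; case: eqP => [->|/eqP neq]; first by rewrite e x0.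
  apply/eqP; move: rest; rewrite sum_nat_eq0 => /forallP/(_ a).
  by rewrite neq.
have f_inj : injective f.
  move=> i j fij; apply/eqP/negPn/negP => neq.
  have := support_row (wd (f i)); rewrite mnmE /= ltn_ord.
  rewrite (bigD1 (wd i)) // (bigD1 (wd j)) /=; last by rewrite (inj_eq (@widen_inj _ _ mN)) eq_sym.
  by rewrite !colE fij !eqxx.
exists (perm f_inj) => h; rewrite exchange_big /=.
transitivity (\prod_(b < N | (b < m)%N) \prod_a h a b ^+ w a b).
  rewrite [RHS]big_mkcond; apply: eq_bigr => b _; case: ifPn => // bm.
  by rewrite big1 // => a _; rewrite col0 // expr0.
rewrite big_ord_narrow; apply: eq_bigr => i _; rewrite (bigD1 (wd (f i))) //= colE eqxx expr1.
rewrite permE big1 ?mulr1 // => a /negbTE neq; by rewrite colE neq expr0.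
Qed.

End Support.

Lemma ext_perm_mxE (s : 'S_m) i j : ext_perm_mx K N s (wd i) (wd j) = (i == s j)%:R.
Proof. by rewrite mxE /ext_perm /= valK. Qed.

(** At the permutation matrix of [s] the monomial of [s0] is 1 if [s = s0] and 0 otherwise; at E^T E
    it is 1 if [s0] preserves [c] and 0 otherwise. So both sides agree monomial by monomial, once
    the right side is written as the trace at E^T E. *)
Theorem young_trace (c : 'I_m -> 'I_N) :
  \sum_(s | young_stab c s) \tr (A (ext_perm_mx K N s) *m P ones) =
  #|young_stab c|%:R * (\dim (weight_space L (content_mnm c)))%:R.
Proof.
rewrite -mxtrace_weight_proj // -(young_gram_trace natK mN) mxtrace_mulC.
set J := _ *m content_mx _ _ _.
under eq_bigr => s _ do rewrite -ones_trace_poly_eval mevalE.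
rewrite -ones_trace_poly_eval mevalE exchange_big /=; apply: eq_big_seq => W.
rewrite mcoeff_msupp => W_supp; rewrite -mulr_sumr; congr (_ * _).
have vecE (h : 'M[K]_N) : \prod_i mxvec h 0 i ^+ W i =
    \prod_a \prod_b h a b ^+ W (mxvec_index a b).
  rewrite pair_bigA [LHS](reindex _ (curry_mxvec_bij _ _)) /=.
  by apply: eq_bigr => -[a b] _; rewrite mxvecE.
have [s0 s0P] := support_perm W_supp.
have prodb (b : 'I_m -> bool) : \prod_i (b i)%:R = [forall i, b i]%:R :> K.
  case: forallP => [H|H]; first by rewrite big1 // => i _; rewrite H.
  have [i bi] : exists i, ~~ b i by apply/existsP; rewrite -negb_forall; apply/forallP.
  by rewrite (bigD1 i) //= (negbTE bi) mul0r.
transitivity (\sum_(s | young_stab c s) [forall i, s0 i == s i]%:R : K).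
  apply: eq_bigr => s _; rewrite -prodb vecE s0P.
  by apply: eq_bigr => i _; rewrite ext_perm_mxE.
rewrite [RHS](vecE J) s0P; under [RHS]eq_bigr => i _ do rewrite content_mx_gram.
rewrite prodb -/(young_stab c s0); have [s0c|s0c] := boolP (young_stab c s0).
  rewrite (bigD1 s0) //= big1 ?addr0 => [|s /andP[_ neq]].
    by rewrite (_ : [forall i, _] = true) //; apply/forallP => i.
  rewrite (_ : [forall i, _] = false) //; apply: contraNF neq => /forallP e.
  by apply/eqP/permP => i; rewrite (eqP (e i)).
rewrite big1 // => s sc; rewrite (_ : [forall i, _] = false) //.
apply: contraNF s0c => /forallP e; rewrite (_ : s0 = s) //.
by apply/permP => i; rewrite (eqP (e i)).
Qed.

End PermutationTraces.

(** * Modules in coordinates *)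

Section Coordinates.
Import VectorInternalTheory.
Variables (K : fieldType) (natK : forall a, a.+1%:R != 0 :> K) (m : nat).
Implicit Types V W : symModule K m.

(** Row vectors with the action from the right make [r] multiplicative for the product in which the
    left factor acts first. *)
Definition coordinates V n (f : V -> 'rV[K]_n) (r : 'S_m -> 'M[K]_n) : Prop :=
  [/\ linear f, bijective f & forall s v, f (act s v) = f v *m r s].

Lemma coordinates_hom V n (f : V -> 'rV[K]_n) r : coordinates f r -> mx_hom r.
Proof.
case=> _ [g fK gK] f_act; split=> [|s t]; apply/row_matrixP => i; rewrite !rowE.
  by rewrite -[delta_mx 0 i]gK -f_act act1 mulmx1.
by rewrite mulmxA -[delta_mx 0 i]gK -!f_act actM.
Qed.

(** The carrier of a [symModule] has no dimension; finiteness is borrowed from an injection into a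
    [vectType]. *)
Lemma coordinates_exist V (vT : vectType K) (h : V -> vT) :
  linear h -> injective h -> exists n (f : V -> 'rV[K]_n) r, coordinates f r.
Proof.
move=> h_lin h_inj; have h0 : h 0 = 0 by have := h_lin (-1) 0 0; rewrite !scaleN1r !addNr.
have [U UP] : exists U : {vspace vT}, forall w, w \in U <-> exists v, h v = w.
  apply: ex_vspace_of; first by exists 0.
  by move=> a _ _ [u <-] [v <-]; exists (a *: u + v); apply: h_lin.
pose f v := v2r (vsproj U (h v)).
have f_lin : linear f by move=> a u v; rewrite /f h_lin !linearP.
have /choice[g gP] x : exists v, h v = vsval (r2v x : subvs_of U).
  by apply/UP/subvsP.
have gK : cancel g f by move=> x; rewrite /f gP vsvalK r2vK.
have fK : cancel f g.
  by move=> v; apply: h_inj; rewrite gP /f v2rK vsprojK //; apply/UP; exists v.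
have F_lin s : linear (fun x => f (act s (g x))).
  move=> a x y; have -> : g (a *: x + y) = a *: g x + g y.
    by apply: (can_inj fK); rewrite f_lin !gK.
  by rewrite act_linear f_lin.
pose n := dim (subvs_of U).
pose F s := HB.pack_for {linear 'rV[K]_n -> 'rV[K]_n} (fun x : 'rV[K]_n => f (act s (g x)))
  (GRing.isLinear.Build K _ _ _ _ (F_lin s)).
exists _, f, (fun s => lin1_mx (F s)); split=> //; first by exists g.
by move=> s v; rewrite mul_rV_lin1 /= fK.
Qed.

Theorem sm_surjects_of_traces V W n1 n2 (f1 : V -> 'rV[K]_n1) (f2 : W -> 'rV[K]_n2) r1 r2 :
    coordinates f1 r1 -> coordinates f2 r2 -> (forall s, \tr (r1 s) = \tr (r2 s)) ->
  sm_surjects V W.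
Proof.
move=> c1 c2 tr12; have [T Teq Tfull] := equal_traces_surjection natK
  (coordinates_hom c1) (coordinates_hom c2) tr12.
have [f1_lin [g1 f1K g1K] f1_act] := c1; have [f2_lin [g2 f2K g2K] f2_act] := c2.
apply: (@sm_surjects_of_relation _ _ _ _ (fun v w => f2 w = f1 v *m T)).
- by move=> a v v' w w' e e'; rewrite f2_lin f1_lin e e' mulmxDl scalemxAl.
- by move=> v; exists (g2 (f1 v *m T)); rewrite g2K.
- move=> w; have /submxP[x ex] : (f2 w <= T)%MS by apply: submx_full.
  by exists (g1 x); rewrite g1K.
- have f0 (U : symModule K m) n (f : U -> 'rV[K]_n) : linear f -> f 0 = 0.
    by move=> f_lin; have := f_lin (-1) 0 0; rewrite !scaleN1r !addNr.
  by move=> w; rewrite f0 // mul0mx -(f0 W _ _ f2_lin) => /(can_inj f2K).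
- by move=> s v w e; rewrite f2_act f1_act e -!mulmxA Teq.
Qed.

Lemma sm_surjects_trans V1 V2 V3 :
  sm_surjects V1 V2 -> sm_surjects V2 V3 -> sm_surjects V1 V3.
Proof.
case=> f f_eq f_onto [g g_eq g_onto].
exists (g \o f : {linear V1 -> V3}) => [s v|w] /=; first by rewrite f_eq g_eq.
by have [v <-] := g_onto w; have [u <-] := f_onto v; exists u.
Qed.

Definition orbit_sum V (S : pred 'S_m) (v : V) : V := \sum_(s | S s) act s v.

Lemma orbit_sum_linear V S : linear (@orbit_sum V S).
Proof.
move=> a u v; rewrite /orbit_sum scaler_sumr -big_split; apply: eq_bigr => s _.
exact: act_linear.
Qed.

(** Divided by the order of the subgroup, the sum of the [r s] is a projection, so its trace is its
    rank. Its image has the orbit sums of the [b i] as a basis. *)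
Lemma subgroup_trace V n (f : V -> 'rV[K]_n) r (S : pred 'S_m)
    (I : finType) (D : {set I}) (b : I -> V) :
    coordinates f r -> S 1%g -> (forall s t, S s -> S (s * t)%g = S t) ->
    (forall x : I -> K, \sum_(i in D) x i *: orbit_sum S (b i) = 0 ->
       forall i, i \in D -> x i = 0) ->
    (forall v, lspan (fun u => exists2 i, i \in D & u = orbit_sum S (b i)) (orbit_sum S v)) ->
  \sum_(s | S s) \tr (r s) = #|S|%:R * #|D|%:R.
Proof.
move=> cf S1 SM b_free b_span; have [r1 rM] := coordinates_hom cf.
have [f_lin [g fK gK] f_act] := cf.
have f0 : f 0 = 0 by have := f_lin (-1) 0 0; rewrite !scaleN1r !addNr.
have f_sum (J : finType) (Q : pred J) (a : J -> K) (v : J -> V) :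
    f (\sum_(j | Q j) a j *: v j) = \sum_(j | Q j) a j *: f (v j).
  by elim/big_rec2: _ => // j x y _ <-; rewrite f_lin.
pose E := \sum_(s | S s) r s.
have fE v : f (orbit_sum S v) = f v *m E.
  rewrite mulmx_sumr /orbit_sum; under eq_bigr => s _ do rewrite -[act s v]scale1r.
  by rewrite f_sum; apply: eq_bigr => s _; rewrite scale1r f_act.
have EE : E *m E = #|S|%:R *: E.
  rewrite {1}/E mulmx_suml (eq_bigr (fun=> E)) => [|s Ss].
    by rewrite sumr_const scaler_nat.
  rewrite /E mulmx_sumr [RHS](reindex_inj (mulgI s)) /=.
  by apply: eq_big => [t|t _]; rewrite ?SM ?rM.
have S0 : #|S|%:R != 0 :> K.
  have : (0 < #|S|)%N by apply/card_gt0P; exists 1%g.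
  by case: #|_| => // c _; apply: natK.
have -> : \sum_(s | S s) \tr (r s) = #|S|%:R * \tr (#|S|%:R^-1 *: E).
  by rewrite mxtraceZ mulVKf // raddf_sum.
congr (_ * _); rewrite mxtrace_idem; last first.
  by rewrite -scalemxAl -scalemxAr EE [X in _ *: X = _]scalerA mulVf // scale1r.
congr (_%:R); rewrite mxrank_scale_nz ?invr_eq0 //.
pose B := \matrix_(i < #|D|) f (orbit_sum S (b (enum_val i))).
have B_free : row_free B.
  rewrite -kermx_eq0; apply/rowV0P => x /sub_kermxP xB.
  pose y (i : I) := \sum_(j < #|D| | enum_val j == i) x 0 j.
  have yE j : y (enum_val j) = x 0 j.
    by rewrite /y (big_pred1 j) // => l; rewrite /= (inj_eq enum_val_inj).
  apply/rowP => j; rewrite [RHS]mxE -yE; apply: b_free (enum_valP j).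
  apply: (can_inj fK); rewrite f_sum f0 -[RHS]xB mulmx_sum_row big_enum_val.
  by apply: eq_bigr => l _; rewrite rowK yE.
move/eqP: B_free => <-; apply/eqmx_rank/andP; split; last first.
  apply/row_subP => i; rewrite rowK fE; exact: submxMl.
apply/row_subP => i; rewrite rowE -[delta_mx 0 i]gK -fE.
elim: (b_span (g (delta_mx 0 i))) => {i} [|_ [i iD ->]|a u v _ IHu _ IHv].
- by rewrite f0 sub0mx.
- have -> : f (orbit_sum S (b i)) = row (enum_rank_in iD i) B by rewrite rowK enum_rankK_in.
  exact: row_sub.
- by rewrite f_lin addmx_sub // scalemx_sub.
Qed.

End Coordinates.

Section SchurCoordinates.
Variables (K : fieldType) (natK : forall a, a.+1%:R != 0 :> K).
Variables (N m d : nat) (mN : (m <= N)%N) (L : polyRep K N m d).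
Local Notation A := (peval (pr_mx L)).
Local Notation P1 := (weight_proj L (ones_mnm N m)).

(** A rank factorization C R of the weight projection gives the coordinates R v on its image; the
    transpose turns the columns of [L] into rows. *)
Lemma schur_coordinates : exists n (f : schur_functor mN L -> 'rV[K]_n) r,
  coordinates f r /\ forall s, \tr (r s) = \tr (A (ext_perm_mx K N s) *m P1).
Proof.
pose R := row_base P1; pose C := col_base P1.
have RC : R *m C = 1%:M by apply/idem_base/weight_proj_idem.
have CR : C *m R = P1 by apply: mulmx_base.
have P1C : P1 *m C = C by rewrite -[X in X *m C](mulmx_base P1) -mulmxA RC mulmx1.
have wE : (fun i : 'I_N => ones_mnm N m i) = @ones_weight N m.
  by apply: funext => i; rewrite mnmE.
have memP v : @has_weight K N m d L (@ones_weight N m) v <-> P1 *m v = v.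
  by rewrite -wE; apply: has_weightP.
pose f (v : schur_functor mN L) := (R *m val v)^T.
have vP (v : schur_functor mN L) : P1 *m val v = val v.
  by case: v => v /= /asboolP/memP.
have g_in (x : 'rV[K]_(\rank P1)) : @has_weight K N m d L (@ones_weight N m) (C *m x^T).
  by apply/memP; rewrite mulmxA P1C.
pose g x : schur_functor mN L := SubCarrier (asboolT (g_in x)).
exists (\rank P1), f, (fun s => (R *m A (ext_perm_mx K N s) *m C)^T); split; last first.
  by move=> s; rewrite mxtrace_tr -mulmxA mxtrace_mulC -mulmxA CR.
split.
- by move=> a u v; rewrite /f /= mulmxDr -scalemxAr linearD linearZ.
- exists g => [v|x].
    by apply: val_inj; rewrite /= trmxK mulmxA CR vP.
  by rewrite /f /= mulmxA RC mul1mx trmxK.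
- move=> s v; rewrite /f -trmx_mul; congr trmx.
  by rewrite -[_ *m C *m _]mulmxA (mulmxA C) CR vP -mulmxA.
Qed.

End SchurCoordinates.

(** * Traces on the skew Specht module *)

(** Elements of corresponding fibres are matched by their positions in the enumerations. *)
Lemma fibre_injection (X Y A : finType) (f : X -> A) (g : Y -> A) :
    (forall a, #|[set x | f x == a]| = #|[set y | g y == a]|) ->
  exists h : {ffun X -> Y}, injective h /\ forall x, g (h x) = f x.
Proof.
move=> card_fg; pose sX a := enum [set x | f x == a]; pose sY a := enum [set y | g y == a].
have sXY a : size (sX a) = size (sY a) by rewrite -!cardE card_fg.
have /choice[h hP] x : exists y, g y = f x /\ index y (sY (f x)) = index x (sX (f x)).
  have ix : (index x (sX (f x)) < size (sY (f x)))%N.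
    by rewrite -sXY index_mem mem_enum inE.
  case e: (sY (f x)) ix => [//|y0 s] ix.
  exists (nth y0 (sY (f x)) (index x (sX (f x)))); rewrite e; split.
    have : nth y0 (y0 :: s) (index x (sX (f x))) \in sY (f x) by rewrite e mem_nth.
    by rewrite mem_enum inE => /eqP.
  by rewrite index_uniq // -e enum_uniq.
exists [ffun x => h x]; split=> [x x'|x]; rewrite !ffunE; last by have [] := hP x.
have [gx ix] := hP x; have [gx' ix'] := hP x' => e.
have fxx : f x = f x' by rewrite -gx -gx' e.
have mX z : z \in sX (f z) by rewrite mem_enum inE.
rewrite -(nth_index x (mX x)) -(nth_index x (mX x')) -ix -ix' e fxx.
by [].
Qed.

Lemma lspan_inj (K : fieldType) (V W : lmodType K) (f : V -> W) (G : V -> Prop) v :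
    linear f -> injective f ->
    lspan (fun w => exists2 u, G u & w = f u) (f v) -> lspan G v.
Proof.
move=> f_lin f_inj; have f0 : f 0 = 0 by have := f_lin (-1) 0 0; rewrite !scaleN1r !addNr.
suff H w : lspan (fun w => exists2 u, G u & w = f u) w -> exists2 u, lspan G u & w = f u.
  by case/H=> u Gu /f_inj ->.
elim=> {w} [|_ [u Gu ->]|a _ _ _ [u Gu ->] _ [u' Gu' ->]].
- by exists 0; [exact: lspan_zero|rewrite f0].
- by exists u => //; apply: lspan_gen.
- by exists (a *: u + u'); [apply: lspan_lin|rewrite f_lin].
Qed.

Section SkewTraces.
Variables (K : fieldType) (natK : forall a, a.+1%:R != 0 :> K).
Variables (k n : nat) (k2 : (2 <= k)%N) (N : nat).
Local Notation m := (mdeg n.+1 k).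
Hypothesis mN : (m <= N)%N.
Local Notation cbox := (cbox k n).
Local Notation row := (@crow k n).
Local Notation col := (@ccol k n).
Local Notation W := (filling_module K cbox m).
Local Notation sym := (symmetrize K row col).
Variable c : 'I_m -> 'I_N.
Local Notation mu := (content_mnm c).
Local Notation stab := (young_stab c).

Definition filling_content (T : {ffun cbox -> 'I_N}) : 'X_{1..N} :=
  [multinom #|[set b | T b == a]| | a < N].

Lemma content_fperm T s : filling_content (fperm T s) = filling_content T.
Proof.
apply/mnmP => a; rewrite !mnmE -[RHS](card_preimset _ (@perm_inj _ s)).
by apply: eq_card => b; rewrite !inE ffunE.
Qed.

Lemma card_cbox_m : #|{: cbox}| = m.
Proof. by rewrite card_cbox ?(ltnW k2) // /mdeg subn1 mulnC. Qed.

Lemma injective_bij (T : {ffun cbox -> 'I_m}) : injective T -> bijective T.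
Proof. by move=> T_inj; apply: inj_card_bij => //; rewrite card_ord card_cbox_m. Qed.

Lemma content_relabel (T : {ffun cbox -> 'I_m}) : injective T ->
  filling_content (relabel c T) = mu.
Proof.
move=> T_inj; apply/mnmP => a; rewrite !mnmE -(on_card_preimset (f := T)).
  by apply: eq_card => b; rewrite !inE ffunE.
by apply: onW_bij; apply: injective_bij.
Qed.

(** A filling by colours with the content of [c] comes from a bijective filling by letters. For
    another content any bijection is taken, so that [lift] is total. *)
Lemma lifting_exists (S : {ffun cbox -> 'I_N}) : exists T : {ffun cbox -> 'I_m},
  injective T /\ (filling_content S = mu -> relabel c T = S).
Proof.
have [/mnmP e|ne] := eqVneq (filling_content S) mu.
  have [|T [T_inj cT]] := @fibre_injection _ _ _ S c.
    by move=> a; have := e a; rewrite !mnmE.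
  by exists T; split=> // _; apply/ffunP => b; rewrite ffunE cT.
have [|T [T_inj _]] := @fibre_injection cbox 'I_m unit (fun=> tt) (fun=> tt).
  by case; rewrite !cardsE !eq_cardT // -!cardT card_cbox_m card_ord.
by exists T; split=> // e; rewrite e eqxx in ne.
Qed.

Let lift S := projT1 (cid (lifting_exists S)).
Let lift_inj S : injective (lift S). Proof. by rewrite /lift; case: cid => T []. Qed.
Let liftK S : filling_content S = mu -> relabel c (lift S) = S.
Proof. by rewrite /lift; case: cid => T []. Qed.

Lemma young_stab1 : stab 1%g.
Proof. by apply/forallP => i; rewrite perm1. Qed.

Lemma young_stabM s t : stab s -> stab (s * t)%g = stab t.
Proof.
move=> /forallP sc; apply/forallP/forallP => tc i; last by rewrite permM (eqP (tc _)).
by have := tc (s^-1%g i); rewrite permM permKV -(eqP (sc (s^-1%g i))) permKV.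
Qed.

Lemma orbit_sum_act (v : W) s : stab s -> orbit_sum stab (act s v) = orbit_sum stab v.
Proof.
move=> sc; rewrite /orbit_sum [RHS](reindex_inj (mulgI s)) /=.
by apply: eq_big => [t|t _]; rewrite ?young_stabM // letter_actM.
Qed.

(** Two bijective fillings with the same colours differ by a permutation of the letters in
    [stab]. *)
Lemma orbit_sum_relabel (T T' : {ffun cbox -> 'I_m}) : injective T -> injective T' ->
  relabel c T = relabel c T' -> orbit_sum stab (sym T : W) = orbit_sum stab (sym T' : W).
Proof.
move=> T_inj T'_inj /ffunP e; have [g TK gK] := injective_bij T_inj.
have s_inj : injective (fun i => T' (g i)).
  by move=> i j /T'_inj /(can_inj gK).
pose s := perm s_inj.
have -> : sym T' = act s (sym T : W).
  rewrite /= /letter_act relabel_symmetrize; congr symmetrize.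
  by apply/ffunP => b; rewrite ffunE permE TK.
rewrite orbit_sum_act //; apply/forallP => i; rewrite permE -{2}[i]gK.
by have := e (g i); rewrite !ffunE => ->.
Qed.

(** Independent of the choice of [lift] by [orbit_sum_relabel]. The default 0 is compatible with
    straightening, since rearranging a filling keeps its content. *)
Let F (S : {ffun cbox -> 'I_N}) : W :=
  if filling_content S == mu then orbit_sum stab (sym (lift S) : W) else 0.

Let F_relabel (T : {ffun cbox -> 'I_m}) : injective T ->
  F (relabel c T) = orbit_sum stab (sym T : W).
Proof.
move=> T_inj; rewrite /F content_relabel // eqxx; apply: orbit_sum_relabel => //.
by rewrite liftK // content_relabel.
Qed.

Let fperm_inj (T : {ffun cbox -> 'I_m}) s : injective T -> injective (fperm T s).
Proof. by move=> T_inj b b'; rewrite !ffunE => /T_inj/perm_inj. Qed.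

Let F_straight S :
  lspan (fun v => exists2 s, semistd row col (fperm S s) & v = F (fperm S s)) (F S).
Proof.
apply: straightening => //.
- exact: cbox_inj.
- move=> {}S b b' neq cbb'; have [e|ne] := eqVneq (filling_content S) mu; last first.
    by rewrite /F content_fperm (negbTE ne) oppr0.
  rewrite -(liftK e) -relabel_fperm !F_relabel //; last exact: fperm_inj.
  rewrite symmetrize_alt //; have := @orbit_sum_linear _ _ W stab (-1) (sym (lift S)) 0.
  have o0 : orbit_sum stab (0 : W) = 0.
    by have := @orbit_sum_linear _ _ W stab (-1) 0 0; rewrite !scaleN1r !addNr.
  by rewrite !scaleN1r o0 !addr0.
- move=> {}S b0 b1 r01 c01; have [e|ne] := eqVneq (filling_content S) mu; last first.
    by rewrite big1 // => s _; rewrite /F content_fperm (negbTE ne) scaler0.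
  rewrite -(liftK e).
  rewrite (eq_bigr (fun s : {perm cbox} =>
    orbit_sum stab ((-1) ^+ s *: sym (fperm (lift S) s) : W))).
    rewrite /orbit_sum exchange_big big1 //= => s _.
    have := symmetrize_garnir natK (@cgarnir_rows k n k2) (lift S) r01 c01.
    move/(congr1 (letter_act s)); rewrite /letter_act raddf_sum /= => ->.
    by rewrite /relabel_space big1 // => T _; rewrite ffunE scale0r.
  move=> s _; rewrite -relabel_fperm F_relabel; last exact: fperm_inj.
  by rewrite /orbit_sum scaler_sumr; apply: eq_bigr => t _; rewrite actZ.
Qed.

Lemma orbit_sum_val (v : skew_module K row col m) :
  val (orbit_sum stab v) = orbit_sum stab (val v : W).
Proof. by rewrite /orbit_sum raddf_sum. Qed.

Definition semistd_content : {set {ffun cbox -> 'I_N}} :=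
  [set S | semistd row col S & filling_content S == mu].

(** The orbit sums of the semistandard coloured fillings of content [mu] span by straightening. They
    are independent because merging the letters of one colour turns each of them into [#|stab|]
    times a skew polytabloid over the colours, where [symmetrize_free] applies. *)
Theorem skew_young_trace d (f : skew_module K row col m -> 'rV[K]_d) r :
  coordinates f r ->
  \sum_(s | stab s) \tr (r s) = #|stab|%:R * #|semistd_content|%:R.
Proof.
move=> cf.
have sym_in (T : {ffun cbox -> 'I_m}) : injective T ->
    @span_of K m W (@is_symmetrized K cbox row col m) (sym T).
  by move=> T_inj; apply/lspan_span_of/lspan_gen; exists T.
pose b S : skew_module K row col m := SubCarrier (asboolT (sym_in _ (@lift_inj S))).
have bF S : S \in semistd_content -> F S = orbit_sum stab (sym (lift S) : W).
  by rewrite inE /F => /andP[_ ->].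
apply: (subgroup_trace natK (b := b) cf young_stab1 young_stabM).
- move=> x x0 S SD.
  pose y S : K := if S \in semistd_content then x S * #|stab|%:R else 0.
  have S0 : #|stab|%:R != 0 :> K.
    have : (0 < #|stab|)%N by apply/card_gt0P; exists 1%g; apply: young_stab1.
    by case: #|_| => // a _; apply: natK.
  suff : y S = 0 by rewrite /y SD => /eqP; rewrite mulf_eq0 (negbTE S0) orbF => /eqP.
  have ssS : semistd row col S by move: SD; rewrite inE => /andP[].
  apply: (symmetrize_free natK (@cbox_inj k n k2) (@cbox_convex k n k2)) ssS.
  rewrite (bigID (mem semistd_content)) /= [X in _ + X]big1 ?addr0; last first.
    by move=> T /andP[_ /negbTE nT]; rewrite /y nT scale0r.
  have {x0} := congr1 (fun v : skew_module K row col m => relabel_space c (val v)) x0.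
  have z : relabel_space c (0 : filling_space K cbox m) = 0.
    by rewrite /relabel_space big1 // => T _; rewrite ffunE scale0r.
  pose h (v : skew_module K row col m) := relabel_space c (val v).
  have h_lin : linear h by move=> a u v; rewrite /h -relabel_space_linear.
  have h_sum (D : {set {ffun cbox -> 'I_N}}) g :
      h (\sum_(T in D) x T *: g T) = \sum_(T in D) x T *: h (g T).
    by elim/big_rec2: _ => [|T u v _ <-]; [apply: z|apply: h_lin].
  rewrite -!/(h _) h_sum [h 0]z => x0; rewrite -[RHS]x0; apply: eq_big => T.
    by rewrite /= inE; case: semistd.
  move=> /andP[_ TD]; rewrite /y TD -scalerA; congr (_ *: _).
  rewrite /h orbit_sum_val /orbit_sum [RHS]raddf_sum /=.
  transitivity (\sum_(s | stab s) sym T); first by rewrite sumr_const scaler_nat.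
  apply: eq_bigr => s /forallP sc; apply/esym.
  rewrite /letter_act relabel_space_comp relabel_symmetrize; congr symmetrize.
  have ct : filling_content T = mu by move: TD; rewrite inE => /andP[_ /eqP].
  by rewrite -[RHS](liftK ct); apply/ffunP => l; rewrite !ffunE /= (eqP (sc _)).
- case=> v /= vP; have /asboolP/lspan_span_of H := vP.
  apply: (lspan_inj (f := fun u : skew_module K row col m => val u)) => //.
    exact: val_inj.
  rewrite orbit_sum_val /=.
  apply: (lspan_map (@orbit_sum_linear _ _ W stab) _ H) => _ [T T_inj ->].
  rewrite -F_relabel //; apply: lspan_trans (F_straight (relabel c T)).
  move=> _ [s ss ->]; apply: lspan_gen.
  have SD : fperm (relabel c T) s \in semistd_content.
    by rewrite inE ss content_fperm content_relabel // eqxx.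
  exists (orbit_sum stab (b (fperm (relabel c T) s))); last by rewrite orbit_sum_val bF.
  by exists (fperm (relabel c T) s).
Qed.

End SkewTraces.

(** * The skew Schur polynomial *)

Section SkewShape.
Variables (k n : nat) (k2 : (2 <= k)%N) (n0 : (0 < n)%N).
Local Notation la := (alpha_outer' n.+1 k).
Local Notation mu := (alpha_inner' n.+1 k).

Lemma count_iota_gt r a b : count (fun x => r < x)%N (iota a b) = (a + b - maxn a r.+1)%N.
Proof.
elim: b a => [|b IH] a; first by rewrite /= addn0; lia.
by rewrite /= IH; case: ltnP; lia.
Qed.

Lemma nth_conj_part (s : seq nat) r :
  nth 0%N (conj_part s) r = if (r < head 0 s)%N then count (fun x => r < x)%N s else 0%N.
Proof.
rewrite /conj_part; case: ltnP => rs; first by rewrite nth_mkseq.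
by rewrite nth_default // size_mkseq.
Qed.

Lemma head_alpha_outer : head 0%N (alpha_outer n.+1 k) = (n + k - 1)%N.
Proof.
rewrite /alpha_outer subn1 /= -nth0 nth_rev ?size_iota; last by lia.
by rewrite nth_iota; lia.
Qed.

Lemma nth_alpha_outer r : nth 0%N la r = minn k (n + k - 1 - r).
Proof.
rewrite nth_conj_part head_alpha_outer /alpha_outer subn1 /= count_rev count_iota_gt.
by case: ltnP; lia.
Qed.

Lemma nth_alpha_inner r : nth 0%N mu r = if (r < k - 2)%N then (k - 1 - r)%N else 0%N.
Proof.
rewrite nth_conj_part /alpha_inner /= count_rev count_iota_gt.
by case: ltnP; lia.
Qed.

Lemma size_alpha_outer : size la = (n + k - 1)%N.
Proof. by rewrite size_mkseq head_alpha_outer. Qed.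

Lemma head_alpha_outer' : head 0%N la = k.
Proof. by rewrite -nth0 nth_alpha_outer; lia. Qed.

Lemma box_exists (r c : nat) : (nth 0 mu r <= c < nth 0 la r)%N ->
  exists b : box la mu, box_row b = r /\ box_col b = c.
Proof.
move=> rc; have rl : (r < size la)%N.
  by move: rc; rewrite nth_alpha_outer size_alpha_outer; lia.
have cl : (c < head 0 la)%N.
  by move: rc; rewrite nth_alpha_outer head_alpha_outer'; lia.
by exists (exist _ (Ordinal rl, Ordinal cl) rc : box la mu).
Qed.

Lemma box_ext (b b' : box la mu) : box_row b = box_row b' -> box_col b = box_col b' -> b = b'.
Proof.
move=> er ec; apply: val_inj; rewrite [LHS]surjective_pairing [RHS]surjective_pairing.
by congr (_, _); apply: val_inj.
Qed.

Lemma box_bij : exists g : cbox k n -> box la mu,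
  bijective g /\ forall b, box_row (g b) = crow b /\ box_col (g b) = ccol b.
Proof.
have /choice[g gP] (b : cbox k n) :
    exists x : box la mu, box_row x = crow b /\ box_col x = ccol b.
  have [lc li v] := cboxP b; apply: box_exists.
  rewrite nth_alpha_inner nth_alpha_outer /crow.
  by case: ltnP; lia.
have /choice[h hP] (x : box la mu) :
    exists b : cbox k n, box_row x = crow b /\ box_col x = ccol b.
  have := valP x; rewrite nth_alpha_inner nth_alpha_outer -/(box_row x) -/(box_col x) => xP.
  have [||| b [cb ib]] := @cbox_exists k n (box_col x) (box_row x + box_col x - (k - 2)).
  - by move: xP; lia.
  - by move: xP; lia.
  - by move: xP; case: ltnP; lia.
  exists b; rewrite /crow cb ib; split=> //.
  by move: xP; case: ltnP; lia.
exists g; split=> //; exists h => [b|x].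
  have [er ec] := gP b; have [er' ec'] := hP (g b).
  by apply: (cbox_inj k2); rewrite -?er' -?ec'.
have [er ec] := gP (h x); have [er' ec'] := hP x.
by apply: box_ext; rewrite ?er ?ec.
Qed.

Variables (N m : nat) (c : 'I_m -> 'I_N).
Local Notation row := (@crow k n).
Local Notation col := (@ccol k n).

Lemma skew_schur_coef (w : 'X_{1..N}) :
  (skew_schur N la mu)@_w =
  #|[set S : {ffun cbox k n -> 'I_N} | semistd row col S
       & [multinom #|[set b | S b == a]| | a < N] == w]|%:R.
Proof.
have [g [[h gK hK] gP]] := box_bij.
pose G (T : {ffun box la mu -> 'I_N}) : {ffun cbox k n -> 'I_N} := [ffun b => T (g b)].
pose H (S : {ffun cbox k n -> 'I_N}) : {ffun box la mu -> 'I_N} := [ffun x => S (h x)].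
have GK : cancel G H by move=> T; apply/ffunP => x; rewrite !ffunE hK.
have HK : cancel H G by move=> S; apply/ffunP => b; rewrite !ffunE gK.
have ssG T : semistandard T = semistd row col (G T).
  apply/idP/idP => [ssT|ssT].
    apply/forallP => b; apply/forallP => b'; rewrite !ffunE.
    have /forallP/(_ (g b))/forallP/(_ (g b'))/andP[/implyP r_ /implyP c_] := ssT.
    have [er ec] := gP b; have [er' ec'] := gP b'; rewrite er ec er' ec' in r_ c_.
    apply/andP; split; apply/implyP => /andP[e1 e2]; first by apply: c_; rewrite e1.
    by apply: r_; rewrite e1 (eqP e2) ltnSn.
  apply/forallP => x; apply/forallP => x'.
  have [er ec] := gP (h x); have [er' ec'] := gP (h x'); rewrite !hK in er ec er' ec'.
  have TE y : T y = G T (h y) by rewrite ffunE hK.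
  rewrite er ec er' ec' !TE; apply/andP; split; apply/implyP => /andP[/eqP e1 e2].
    (* [semistandard] compares all pairs of boxes in a row, [semistd] adjacent ones. *)
    exact: (semistd_row (@cbox_inj k n k2) (@cbox_convex k n k2) ssT).
  exact: (semistd_col ssT).
rewrite raddf_sum /=.
transitivity (\sum_(S | semistd row col S)
   ([multinom #|[set b | S b == a]| | a < N] == w)%:R : int).
  rewrite [RHS](reindex G) /=; last by exists H => T _; [apply: GK|apply: HK].
  apply: eq_big => [T|T _]; first exact: ssG.
  rewrite mprodXE mcoeffX; congr (_ == _)%:R; apply/mnmP => a.
  rewrite mnm_sumE mnmE (reindex g) /=; last by exists h => b _; [apply: gK|apply: hK].
  rewrite -sum1_card [RHS]big_mkcond /=; apply: eq_bigr => b _.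
  by rewrite mnm1E inE ffunE; case: eqP.
rewrite -natr_sum -sum1_card; congr (_%:R); rewrite [RHS]big_mkcond [LHS]big_mkcond.
by apply: eq_bigr => S _; rewrite inE; case: semistd => //=; case: eqP.
Qed.

End SkewShape.

Lemma formal_character_coef (K : fieldType) (N m d : nat) (L : polyRep K N m d) (w : 'X_{1..N}) :
  (mpoly.mdeg w <= m)%N -> (formal_character L)@_w = (\dim (weight_space L w))%:R.
Proof.
rewrite -ltnS => wm; rewrite /formal_character raddf_sum /= (bigD1 (BMultinom wm)) //=.
rewrite mcoeffMn mcoeffX eqxx big1 ?addr0 // => v vw.
rewrite mcoeffMn mcoeffX; case: eqP => [e|]; last by rewrite mul0rn.
by case/eqP: vw; apply: val_inj.
Qed.

Lemma mdeg_content N m (c : 'I_m -> 'I_N) : mpoly.mdeg (content_mnm c) = m.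
Proof.
rewrite mdegE -[RHS]card_ord -sum1_card (partition_big c xpredT) //=.
by apply: eq_bigr => a _; rewrite mnmE -sum1_card; apply: eq_bigl => i; rewrite inE.
Qed.

(** * Alternating elements *)

Section SchurToSkew.
Variables (K : fieldType) (natK : forall a, a.+1%:R != 0 :> K).
Variables (k n : nat) (k2 : (2 <= k)%N) (n0 : (0 < n)%N) (N d : nat).
Local Notation m := (mdeg n.+1 k).
Hypothesis mN : (m <= N)%N.
Variable L : polyRep K N m d.
Hypothesis L_char : has_skew_schur_character L (alpha_outer' n.+1 k) (alpha_inner' n.+1 k).

Lemma mx_hom_trace_conj n1 (r : 'S_m -> 'M[K]_n1) g t :
  mx_hom r -> \tr (r (g ^ t)%g) = \tr (r g).
Proof.
move=> rH; have [_ rM] := rH.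
by rewrite conjgE !rM mxtrace_mulC -mulmxA mx_homV // mulmx1.
Qed.

(** The difference [D] of the traces is a class function. Its sums over Young subgroups vanish
    because the weight multiplicities of [L] and the numbers of semistandard fillings are
    coefficients of the same polynomial. *)
Theorem schur_surjects_skew :
  sm_surjects (schur_functor mN L) (skew_module K (@crow k n) (@ccol k n) m).
Proof.
have [n1 [f1 [r1 [c1 tr1]]]] := schur_coordinates natK mN L.
pose h (v : skew_module K (@crow k n) (@ccol k n) m) : filling_space K (cbox k n) m := val v.
have [n2 [f2 [r2 c2]]] : exists n2 (f2 : skew_module K (@crow k n) (@ccol k n) m -> 'rV[K]_n2) r2,
    coordinates f2 r2.
  by apply: (coordinates_exist (h := h)) => //; apply: val_inj.
apply: (sm_surjects_of_traces natK c1 c2) => s; apply/eqP; rewrite -subr_eq0; apply/eqP.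
pose D s := \tr (r1 s) - \tr (r2 s); rewrite -/(D s).
apply: (young_sums_eq0 natK) => [g t|c'].
  by rewrite /D !mx_hom_trace_conj //; apply: coordinates_hom; eassumption.
pose c i := widen_ord mN (c' i).
rewrite (eq_bigl (young_stab c)) => [|g]; last first.
  by apply: eq_forallb => i; rewrite (inj_eq (@widen_inj _ _ mN)).
rewrite /D sumrB (eq_bigr _ (fun g _ => tr1 g)) young_trace // (skew_young_trace natK k2 c c2).
apply/eqP; rewrite subr_eq0; apply/eqP; congr (_ * _%:R).
have /(congr1 (mcoeff (content_mnm c))) := L_char.
rewrite formal_character_coef ?mdeg_content // skew_schur_coef // => /eqP.
by rewrite Num.Theory.eqr_nat => /eqP.
Qed.

End SchurToSkew.

(** * Antisymmetrizers of Young subgroups *)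

Section AlternatingSums.
Variables (K : fieldType) (m : nat).
Implicit Types V W : symModule K m.

Definition alt_sum V (S : pred 'S_m) (v : V) : V := \sum_(s | S s) (-1) ^+ s *: act s v.

Lemma alt_sum_linear V S : linear (@alt_sum V S).
Proof.
move=> a u v; rewrite /alt_sum scaler_sumr -big_split; apply: eq_bigr => s _ /=.
by rewrite act_linear scalerDr !scalerA mulrC.
Qed.

Lemma alt_sum0 V S : alt_sum S (0 : V) = 0.
Proof. by have := @alt_sum_linear V S (-1) 0 0; rewrite !scaleN1r !addNr. Qed.

Lemma alt_sum_map V W (f : V -> W) S v : linear f -> equivariant f ->
  f (alt_sum S v) = alt_sum S (f v).
Proof.
move=> f_lin f_eq; have f0 : f 0 = 0 by have := f_lin (-1) 0 0; rewrite !scaleN1r !addNr.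
by rewrite /alt_sum; elim/big_rec2: _ => // s x y _ <-; rewrite f_lin f_eq.
Qed.

Lemma alt_sum_idem V (cls : 'I_m -> nat) (v : V) :
  alt_sum (class_perm cls) (alt_sum (class_perm cls) v) =
  #|class_perm cls|%:R *: alt_sum (class_perm cls) v.
Proof.
rewrite {1}/alt_sum (eq_bigr (fun=> alt_sum (class_perm cls) v)) => [|s Ss].
  by rewrite sumr_const scaler_nat.
rewrite /alt_sum (big_morph _ (actD s) (act0 V s)) scaler_sumr.
rewrite [RHS](reindex_inj (mulIg s)) /=; apply: eq_big => [t|t _]; first by rewrite class_permMr.
by rewrite actZ scalerA actM odd_permM -signr_addb addbC.
Qed.

End AlternatingSums.

Section FewColumns.
Variables (K : fieldType) (natK : forall a, a.+1%:R != 0 :> K).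
Variables (k n : nat) (k2 : (2 <= k)%N) (kn : (k <= n.+1)%N).
Local Notation m := (mdeg n.+1 k).
Local Notation cbox := (cbox k n).
Local Notation row := (@crow k n).
Local Notation col := (@ccol k n).

(* As k <= n.+1, row number k - 2 of the shape has k boxes. *)
Lemma full_row_boxes : exists b : 'I_k -> cbox, injective b /\ forall j, row (b j) = (k - 2)%N.
Proof.
have /choice[b bP] (j : 'I_k) : exists b : cbox, ccol b = j /\ cidx b = j.
  by apply: cbox_exists => //; [have := ltn_ord j; lia|case: eqP].
exists b; split=> [j j' e|j]; last by have [cb ib] := bP j; rewrite /crow cb ib addnK.
have [cj _] := bP j; have [cj' _] := bP j'.
by apply: val_inj; rewrite /= -cj -cj' e.
Qed.

(** For each column permutation [t], the letters at the images under [t] of the k boxes of the full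
    row lie in at most k - 1 classes, so two of them share a class. Exchanging these two reverses
    the sign, while on the filling it amounts to an exchange of two boxes in one row, which the row
    sum absorbs. *)
Lemma symmetrize_alt_sum (cls : 'I_m -> nat) (T : {ffun cbox -> 'I_m}) :
    (forall i, (cls i < k - 1)%N) -> injective T ->
  alt_sum (class_perm cls) (symmetrize K row col T : filling_module K cbox m) = 0.
Proof.
move=> cls_lt T_inj; have [b [b_inj b_row]] := full_row_boxes.
rewrite /alt_sum /=.
under eq_bigr => s _ do rewrite /letter_act relabel_symmetrize /symmetrize scaler_sumr.
rewrite exchange_big big1 //= => t ct.
have [j [j' [neq ecls]]] : exists j j' : 'I_k, j != j' /\ cls (T (t (b j))) = cls (T (t (b j'))).
  apply: contrapT => nex.
  have f_inj : injective (fun j => Ordinal (cls_lt (T (t (b j))))).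
    move=> j j' /(congr1 val) /= e; apply: contrapT => /eqP neq.
    by apply: nex; exists j, j'.
  have := leq_card _ f_inj; rewrite !card_ord; lia.
pose u := tperm (b j) (b j'); pose v := tperm (T (t (b j))) (T (t (b j'))).
have bneq : b j != b j' by rewrite (inj_eq b_inj).
have Tneq : T (t (b j)) != T (t (b j')) by rewrite (inj_eq T_inj) (inj_eq perm_inj).
have cv : class_perm cls v by apply: class_tperm.
have ru : class_perm row u by apply: class_tperm; rewrite !b_row.
have vT x : v (T (t x)) = T (t (u x)).
  rewrite /u /v; have Tt_inj : injective (fun x => T (t x)) by move=> ? ? /T_inj/perm_inj.
  by rewrite (inj_tperm (b j) (b j') x Tt_inj).
apply: (oppr_self natK); rewrite -sumrN [LHS](reindex_inj (mulgI v)) /=.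
apply: eq_big => [s|s _]; first by rewrite class_permMl.
rewrite odd_permM odd_tperm Tneq signr_addb expr1 mulN1r scaleNr; congr (- (_ *: _)).
rewrite [RHS](reindex_inj (mulIg u)) /=; apply: eq_big => [r|r _]; first by rewrite class_permMr.
congr (_ *: fvec _ _); apply/ffunP => x; rewrite !ffunE !permM.
by rewrite vT.
Qed.

Lemma skew_alt_sum (cls : 'I_m -> nat) (v : skew_module K row col m) :
  (forall i, (cls i < k - 1)%N) -> alt_sum (class_perm cls) v = 0.
Proof.
move=> cls_lt; apply: val_inj.
have -> : val (alt_sum (class_perm cls) v) =
    alt_sum (class_perm cls) (val v : filling_module K cbox m).
  exact: (@alt_sum_map _ _ (skew_module K row col m) (filling_module K cbox m) (fun v => val v)).
case: v => v /= /asboolP/lspan_span_of; elim=> {v} [|_ [T T_inj ->]|a u v _ IHu _ IHv].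
- exact: (@alt_sum0 K m (filling_module K cbox m)).
- exact: symmetrize_alt_sum.
- by rewrite alt_sum_linear IHu IHv scaler0 addr0.
Qed.

End FewColumns.

Section SpechtAlternating.
Variables (K : fieldType) (m : nat) (nu : seq nat).
Hypothesis nu_part : is_partition m nu.
Local Notation offset := (fun i : 'I_m => reshape_offset nu i).

Lemma partition_box (i : 'I_m) :
  (reshape_index nu i < size nu)%N /\ (reshape_offset nu i < head 0 nu)%N.
Proof.
have [nu_sorted _ /eqP sum_nu] := and3P nu_part.
have im : (i < sumn nu)%N by rewrite sum_nu.
have lt_off := reshape_offsetP im.
have idx := reshape_indexP im.
split=> //; apply: leq_trans lt_off _.
case: (nu) nu_sorted idx => // a s /= nu_path.
case: (reshape_index _ _) => //= j js; have geq_trans : transitive geq.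
  by move=> x y z xy yz; apply: leq_trans yz xy.
by have /allP := order_path_min geq_trans nu_path; apply; apply: mem_nth.
Qed.

Lemma column_stab1 : column_stab nu (1%g : 'S_m) =1 class_perm offset.
Proof. by move=> s; apply: eq_forallb => i; rewrite invg1 !perm1. Qed.

Lemma polytabloid1E : polytabloid K nu (1%g : 'S_m) =
  alt_sum (class_perm offset) (tabloid_vec K (tabloid nu (1%g : 'S_m)) : tabloid_module K m nu).
Proof.
rewrite /polytabloid /alt_sum; apply: eq_big => [s|s _]; first exact: column_stab1.
by congr (_ *: _); rewrite /= tabloid_act_vec.
Qed.

(** The coefficient of its own tabloid is 1: a permutation that keeps every box in its column and in
    its row is the identity. *)
Lemma polytabloid_neq0 : polytabloid K nu (1%g : 'S_m) <> 0.
Proof.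
have [_ _ /eqP sum_nu] := and3P nu_part.
move/ffunP/(_ (tabloid nu (1%g : 'S_m))); rewrite sum_ffunE (bigD1 1%g) /=; last first.
  by rewrite column_stab1 class_perm1.
rewrite [X in _ + X]big1 => [|s /andP[]].
  rewrite addr0 !ffunE mulg1 eqxx odd_perm1 => /eqP.
  by rewrite scale1r oner_eq0.
rewrite column_stab1 => /class_permP cs s1; rewrite !ffunE mul1g.
case: eqP => [e|_]; last exact: mulr0.
case/eqP: s1; apply/permP => p; rewrite perm1.
have [idx _] := partition_box p; have := e => /ffunP/(_ (Ordinal idx)).
rewrite !ffunE => /setP/(_ p).
rewrite (_ : p \in _ = true); last by apply/imsetP; exists p; rewrite ?inE ?perm1.
move/esym/imsetP => [p' /[!inE] /eqP /= ip' ep].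
suff pp' : p = p' by rewrite {1}pp' -ep.
apply: val_inj; rewrite /= -[LHS](reshape_indexK nu) -[RHS](reshape_indexK nu) ip'.
by congr flatten_index; rewrite -[RHS](cs p') -ep.
Qed.

(** The polytabloid of the identity is itself an alternating sum over the column group, so the
    antisymmetrizer multiplies it by the order of that group. *)
Lemma specht_alt_sum : (forall a, a.+1%:R != 0 :> K) ->
  ~ (forall v : specht K m nu, alt_sum (class_perm offset) v = 0).
Proof.
move=> natK alt0; apply: polytabloid_neq0.
have e_in : @span_of K m (tabloid_module K m nu) (@is_polytabloid K m nu)
    (polytabloid K nu (1%g : 'S_m)).
  by apply/lspan_span_of/lspan_gen; exists 1%g.
pose e : specht K m nu := SubCarrier (asboolT e_in).
have := congr1 val (alt0 e).
have -> : val (alt_sum (class_perm offset) e) =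
    alt_sum (class_perm offset) (val e : tabloid_module K m nu).
  exact: (@alt_sum_map _ _ (specht K m nu) (tabloid_module K m nu) (fun v => val v)).
rewrite /= polytabloid1E alt_sum_idem => /eqP; rewrite scaler_eq0 => /orP[|/eqP //].
have : (0 < #|class_perm offset|)%N by apply/card_gt0P; exists 1%g; apply: class_perm1.
by case: #|_| => // a _; rewrite (negbTE (natK a)).
Qed.

End SpechtAlternating.

Lemma alt_sum_sum_eq0 (K : fieldType) (m : nat) (S : pred 'S_m)
    (V W : symModule K m) :
  (forall x : sm_sum V W, alt_sum S x = 0) ->
  (forall v : V, alt_sum S v = 0) /\ (forall w : W, alt_sum S w = 0).
Proof.
move=> alt0; split=> [v|w].
  have := alt0 (v, 0); move/(congr1 fst) => /= <-; apply/esym.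
  exact: (@alt_sum_map _ _ (sm_sum V W) V (fun x => x.1)).
have := alt0 (0, w); move/(congr1 snd) => /= <-; apply/esym.
exact: (@alt_sum_map _ _ (sm_sum V W) W (fun x => x.2)).
Qed.

Lemma sm_iso_alt_sum (K : fieldType) (m : nat) (S : pred 'S_m) (V W : symModule K m) :
  sm_iso V W -> (forall v : V, alt_sum S v = 0) -> forall w : W, alt_sum S w = 0.
Proof.
case=> f f_eq [g fK gK] alt0 w; rewrite -[w]gK -(alt_sum_map _ _ (f := f)) //; last exact: linearP.
by rewrite alt0 linear0.
Qed.

Unset Implicit Arguments.

Theorem theorem6p1 (K : fieldType) (charK : [pchar K] =i pred0) (n k N : nat)
    (n2 : (2 <= n)%N) (k2 : (2 <= k)%N) (mN : (mdeg n k <= N)%N) :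
  (forall (d : nat) (L : polyRep K N (mdeg n k) d),
     has_skew_schur_character L (alpha_outer' n k) (alpha_inner' n k) ->
     sm_surjects (schur_functor mN L) (Lie K n (mdeg n k)))
  /\
  ((k <= n)%N ->
     forall C : symModule K (mdeg n k), is_gamma C -> sm_is_zero C).
Proof.
have natK a : a.+1%:R != 0 :> K by rewrite ((pcharf0P K).1 charK).
case: n n2 mN => // n n1 mN; have n0 : (0 < n)%N by [].
have skew_Lie := skew_module_surjects_Lie natK k2 n0.
split=> [d L L_char|kn C [[B _ rho_iso] [s [s_part C_iso] s_cols]]].
  exact: sm_surjects_trans (schur_surjects_skew natK k2 n0 mN L_char) skew_Lie.
(* An alternating sum over fewer than [k] classes kills the skew Specht module, hence its image
   [Lie], hence the summand [C]. *)
have C_alt (cls : 'I_(mdeg n.+1 k) -> nat) : (forall i, (cls i < k - 1)%N) ->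
    forall v : C, alt_sum (class_perm cls) v = 0.
  move=> cls_lt; apply: (alt_sum_sum_eq0 _).2; apply: sm_iso_alt_sum rho_iso _.
  have -> : rho K n.+1 k = Lie K n.+1 (mdeg n.+1 k) by rewrite /rho; case: (n) n0.
  case: skew_Lie => f f_eq f_onto v; have [u <-] := f_onto v.
  rewrite -(alt_sum_map _ _ (f := f)) //; last exact: linearP.
  by rewrite skew_alt_sum ?linear0.
(* Without constituents [C] is isomorphic to the space of row vectors of length 0. *)
case: s => [|nu s] in s_part C_iso s_cols.
  case: C_iso => f _ [g fK _] v; apply: (can_inj fK).
  by apply/rowP => -[].
have /= /andP[nu_part _] := s_part; have /= /andP[nu_cols _] := s_cols.
have nu_alt cls : (forall i, (cls i < k - 1)%N) ->
    forall v : specht K (mdeg n.+1 k) nu, alt_sum (class_perm cls) v = 0.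
  move=> cls_lt; apply: (alt_sum_sum_eq0 _).1.
  exact: sm_iso_alt_sum C_iso (C_alt cls cls_lt).
(* The classes are the columns of [nu], at most k - 1 in number, and this alternating sum does not
   vanish on its Specht module. *)
case: (specht_alt_sum nu_part natK); apply: nu_alt => i.
by have [_] := partition_box nu_part i; move=> /leq_trans; apply.
Qed.
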